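(* Let $\Phi:\mathbb R\to\mathbb R$ be a $2\pi$-periodic bounded function that is differentiable a.e. Then $\mathbb S_{\Phi}(z)$ has the finite angular limit $\Phi'(\arg\zeta)+i\cdot\mathbb H_{\Phi}(\arg\zeta)$ as $z\to\zeta$ for a.e. $\zeta\in\partial\mathbb D$.
   Context: $\mathbb D=\{z\in\mathbb C:|z|<1\}$; for $|\zeta|=1$, $\arg\zeta$ is the unique $\tau\in(-\pi,\pi]$ with $\zeta=e^{i\tau}$. For arbitrary functions $g,f$ on a compact interval $[a,b]$, the Riemann--Stieltjes integral $\int_a^b g\,df$ is the limit, as $\delta:=\max_k|t_k-t_{k-1}|\to0$, of the sums $\sum_{k=1}^p g(\tau_k)\,(f(t_k)-f(t_{k-1}))$ over partitions $a=t_0\le t_1\le\dots\le t_p=b$ and points $\tau_k\in[t_{k-1},t_k]$, provided a finite limit exists, uniform with respect to the partitions and the intermediate points (no monotonicity or bounded variation is assumed; complex-valued functions are allowed). For a $2\pi$-periodic bounded $\Phi:\mathbb R\to\mathbb R$ whose set of discontinuities has measure zero, the Schwartz--Stieltjes integral is $$\mathbb S_\Phi(z):=\frac1{2\pi}\int_{-\pi}^{\pi}\frac{e^{it}+z}{e^{it}-z}\,d\Phi(t),\qquad z\in\mathbb D .$$ The Hilbert--Stieltjes integral of $\Phi$ at $\tau$ is the principal value $$\mathbb H_\Phi(\tau):=\frac1{2\pi}\lim_{\varepsilon\to+0}\int_{\varepsilon\le|\tau-t|\le\pi}\frac{d\Phi(t)}{\tan\frac{\tau-t}{2}},$$ where the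 integral is the sum of the Riemann--Stieltjes integrals over $[\tau-\pi,\tau-\varepsilon]$ and $[\tau+\varepsilon,\tau+\pi]$, and $1/\tan(\pm\pi/2)$ is read as $\cot(\pm\pi/2)=0$. A path in $\mathbb D$ terminating at $\zeta\in\partial\mathbb D$ is nontangential if its part in a neighborhood of $\zeta$ lies inside an angle in $\mathbb D$ with vertex at $\zeta$; the angular limit at $\zeta$ is the limit along all nontangential paths to $\zeta$. *)

(* Defs.v *)
From HB Require Import structures.
From mathcomp Require Import all_boot all_order all_algebra.
From mathcomp Require Import complex.
From mathcomp Require Import all_classical all_reals all_analysis.

Set Implicit Arguments.
Unset Strict Implicit.
Unset Printing Implicit Defensive.

Import Order.TTheory GRing.Theory Num.Theory numFieldNormedType.Exports.

Local Open Scope classical_set_scope.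
Local Open Scope ring_scope.
Local Open Scope complex_scope.

(* The order of R[i] compares only numbers with equal imaginary parts and the
   norm of R[i] has values in R[i]; thus [`|z| < 1] is the usual inequality and
   [0 < e :> R[i]] says that e is a positive real.  The topology of the complex
   plane is the one of the alias [R[i]^o]. *)

Section RiemannStieltjes.
Context {R : realType} {K : numFieldType}.
Implicit Types (g f : R -> K) (a b : R) (I : K).

(* The partition t and the intermediate points s are given by sequences, of
   which only t 0, ..., t p and s 0, ..., s p.-1 matter; the point s k belongs
   to [t k, t (k + 1)]. *)
Definition tagged_partition a b (p : nat) (t s : nat -> R) : Prop :=
  [/\ t 0%N = a, t p = b &
      forall k, (k < p)%N -> t k <= s k <= t k.+1].

Definition RS_sum g f (p : nat) (t s : nat -> R) : K :=
  \sum_(k < p) g (s k) * (f (t k.+1) - f (t k)).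

Definition is_RSint g f a b I : Prop :=
  forall e : K, 0 < e -> exists2 d : R, 0 < d &
    forall (p : nat) (t s : nat -> R), tagged_partition a b p t s ->
      (forall k, (k < p)%N -> `|t k.+1 - t k| < d) ->
      `|RS_sum g f p t s - I| < e.

Definition RS_integrable g f a b : Prop := exists I, is_RSint g f a b I.

(* The value is meaningful only if [RS_integrable g f a b]. *)
Definition RSint g f a b : K := xget 0 [set I | is_RSint g f a b I].

End RiemannStieltjes.

Section Circle.
Context {R : realType}.
Implicit Types (t : R) (zeta : R[i]).

Definition expi t : R[i] := cos t +i* sin t.

Definition arg zeta : R := xget 0 [set t | - pi < t <= pi /\ zeta = expi t].

(* A subset of the unit circle is null for arc length iff its preimage under
   the bijection expi from ]-pi, pi] onto the circle is Lebesgue-null. *)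
Definition circle_ae (P : R[i] -> Prop) : Prop :=
  {ae @lebesgue_measure R, forall t, - pi < t <= pi -> P (expi t)}.

End Circle.

Section Transforms.
Context {R : realType}.
Implicit Types (Phi : R -> R) (z : R[i]) (tau eps t : R).

Definition schwartz_kernel z t : R[i] := (expi t + z) / (expi t - z).

Definition schwartz_exists Phi z : Prop :=
  RS_integrable (schwartz_kernel z) (fun t => (Phi t)%:C) (- pi) pi.

Definition schwartz Phi z : R[i] :=
  ((2 * pi)^-1)%:C *
  RSint (schwartz_kernel z) (fun t => (Phi t)%:C) (- pi) pi.

(* [cos / sin] rather than [1 / tan], so that the value is 0 at
   t = tau - pi and t = tau + pi. *)
Definition hilbert_kernel tau t : R :=
  cos ((tau - t) / 2) / sin ((tau - t) / 2).

Definition hilbert_trunc Phi tau eps : R :=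
  RSint (hilbert_kernel tau) Phi (tau - pi) (tau - eps) +
  RSint (hilbert_kernel tau) Phi (tau + eps) (tau + pi).

Definition hilbert_exists Phi tau : Prop :=
  (forall eps, 0 < eps <= pi ->
     RS_integrable (hilbert_kernel tau) Phi (tau - pi) (tau - eps) /\
     RS_integrable (hilbert_kernel tau) Phi (tau + eps) (tau + pi)) /\
  cvg (hilbert_trunc Phi tau eps @[eps --> 0^'+]).

Definition hilbert Phi tau : R :=
  (2 * pi)^-1 * lim (hilbert_trunc Phi tau eps @[eps --> 0^'+]).

End Transforms.

Section AngularLimit.
Context {R : realType}.
Implicit Types (z zeta L : R[i]) (gamma : R -> R[i]).

Definition disk : set R[i] := [set z | `|z| < 1].

Definition disk_path gamma zeta : Prop :=
  [/\ {within `[0%R, 1%R], continuous (gamma : R -> R[i]^o)},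
      forall t : R, 0 <= t < 1 -> disk (gamma t) &
      gamma 1 = zeta].

(* The part within distance rho of zeta of the angle with vertex zeta bounded
   by the rays of directions alpha and beta. *)
Definition sector zeta (alpha beta rho : R) : set R[i] :=
  [set z | exists r theta : R,
     [/\ 0 < r < rho, alpha < theta < beta & z = zeta + r%:C * expi theta]].

(* The inclusion of the sector in the disk forces its two sides not to be
   tangent to the circle. *)
Definition nontangential gamma zeta : Prop :=
  exists alpha beta rho : R,
    [/\ alpha < beta, 0 < rho, sector zeta alpha beta rho `<=` disk &
        \forall z \near (zeta : R[i]^o),
          forall t : R, 0 <= t < 1 -> gamma t = z -> sector zeta alpha beta rho z].

Definition angular_limit (F : R[i] -> R[i]) zeta L : Prop :=
  forall gamma, disk_path gamma zeta -> nontangential gamma zeta ->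
    (F (gamma t) : R[i]^o) @[t --> 1^'-] --> (L : R[i]^o).

End AngularLimit.

(* Main.v *)
(* By integration by parts, S(z) is the integral of Phi against the derivative of
   the Schwartz kernel, with Phi replaced by its upper semicontinuous envelope F so
   that Lebesgue integrals make sense.  At a point tau of differentiability the
   real part tends to Phi'(tau) in every Stolz angle (Fatou), while the imaginary
   part differs from the Hilbert integral truncated at |z - e^{i tau}| by o(1).
   It remains to show that the imaginary part has a radial limit at almost every
   tau: this makes the truncated Hilbert integrals converge, hence also the
   imaginary part in every Stolz angle.

   Points of differentiability lie in the sets E_m of those tau for which
   |Phi t - Phi tau| <= m |t - tau| for all t.  The m-Lipschitz minorant Psi of Phi
   agrees with Phi on E_m.  For F - Psi the integral converges absolutely at almost
   every tau in E_m, because with beta = (F - Psi) / 2m the Marcinkiewicz integral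
   of beta(t) / ((t - tau)^2 + beta(t)^2) is finite by Tonelli.  For Psi, the
   Fourier coefficients c_n satisfy sum n^2 |c_n|^2 < oo, so Psi has an absolutely
   continuous conjugate function K; the imaginary part of S_Psi is the real part of
   S_K, and Fatou applies to K. *)

(* Differentiability at tau alone does not settle the imaginary part: an increment o(|t - tau|)
   against a kernel of size (t - tau)^-2 leaves an integral that may diverge. Hence the detour
   through a decomposition valid for almost every tau.

   The sets E_m enter only as a pointwise hypothesis on tau. The summand beta(t)^2 in the
   denominator makes the Marcinkiewicz kernel, as a function of tau, a Cauchy kernel of mass at most
   pi for each t; so its integral in t is finite for almost every tau, in E_m or not. For tau in E_m
   one has beta(t) <= |t - tau|, and the kernel dominates beta(t) / (2 (t - tau)^2).

   Phi need not have bounded variation. The Riemann-Stieltjes integrals exist because the kernels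
   are continuously differentiable: after integration by parts the error of a sum of mesh below d is
   at most a constant times the integral of the oscillation of Phi at scale d, which tends to 0 with
   d by continuity almost everywhere.

   The affine part of F at tau is integrated exactly, by explicit primitives of the kernels; only
   the excess over it is estimated. *)
Require Import Defs.
From HB Require Import structures.
From mathcomp Require Import all_boot all_order all_algebra.
From mathcomp Require Import complex.
From mathcomp Require Import all_classical all_reals all_analysis.
From mathcomp Require Import ring lra measurable_realfun.
Import Order.TTheory GRing.Theory Num.Theory numFieldNormedType.Exports.
Local Open Scope classical_set_scope.
Local Open Scope ring_scope.

Set Implicit Arguments.
Unset Strict Implicit.

(** * Derivatives and integrals over intervals *)

Section RealDerivatives.
Context {R : realType}.
Implicit Types (f g : R -> R) (x df dg c : R).

Lemma rderiv_cst c x : is_derive x 1 (fun _ : R => c) 0.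
Proof. exact: is_derive_cst. Qed.

Lemma rderiv_id x : is_derive x 1 (fun t : R => t) 1.
Proof. exact: is_derive_id. Qed.

Lemma rderivD f g x df dg : is_derive x 1 f df -> is_derive x 1 g dg ->
  is_derive x 1 (fun t => f t + g t) (df + dg).
Proof. exact: is_deriveD. Qed.

Lemma rderivN f x df : is_derive x 1 f df -> is_derive x 1 (fun t => - f t) (- df).
Proof. exact: is_deriveN. Qed.

Lemma rderivB f g x df dg : is_derive x 1 f df -> is_derive x 1 g dg ->
  is_derive x 1 (fun t => f t - g t) (df - dg).
Proof. exact: is_deriveB. Qed.

Lemma rderivM f g x df dg : is_derive x 1 f df -> is_derive x 1 g dg ->
  is_derive x 1 (fun t => f t * g t) (f x * dg + g x * df).
Proof. exact: is_deriveM. Qed.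

Lemma rderivZ f x df c : is_derive x 1 f df ->
  is_derive x 1 (fun t => c * f t) (c * df).
Proof. exact: is_deriveZ. Qed.

Lemma rderiv_comp f g x df dg :
  is_derive x 1 g dg -> is_derive (g x) 1 f df ->
  is_derive x 1 (fun t => f (g t)) (dg * df).
Proof. by move=> hg hf; rewrite mulrC; exact: (@is_derive1_comp _ f g). Qed.

Lemma rderivV f x df : f x != 0 -> is_derive x 1 f df ->
  is_derive x 1 (fun t => (f t)^-1) (- df / (f x) ^+ 2).
Proof.
move=> fx0 hf; apply: (is_derive_eq (is_deriveV fx0 hf)).
by rewrite /GRing.scale /= mulrC mulrN mulNr.
Qed.

Lemma rderiv_div f g x df dg : g x != 0 ->
  is_derive x 1 f df -> is_derive x 1 g dg ->
  is_derive x 1 (fun t => f t / g t) ((df * g x - f x * dg) / (g x) ^+ 2).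
Proof.
move=> gx0 hf hg; apply: (is_derive_eq (rderivM hf (rderivV gx0 hg))).
by field.
Qed.

Lemma rderiv_sin f x df : is_derive x 1 f df ->
  is_derive x 1 (fun t => sin (f t)) (df * cos (f x)).
Proof. by move=> hf; apply: (@rderiv_comp sin). Qed.

Lemma rderiv_cos f x df : is_derive x 1 f df ->
  is_derive x 1 (fun t => cos (f t)) (- (df * sin (f x))).
Proof.
move=> hf; rewrite -mulrN; exact: (@rderiv_comp cos).
Qed.

Lemma rderiv_cont f x df : is_derive x 1 f df -> {for x, continuous f}.
Proof. by case=> d _; exact/differentiable_continuous/derivable1_diffP. Qed.

End RealDerivatives.

(** * Lebesgue integrals of bounded measurable functions over compact intervals *)

Section IntervalIntegral.
Context {R : realType}.
Local Notation mu := (@lebesgue_measure R).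
Implicit Types (f g : R -> R) (a b c M : R).

(** This class is closed under products and contains the continuous functions, so it discharges
    every integrability side condition below. *)
Definition bmfun a b f : Prop :=
  measurable_fun `[a, b] f /\
  exists M : R, forall x, a <= x <= b -> `|f x| <= M.

Lemma bmfun_itg a b f : bmfun a b f -> mu.-integrable `[a, b] (EFin \o f).
Proof.
move=> [mf [M fM]]; apply: measurable_bounded_integrable => //.
- by rewrite /= lebesgue_measure_itv /=; case: ifPn => // _; rewrite -EFinB ltry.
- exists M; split; first exact: num_real.
  by move=> y My x /=; rewrite in_itv /= => /fM/le_trans -> //; exact: ltW.
Qed.

Lemma bmfun_cont a b f :
  (forall x, a <= x <= b -> {for x, continuous f}) -> bmfun a b f.
Proof.
move=> cf; have cf' : {within `[a, b], continuous f}.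
  by apply: continuous_in_subspaceT => x; rewrite inE /= in_itv /= => /cf.
split; first exact: subspace_continuous_measurable_fun.
have := compact_bounded (continuous_compact cf' (@segment_compact R a b)).
case=> M [_ /(_ (M + 1))]; rewrite ltrDl ltr01 => /(_ isT) MM.
by exists (M + 1) => x xab; apply: MM; exists x => //=; rewrite in_itv.
Qed.

Lemma bmfun_cst a b c : bmfun a b (fun=> c).
Proof. by apply: bmfun_cont => x _; exact: cst_continuous. Qed.

Lemma bmfunD a b f g : bmfun a b f -> bmfun a b g ->
  bmfun a b (fun x => f x + g x).
Proof.
move=> [mf [M fM]] [mg [N gN]]; split; first exact: measurable_funD.
exists (M + N) => x xab; rewrite (le_trans (ler_normD _ _))//.
by rewrite lerD ?fM ?gN.
Qed.

Lemma bmfunM a b f g : bmfun a b f -> bmfun a b g ->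
  bmfun a b (fun x => f x * g x).
Proof.
move=> [mf [M fM]] [mg [N gN]]; split; first exact: measurable_funM.
by exists (M * N) => x xab; rewrite normrM ler_pM ?fM ?gN.
Qed.

Lemma bmfunN a b f : bmfun a b f -> bmfun a b (fun x => - f x).
Proof.
move=> [mf [M fM]]; split; first exact: measurableT_comp.
by exists M => x xab; rewrite normrN fM.
Qed.

Lemma bmfunB a b f g : bmfun a b f -> bmfun a b g ->
  bmfun a b (fun x => f x - g x).
Proof. by move=> hf hg; apply: bmfunD => //; apply: bmfunN. Qed.

Lemma bmfun_norm a b f : bmfun a b f -> bmfun a b (fun x => `|f x|).
Proof.
move=> [mf [M fM]]; split; first exact: measurableT_comp.
by exists M => x xab; rewrite normr_id fM.
Qed.

Definition II a b f := Rintegral mu `[a, b] f.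

Lemma II_eq a b f g : (forall x, a <= x <= b -> f x = g x) ->
  II a b f = II a b g.
Proof.
by move=> fg; apply: eq_Rintegral => x; rewrite inE /= in_itv /= => /fg.
Qed.

Lemma IID a b f g : bmfun a b f -> bmfun a b g ->
  II a b (fun x => f x + g x) = II a b f + II a b g.
Proof. by move=> hf hg; apply: RintegralD => //; exact: bmfun_itg. Qed.

Lemma IIB a b f g : bmfun a b f -> bmfun a b g ->
  II a b (fun x => f x - g x) = II a b f - II a b g.
Proof. by move=> hf hg; apply: RintegralB => //; exact: bmfun_itg. Qed.

Lemma IIZ a b f c : bmfun a b f -> II a b (fun x => c * f x) = c * II a b f.
Proof. by move=> hf; apply: RintegralZl => //; exact: bmfun_itg. Qed.

Lemma IIN a b f : bmfun a b f -> II a b (fun x => - f x) = - II a b f.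
Proof.
move=> hf; rewrite -[RHS]mulN1r -IIZ//.
by apply: II_eq => x _; rewrite mulN1r.
Qed.

Lemma II_cst a b c : a <= b -> II a b (fun=> c) = c * (b - a).
Proof.
move=> ab; rewrite /II Rintegral_cst//= lebesgue_measure_itv /=.
case: ifPn => [_|]; first by rewrite -EFinB.
by rewrite lte_fin -leNgt => ba; rewrite (@le_anti _ _ a b) ?ab// subrr.
Qed.

Lemma le_II a b f g : bmfun a b f -> bmfun a b g ->
  (forall x, a <= x <= b -> f x <= g x) -> II a b f <= II a b g.
Proof.
move=> hf hg fg; apply: le_Rintegral (bmfun_itg hf) (bmfun_itg hg) _ => //.
Qed.

Lemma II_ge0 a b f : (forall x, a <= x <= b -> 0 <= f x) -> 0 <= II a b f.
Proof.
by move=> f0; apply: Rintegral_ge0 => x /=; rewrite in_itv /= => /f0.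
Qed.

Lemma le_norm_II a b f g : bmfun a b f -> bmfun a b g ->
  (forall x, a <= x <= b -> `|f x| <= g x) -> `|II a b f| <= II a b g.
Proof.
move=> hf hg fg; apply: (@le_trans _ _ (II a b (fun x => `|f x|))).
  by apply: le_normr_Rintegral => //; exact: bmfun_itg.
by apply: le_II => //; exact: bmfun_norm.
Qed.

Lemma II_split a b c f : a <= c <= b -> bmfun a b f ->
  II a b f = II a c f + II c b f.
Proof.
move=> /andP[ac cb] hf; apply/eqP; rewrite addrC -subr_eq; apply/eqP.
rewrite /II (@Rintegral_itvB _ f (BLeft a) (BRight b) c) ?bnd_simp//.
- rewrite Rintegral_itv_obnd_cbnd//.
  apply: integrableS (bmfun_itg hf) => //.
  by apply: subset_itv; rewrite bnd_simp.
- exact: bmfun_itg.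
Qed.

Lemma II_point a f : II a a f = 0.
Proof. by rewrite /II set_itv1 Rintegral_set1. Qed.

Lemma II_FTC a b f g : a <= b ->
  (forall x, a <= x <= b -> is_derive x 1 g (f x)) ->
  (forall x, a <= x <= b -> {for x, continuous f}) ->
  II a b f = g b - g a.
Proof.
rewrite le_eqVlt => /predU1P[-> _ _|ab dg cf]; first by rewrite II_point subrr.
rewrite /II /Rintegral (@continuous_FTC2 _ f g a b) //=.
- by apply: continuous_in_subspaceT => x; rewrite inE /= in_itv /= => /cf.
- split.
  + move=> x; rewrite in_itv /= => /andP[ax xb].
    by apply: ex_derive; apply: dg; rewrite !ltW.
  + apply: cvg_at_right_filter; apply: (@rderiv_cont _ g a (f a)).
    by apply: dg; rewrite lexx ltW.
  + apply: cvg_at_left_filter; apply: (@rderiv_cont _ g b (f b)).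
    by apply: dg; rewrite lexx ltW.
- move=> x; rewrite in_itv /= => /andP[ax xb].
  by rewrite derive1E; apply: derive_val; apply: dg; rewrite !ltW.
Qed.

End IntervalIntegral.

(** * Borel regularization of an almost everywhere continuous function *)

Section Regularization.
Context {R : realType}.
Local Notation mu := (@lebesgue_measure R).
Implicit Types (f Phi F : R -> R) (d M x y u : R).

Lemma aeS (P Q : R -> Prop) : (forall x, P x -> Q x) ->
  {ae mu, forall x, P x} -> {ae mu, forall x, Q x}.
Proof. by apply: filterS; exact: (ae_filter_ringOfSetsType mu). Qed.

Definition ballsup f d x := sup [set f y | y in ball x d].

Lemma ballsup_ge f d x y M : (forall t, `|f t| <= M) ->
  `|x - y| < d -> f y <= ballsup f d x.
Proof.
move=> fM xy; apply: ub_le_sup; last by exists y.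
by exists M => _ [t _ <-]; rewrite (le_trans (ler_norm _)).
Qed.

Lemma ballsup_le f d x u : 0 < d ->
  (forall y, `|x - y| < d -> f y <= u) -> ballsup f d x <= u.
Proof.
move=> d0 fu; apply: ge_sup.
  by exists (f x), x => //; exact: ballxx.
by move=> _ [y xy <-]; exact: fu.
Qed.

(** The supremum over open balls is lower semicontinuous: a point y of the ball with a < f y remains
    in the ball when the centre moves a little. *)
Lemma ballsup_measurable f d M : (forall t, `|f t| <= M) -> 0 < d ->
  measurable_fun setT (ballsup f d).
Proof.
move=> fM d0; apply/measurable_EFinP; apply: lower_semicontinuous_measurable.
move=> x a; rewrite /= lte_fin => /sup_gt[|_ [y xy <-] ay].
  by exists (f x), x => //; exact: ballxx.
exists (ball y d).
  by apply: open_nbhs_nbhs; split; [exact: ball_open|exact: ball_sym].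
move=> z zy; rewrite lte_fin (lt_le_trans ay)//.
by apply: (ballsup_ge fM); exact: ball_sym zy.
Qed.

(** This is sup f - inf f over the open ball; written with two suprema, it inherits measurability
    from [ballsup]. *)
Definition oscillation f d x := ballsup f d x + ballsup (fun t => - f t) d x.

Lemma oscillation_measurable f d M : (forall t, `|f t| <= M) -> 0 < d ->
  measurable_fun setT (oscillation f d).
Proof.
move=> fM d0; apply: measurable_funD; apply: ballsup_measurable => // t.
by rewrite normrN; exact: fM.
Qed.

Lemma oscillation_ge f d x y z M : (forall t, `|f t| <= M) ->
  `|x - y| < d -> `|x - z| < d -> f y - f z <= oscillation f d x.
Proof.
move=> fM xy xz; apply: lerD; first exact: ballsup_ge.
by apply: (@ballsup_ge (fun t => - f t) _ _ _ M) => // t; rewrite normrN.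
Qed.

Lemma oscillation_ge0 f d x M : (forall t, `|f t| <= M) -> 0 < d ->
  0 <= oscillation f d x.
Proof.
move=> fM d0; rewrite -(subrr (f x)).
by apply: (@oscillation_ge _ _ _ _ _ M) => //; rewrite subrr normr0.
Qed.

Lemma oscillation_le f d x M : (forall t, `|f t| <= M) -> 0 < d ->
  oscillation f d x <= 2 * M.
Proof.
move=> fM d0; rewrite mulr_natl mulr2n lerD// ballsup_le// => y _.
- exact: le_trans (ler_norm _) (fM _).
- by rewrite (le_trans (ler_norm _))// normrN.
Qed.

Lemma oscillation_cvg f x M : (forall t, `|f t| <= M) ->
  {for x, continuous f} ->
  oscillation f n.+1%:R^-1 x @[n --> \oo] --> 0.
Proof.
move=> fM fx; apply/cvgrPdist_le => e e0.
have e20 : 0 < e / 2 by rewrite divr_gt0.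
have /cvgrPdist_le/(_ _ e20) := fx.
move=> [d /= d0 fd].
near=> n; rewrite sub0r normrN ger0_norm; last exact: (oscillation_ge0 _ fM).
have nd : n.+1%:R^-1 < d by near: n; exact: near_infty_natSinv_lt (PosNum d0).
have H y : `|x - y| < n.+1%:R^-1 -> `|f x - f y| <= e / 2.
  by move=> xy; apply: fd => /=; apply: lt_trans nd.
suff : ballsup f n.+1%:R^-1 x <= f x + e / 2 /\
       ballsup (fun t => - f t) n.+1%:R^-1 x <= - f x + e / 2.
  by rewrite /oscillation; case=> ? ?; lra.
by split; apply: ballsup_le => // y /H; rewrite ler_norml => /andP[? ?]; lra.
Unshelve. all: by end_near. Qed.

(* [F] agrees with [Phi] where [Phi] is continuous, and at the other points it
   lies between the lower and upper limits of [Phi]; hence every local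
   inequality on [Phi] passes to [F], which is moreover Borel. *)
Definition regularized Phi F : Prop :=
  [/\ measurable_fun setT F,
      exists M, forall x, `|Phi x| <= M,
      {ae mu, forall x, {for x, continuous Phi}},
      forall x u, (\forall y \near x, Phi y <= u) -> F x <= u &
      forall x u, (\forall y \near x, u <= Phi y) -> u <= F x].

Lemma regularized_continuous Phi M : (forall x, `|Phi x| <= M) ->
  continuous Phi -> regularized Phi Phi.
Proof.
move=> PM cP; split.
- exact: continuous_measurable_fun.
- by exists M.
- exact/aeW.
- by move=> x u /nbhs_singleton.
- by move=> x u /nbhs_singleton.
Qed.

(** [infs _ 0] is the infimum over all n: the upper limit of f at x, with the value f x included. *)
Definition usc_envelope f x := infs (fun n => ballsup f n.+1%:R^-1 x) 0.

Lemma regularized_envelope Phi M : (forall x, `|Phi x| <= M) ->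
  {ae mu, forall x, {for x, continuous Phi}} ->
  regularized Phi (usc_envelope Phi).
Proof.
move=> PM cP.
have lb x : has_lbound (range (fun n => ballsup Phi n.+1%:R^-1 x)).
  exists (Phi x) => _ [n _ <-]; apply: (ballsup_ge PM).
  by rewrite subrr normr0.
split => //; first 2 last.
- move=> x u [d /= d0 Pu]; near \oo => n.
  have nd : n.+1%:R^-1 < d by near: n; exact: near_infty_natSinv_lt (PosNum d0).
  apply: (@le_trans _ _ (ballsup Phi n.+1%:R^-1 x)).
    apply: ge_inf; last by exists n.
    case: (lb x) => m mP; exists m => _ [k _ <-].
    by apply: mP; exists k.
  by apply: ballsup_le => // y xy; apply: Pu => /=; apply: lt_trans nd.
- move=> x u [d /= d0 Pu]; apply: lb_le_inf.
    by exists (ballsup Phi 1%:R^-1 x), 0%N.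
  move=> _ [k _ <-]; apply: (@le_trans _ _ (Phi x)).
    by apply: Pu; exact: ballxx.
  by apply: (ballsup_ge PM); rewrite subrr normr0.
- apply: measurable_fun_infs => [x _|n]; first exact: lb.
  exact: (ballsup_measurable PM).
- by exists M.
Unshelve. all: by end_near. Qed.

Lemma regularized_bound Phi F M : regularized Phi F ->
  (forall x, `|Phi x| <= M) -> forall x, `|F x| <= M.
Proof.
move=> [_ _ _ FU FL] PM x; rewrite ler_norml; apply/andP; split.
- by apply: FL; near=> y; have := PM y; rewrite ler_norml => /andP[].
- by apply: FU; near=> y; have := PM y; rewrite ler_norml => /andP[].
Unshelve. all: by end_near. Qed.

Lemma regularized_bmfun Phi F a b : regularized Phi F -> bmfun a b F.
Proof.
move=> rF; have [mF [M PM] _ _ _] := rF; split; first exact: measurable_funTS.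
by exists M => x _; exact: (regularized_bound rF).
Qed.

(** For z close to x both y and z lie in the ball around x, so Phi z is within the oscillation of
    Phi y; this local inequality passes to F x. *)
Lemma regularized_osc Phi F d x y : regularized Phi F -> 0 < d ->
  `|x - y| < d -> `|F x - Phi y| <= oscillation Phi d x.
Proof.
move=> [_ [M PM] _ FU FL] d0 xy.
have nd : \forall z \near x, `|x - z| < d by exact: nbhsx_ballx.
rewrite ler_norml; apply/andP; split.
  rewrite lerBrDl; apply: FL; near=> z.
  have : Phi y - Phi z <= oscillation Phi d x.
    by apply: (oscillation_ge PM) => //; near: z.
  lra.
rewrite lerBlDl; apply: FU; near=> z.
have : Phi z - Phi y <= oscillation Phi d x.
  by apply: (oscillation_ge PM) => //; near: z.
lra.
Unshelve. all: by end_near. Qed.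

Lemma oscillation_bmfun Phi d M a b : (forall x, `|Phi x| <= M) -> 0 < d ->
  bmfun a b (oscillation Phi d).
Proof.
move=> PM d0; split.
  by apply: measurable_funTS; exact: (oscillation_measurable PM).
exists (2 * M) => x _; rewrite ger0_norm ?(oscillation_le _ PM)//.
exact: (oscillation_ge0 _ PM).
Qed.

(** A quantitative form of Lebesgue's criterion for Riemann integrability, by dominated convergence
    with the bound 2 M. *)
Lemma cvg_II_oscillation Phi M a b : (forall x, `|Phi x| <= M) ->
  {ae mu, forall x, {for x, continuous Phi}} ->
  II a b (oscillation Phi n.+1%:R^-1) @[n --> \oo] --> 0.
Proof.
move=> PM cP.
pose D : set R := `[a, b]%classic.
have [] := @dominated_convergence _ _ _ mu D (measurable_itv _)
  (fun n x => (oscillation Phi n.+1%:R^-1 x)%:E) (cst 0%E) (cst (2 * M)%:E).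
- move=> n; apply/measurable_EFinP/measurable_funTS.
  exact: (oscillation_measurable PM).
- exact: measurable_cst.
- apply: aeS cP => x cx _; apply: cvg_EFin; first exact: nearW.
  exact: (oscillation_cvg PM).
- have := @bmfun_itg _ a b _ (bmfun_cst a b (2 * M)).
  exact.
- apply/aeW => x n _ /=.
  rewrite lee_fin ger0_norm ?(oscillation_le _ PM)//.
  exact: (oscillation_ge0 _ PM).
move=> _ _; rewrite integral0 => h.
by have /fine_cvg := h.
Qed.

End Regularization.

(** * Integration by parts for Riemann-Stieltjes integrals *)

Section RSGeneral.
Context {R : realType} {K : numFieldType}.
Implicit Types (g f : R -> K) (a b c : R) (I : K) (t s : nat -> R).

Lemma tagged_le a b p t s : tagged_partition a b p t s ->
  forall i j, (i <= j <= p)%N -> t i <= t j.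
Proof.
move=> [_ _ ts] i j /andP[+ jp]; elim: j jp => [|j IH] jp.
  by rewrite leqn0 => /eqP ->.
rewrite leq_eqVlt => /predU1P[->//|]; rewrite ltnS => ij.
apply: le_trans (IH (ltnW jp) ij) _.
by have /andP[] := ts _ jp; exact: le_trans.
Qed.

Lemma fine_tagged_partition a b (d : R) : a <= b -> 0 < d -> exists p t s,
  tagged_partition a b p t s /\ forall k, (k < p)%N -> `|t k.+1 - t k| < d.
Proof.
move=> ab d0.
pose p := (Num.truncn ((b - a) / d)).+1.
have p0 : 0 < p%:R :> R by rewrite ltr0n.
pose h := (b - a) / p%:R.
have h0 : 0 <= h by rewrite divr_ge0 ?subr_ge0// ltW.
have hd : h < d.
  rewrite /h ltr_pdivrMr// mulrC -ltr_pdivrMr//.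
  by have := truncnS_gt ((b - a) / d).
pose t k := a + k%:R * h.
have tS k : t k.+1 = t k + h by rewrite /t -natr1 mulrDl mul1r addrA.
exists p, t, t; split; last first.
  by move=> k _; rewrite tS addrC addKr ger0_norm.
split.
- by rewrite /t mul0r addr0.
- by rewrite /t /h mulrC divfK ?gt_eqF// addrC subrK.
- by move=> k _; rewrite lexx tS lerDl.
Qed.

Lemma is_RSint_unique g f a b I J : a <= b ->
  is_RSint g f a b I -> is_RSint g f a b J -> I = J.
Proof.
move=> ab hI hJ; apply/eqP; apply/negPn/negP => IJ.
have e0 : 0 < `|I - J| / 2 by rewrite divr_gt0 ?normr_gt0 ?subr_eq0.
have [d d0 hd] := hI _ e0; have [d' d'0 hd'] := hJ _ e0.
have m0 : 0 < Num.min d d' by rewrite lt_min d0.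
have [p [t [s [tp ts]]]] := fine_tagged_partition ab m0.
have m1 : Num.min d d' <= d by rewrite ge_min lexx.
have m2 : Num.min d d' <= d' by rewrite ge_min lexx orbT.
have h1 := hd _ _ _ tp (fun k kp => lt_le_trans (ts k kp) m1).
have h2 := hd' _ _ _ tp (fun k kp => lt_le_trans (ts k kp) m2).
have : `|I - J| < `|I - J| / 2 + `|I - J| / 2.
  apply: le_lt_trans (ltrD h1 h2).
  by rewrite [X in _ <= X + _]distrC; exact: ler_distD.
by rewrite -splitr ltxx.
Qed.

Lemma RSint_eq g f a b I : a <= b -> is_RSint g f a b I -> RSint g f a b = I.
Proof.
move=> ab hI; rewrite /RSint; case: xgetP => [x _ hx|/(_ I)//].
exact: (is_RSint_unique ab hx hI).
Qed.

Lemma is_RSint_shift g f a b c I :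
  is_RSint (fun x => g (x + c)) (fun x => f (x + c)) a b I ->
  is_RSint g f (a + c) (b + c) I.
Proof.
move=> hI e e0; have [d d0 hd] := hI _ e0; exists d => // p t s [ta tb ts] td.
have := hd p (fun k => t k - c) (fun k => s k - c).
rewrite /RS_sum; under eq_bigr do rewrite !subrK.
apply.
- split; rewrite ?ta ?tb ?addrK// => k kp.
  by rewrite !lerD2r; exact: ts.
- by move=> k kp; rewrite opprB addrA subrK; exact: td.
Qed.

End RSGeneral.

(** * Existence of the integrals by parts, and translation *)

Section RSReal.
Context {R : realType}.
Local Notation mu := (@lebesgue_measure R).
Implicit Types (Phi F g : R -> R) (a b c d M x y u : R).

Lemma ler_normD_eq (x y z u v : R) : `|x| <= u -> `|y| <= v -> x + y = z ->
  `|z| <= u + v.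
Proof. by move=> xu yv <-; rewrite (le_trans (ler_normD _ _))// lerD. Qed.

(** Summation by parts splits the interval at the tag s. On [c, s] the error is the integral of (Phi
    c - F) g', on [s, e] that of (Phi e - F) g'. As the interval is shorter than d, both differences
    are bounded by the oscillation at scale d. *)
Lemma RS_interval_error Phi F g g' (a b C d c s e : R) : regularized Phi F -> 0 < d ->
  a <= c -> c <= s <= e -> e <= b -> e - c < d ->
  (forall x, a <= x <= b -> is_derive x 1 g (g' x)) ->
  (forall x, a <= x <= b -> {for x, continuous g'}) ->
  (forall x, a <= x <= b -> `|g' x| <= C) ->
  `|g s * (Phi e - Phi c) -
    (g e * Phi e - g c * Phi c - II c e (fun t => F t * g' t))|
  <= C * II c e (oscillation Phi d).
Proof.
move=> rF d0 ac /andP[cs se] eb ecd dg cg gC.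
have [_ [M PM] _ _ _] := rF.
have ce := le_trans cs se.
have cb := le_trans ce eb; have ae := le_trans ac ce.
have sb := le_trans se eb; have as_ := le_trans ac cs.
have bg' x y : a <= x -> y <= b -> bmfun x y g'.
  move=> ax yb; apply: bmfun_cont => z /andP[xz zy].
  by apply: cg; rewrite (le_trans ax xz) (le_trans zy yb).
have bF x y : bmfun x y F := regularized_bmfun x y rF.
have bo x y : bmfun x y (oscillation Phi d) := oscillation_bmfun x y PM d0.
have ftc x y : a <= x -> x <= y -> y <= b -> II x y g' = g y - g x.
  move=> ax xy yb; apply: II_FTC => // z /andP[xz zy].
  - by apply: dg; rewrite (le_trans ax xz) (le_trans zy yb).
  - by apply: cg; rewrite (le_trans ax xz) (le_trans zy yb).
have part x y v : a <= x -> x <= y -> y <= b -> c <= v <= e -> c <= x -> y <= e ->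
  `|Phi v * (g y - g x) - II x y (fun t => F t * g' t)|
    <= C * II x y (oscillation Phi d).
  move=> ax xy yb /andP[cv ve] cx ye.
  rewrite -ftc// -IIZ; last exact: bg'.
  rewrite -IIB; [|by apply: bmfunM; [exact: bmfun_cst|exact: bg']
                 |by apply: bmfunM; [exact: bF|exact: bg']].
  rewrite -IIZ//; apply: le_norm_II.
  - apply: bmfunB; first by apply: bmfunM; [exact: bmfun_cst|exact: bg'].
    by apply: bmfunM; [exact: bF|exact: bg'].
  - by apply: bmfunM; first exact: bmfun_cst.
  - move=> z /andP[xz zy]; rewrite -mulrBl normrM mulrC ler_pM//.
      by apply: gC; rewrite (le_trans ax xz) (le_trans zy yb).
    rewrite distrC; apply: (regularized_osc rF) => //.
    rewrite ltr_norml; apply/andP; split; lra.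
rewrite (@II_split _ c e s (fun t => F t * g' t)); first last.
- by apply: bmfunM; [exact: bF|exact: bg'].
- by rewrite cs.
rewrite (@II_split _ c e s (oscillation Phi d)) ?cs//.
have h1 : `|Phi c * (g s - g c) - II c s (fun t => F t * g' t)|
    <= C * II c s (oscillation Phi d) by apply: part => //; rewrite lexx.
have h2 : `|Phi e * (g e - g s) - II s e (fun t => F t * g' t)|
    <= C * II s e (oscillation Phi d) by apply: part => //; rewrite lexx andbT.
rewrite [leRHS]mulrDr -normrN.
by apply: (ler_normD_eq h1 h2); ring.
Qed.

Lemma RS_sum_error Phi F g g' (a b C d : R) p t s : regularized Phi F -> 0 < d ->
  tagged_partition a b p t s -> (forall k, (k < p)%N -> `|t k.+1 - t k| < d) ->
  (forall x, a <= x <= b -> is_derive x 1 g (g' x)) ->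
  (forall x, a <= x <= b -> {for x, continuous g'}) ->
  (forall x, a <= x <= b -> `|g' x| <= C) ->
  `|RS_sum g Phi p t s -
    (g b * Phi b - g a * Phi a - II a b (fun t => F t * g' t))|
  <= C * II a b (oscillation Phi d).
Proof.
move=> rF d0 tp td dg cg gC.
have [_ [M PM] _ _ _] := rF.
have tle := tagged_le tp; have [ta tb ts] := tp.
have at_ k : (k <= p)%N -> a <= t k <= b.
  by move=> kp; rewrite -ta -tb !tle// ?kp ?leqnn.
have bg' x y : a <= x -> y <= b -> bmfun x y g'.
  move=> ax yb; apply: bmfun_cont => z /andP[xz zy].
  by apply: cg; rewrite (le_trans ax xz) (le_trans zy yb).
suff H q : (q <= p)%N -> `|RS_sum g Phi q t s -
    (g (t q) * Phi (t q) - g a * Phi a - II a (t q) (fun t => F t * g' t))|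
  <= C * II a (t q) (oscillation Phi d).
  by have := H p (leqnn p); rewrite tb.
elim: q => [_|q IH qp].
  by rewrite ta /RS_sum big_ord0 !II_point !subrr normr0 mulr0.
have /andP[aq qb] := at_ _ (ltnW qp).
have /andP[aq1 q1b] := at_ _ qp.
have qq1 : t q <= t q.+1 by apply: tle; rewrite leqnSn.
rewrite /RS_sum big_ord_recr /=.
rewrite (@II_split _ a (t q.+1) (t q) (fun t => F t * g' t)) ?aq//; last first.
  by apply: bmfunM; [exact: regularized_bmfun rF|exact: bg'].
rewrite (@II_split _ a (t q.+1) (t q) (oscillation Phi d)) ?aq//; last first.
  exact: oscillation_bmfun PM d0.
have := RS_interval_error rF d0 aq (ts _ qp) q1b _ dg cg gC.
have tqd : t q.+1 - t q < d by have := td _ qp; rewrite ger0_norm// subr_ge0.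
move=> /(_ tqd) h2; have h1 := IH (ltnW qp).
by rewrite [leRHS]mulrDr; apply: (ler_normD_eq h1 h2); rewrite /RS_sum; ring.
Qed.

Lemma is_RSint_by_parts Phi F g g' a b : a <= b -> regularized Phi F ->
  (forall x, a <= x <= b -> is_derive x 1 g (g' x)) ->
  (forall x, a <= x <= b -> {for x, continuous g'}) ->
  is_RSint g Phi a b (g b * Phi b - g a * Phi a - II a b (fun t => F t * g' t)).
Proof.
move=> ab rF dg cg e e0.
have [_ [M PM] cP _ _] := rF.
have [_ [C0 gC0]] := bmfun_cont cg.
pose C := `|C0| + 1.
have C_gt0 : 0 < C by rewrite ltr_wpDl.
have gC x : a <= x <= b -> `|g' x| <= C.
  move=> /gC0/le_trans; apply; rewrite (le_trans (ler_norm _))//.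
  by rewrite lerDl.
have eC : 0 < e / C by rewrite divr_gt0.
have /cvgrPdist_lt/(_ _ eC)[n _ /(_ n (leqnn n))] := cvg_II_oscillation a b PM cP.
rewrite sub0r normrN => hn.
exists n.+1%:R^-1 => // p t s tp td.
apply: le_lt_trans (RS_sum_error rF _ tp td dg cg gC) _ => //.
by rewrite mulrC -ltr_pdivlMr// (le_lt_trans (ler_norm _)).
Qed.

(** Both sides are boundary terms minus the same Riemann-Stieltjes integral, whose definition is
    visibly invariant under translation. Thus F2 may be any regularization of the translate of Phi,
    not only the translate of F. *)
Lemma II_shift Phi F Phi2 F2 g g' a b c : a <= b ->
  regularized Phi F -> regularized Phi2 F2 ->
  (forall x, Phi2 x = Phi (x + c)) ->
  (forall x, is_derive x 1 g (g' x)) -> continuous g' ->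
  II (a + c) (b + c) (fun t => F t * g' t) =
  II a b (fun t => F2 t * g' (t + c)).
Proof.
move=> ab rF rF2 P2 dg cg.
have acbc : a + c <= b + c by rewrite lerD2r.
have h1 := is_RSint_by_parts acbc rF (fun x _ => dg x) (fun x _ => cg x).
have dg2 x : is_derive x 1 (fun y => g (y + c)) (g' (x + c)).
  have := rderiv_comp (rderivD (rderiv_id x) (rderiv_cst c x)) (dg (x + c)).
  by rewrite addr0 mul1r.
have cg2 x : {for x, continuous (fun y => g' (y + c))}.
  apply: (@continuous_comp _ _ _ (fun y => y + c) g'); last exact: cg.
  exact: (rderiv_cont (rderivD (rderiv_id x) (rderiv_cst c x))).
have h2 := is_RSint_by_parts ab rF2 (fun x _ => dg2 x) (fun x _ => cg2 x).
have Pe : Phi2 = (fun x => Phi (x + c)) by apply/funext.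
have h3 : is_RSint g Phi (a + c) (b + c)
   (g (b + c) * Phi2 b - g (a + c) * Phi2 a -
       II a b (fun t => F2 t * g' (t + c))).
  by apply: is_RSint_shift; rewrite -Pe.
have := is_RSint_unique acbc h1 h3; rewrite !P2; lra.
Qed.

End RSReal.

(** * The Schwartz kernel and its derivative *)

Section Kernel.
Context {R : realType}.
Implicit Types (x y t tau : R).

(* With z = x + iy and w = e^{it}: 1 - z / w = kU + i kV, kD = |w - z|^2, and
   (w + z) / (w - z) = kP - i kQ; kre + i kim is minus the derivative of the
   latter in t, the kernel left by integration by parts. *)
Definition kU x y t : R := 1 - x * cos t - y * sin t.
Definition kV x y t : R := x * sin t - y * cos t.
Definition kD x y t : R := kU x y t ^+ 2 + kV x y t ^+ 2.
Definition kP x y t : R := (1 - (x ^+ 2 + y ^+ 2)) / kD x y t.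
Definition kQ x y t : R := 2 * kV x y t / kD x y t.
Definition kre x y t : R :=
  (1 - (x ^+ 2 + y ^+ 2)) * (2 * kV x y t) / kD x y t ^+ 2.
Definition kim x y t : R :=
  (1 - (x ^+ 2 + y ^+ 2)) ^+ 2 / kD x y t ^+ 2 -
  (1 + (x ^+ 2 + y ^+ 2)) / kD x y t.

Lemma kD_dist x y t : kD x y t = (cos t - x) ^+ 2 + (sin t - y) ^+ 2.
Proof.
transitivity ((cos t - x) ^+ 2 + (sin t - y) ^+ 2 +
  (cos t ^+ 2 + sin t ^+ 2 - 1) * (x ^+ 2 + y ^+ 2 - 1)).
  by rewrite /kD /kU /kV; ring.
by rewrite cos2Dsin2 subrr mul0r addr0.
Qed.

Lemma kD_U x y t : kD x y t = x ^+ 2 + y ^+ 2 - 1 + 2 * kU x y t.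
Proof.
transitivity (x ^+ 2 + y ^+ 2 - 1 + 2 * kU x y t +
  (cos t ^+ 2 + sin t ^+ 2 - 1)); first by rewrite kD_dist /kU; ring.
by rewrite cos2Dsin2 subrr addr0.
Qed.

Lemma kU_gt0 x y t : x ^+ 2 + y ^+ 2 < 1 -> 0 < kU x y t.
Proof.
move=> xy1; have := kD_U x y t; have : 0 <= kD x y t.
  by rewrite addr_ge0 ?sqr_ge0.
lra.
Qed.

Lemma kD_gt0 x y t : x ^+ 2 + y ^+ 2 < 1 -> 0 < kD x y t.
Proof.
by move=> xy1; rewrite ltr_pwDl ?sqr_ge0// exprn_gt0// kU_gt0.
Qed.

Lemma kV_sqr x y t : (2 * kV x y t) ^+ 2 =
  2 * (1 + (x ^+ 2 + y ^+ 2)) * kD x y t - kD x y t ^+ 2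
  - (1 - (x ^+ 2 + y ^+ 2)) ^+ 2.
Proof.
have h := kD_U x y t; have h2 : kV x y t ^+ 2 = kD x y t - kU x y t ^+ 2.
  by rewrite /kD; ring.
rewrite exprMn h2; have -> : kU x y t = (kD x y t - (x ^+ 2 + y ^+ 2 - 1)) / 2 by lra.
by field.
Qed.

Lemma is_derive_kU x y t : is_derive t 1 (kU x y) (kV x y t).
Proof.
apply: (is_derive_eq (rderivB (rderivB (rderiv_cst 1 t)
  (rderivZ x (rderiv_cos (rderiv_id t)))) (rderivZ y (rderiv_sin (rderiv_id t))))).
by rewrite /kV; ring.
Qed.

Lemma is_derive_kV x y t : is_derive t 1 (kV x y) (1 - kU x y t).
Proof.
apply: (is_derive_eq (rderivB
  (rderivZ x (rderiv_sin (rderiv_id t))) (rderivZ y (rderiv_cos (rderiv_id t))))).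
by rewrite /kU; ring.
Qed.

Lemma is_derive_kD x y t : is_derive t 1 (kD x y) (2 * kV x y t).
Proof.
have dU := is_derive_kU x y t; have dV := is_derive_kV x y t.
apply: (is_derive_eq (rderivD (rderivM dU dU) (rderivM dV dV))); ring.
Qed.

Lemma is_derive_kQ x y t : kD x y t != 0 -> is_derive t 1 (kQ x y) (kim x y t).
Proof.
move=> D0; apply: (is_derive_eq (rderiv_div D0
  (rderivZ 2 (is_derive_kV x y t)) (is_derive_kD x y t))).
rewrite -expr2 kV_sqr /kim.
have -> : kU x y t = (kD x y t - (x ^+ 2 + y ^+ 2 - 1)) / 2.
  by have := kD_U x y t; lra.
by field; exact: D0.
Qed.

Lemma is_derive_ln_kD x y t : 0 < kD x y t ->
  is_derive t 1 (fun t => ln (kD x y t)) (kQ x y t).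
Proof.
by move=> Dt; exact: (rderiv_comp (is_derive_kD x y t) (is_derive1_ln Dt)).
Qed.

Lemma continuous_kim x y t : kD x y t != 0 -> {for t, continuous (kim x y)}.
Proof.
move=> D0; have D2 : kD x y t * kD x y t != 0 by rewrite mulf_neq0.
have dI := @rderivV _ (fun t => kD x y t * kD x y t) _ _ D2
  (rderivM (is_derive_kD x y t) (is_derive_kD x y t)).
have h := rderiv_cont (rderivB
  (rderivZ ((1 - (x ^+ 2 + y ^+ 2)) ^+ 2) dI)
  (rderivZ (1 + (x ^+ 2 + y ^+ 2)) (rderivV D0 (is_derive_kD x y t)))).
exact: h.
Qed.

Section Disk.
Variables x y : R.
Hypothesis xy1 : x ^+ 2 + y ^+ 2 < 1.

Let D0 t : kD x y t != 0. Proof. by rewrite gt_eqF// kD_gt0. Qed.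

Lemma is_derive_kP t : is_derive t 1 (kP x y) (- kre x y t).
Proof.
apply: (is_derive_eq (rderivZ (1 - (x ^+ 2 + y ^+ 2))
  (rderivV (D0 t) (is_derive_kD x y t)))).
by rewrite /kre; field; exact: D0.
Qed.

Lemma continuous_kre : continuous (kre x y).
Proof.
move=> t; have D2 : kD x y t * kD x y t != 0 by rewrite mulf_neq0.
have dI := @rderivV _ (fun t => kD x y t * kD x y t) _ _ D2
  (rderivM (is_derive_kD x y t) (is_derive_kD x y t)).
have h := rderiv_cont (rderivM
  (rderivZ (1 - (x ^+ 2 + y ^+ 2)) (rderivZ 2 (is_derive_kV x y t)))
  dI).
exact: h.
Qed.

(* t + 2 arg (1 - z e^{-it}) is a primitive of the Poisson kernel. *)
Lemma is_derive_kP_primitive t :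
  is_derive t 1 (fun t => t + 2 * atan (kV x y t / kU x y t)) (kP x y t).
Proof.
have U0 : kU x y t != 0 by rewrite gt_eqF// kU_gt0.
apply: (is_derive_eq (rderivD (rderiv_id t) (rderivZ 2 (rderiv_comp
  (rderiv_div U0 (is_derive_kV x y t) (is_derive_kU x y t)) (is_derive1_atan _))))).
have h : kV x y t ^+ 2 = kD x y t - kU x y t ^+ 2 by rewrite /kD; ring.
have -> : 1 + (kV x y t / kU x y t) ^+ 2 = kD x y t / kU x y t ^+ 2.
  by rewrite exprMn exprVn h; field.
rewrite -!expr2 h /kP.
have -> : kU x y t = (kD x y t - (x ^+ 2 + y ^+ 2 - 1)) / 2.
  by have := kD_U x y t; lra.
field; rewrite D0 /=; have := kU_gt0 t xy1; have := kD_U x y t => h1 h2.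
by rewrite gt_eqF//; lra.
Qed.

End Disk.

Lemma kV_2pi x y t : kV x y (t + 2 * pi) = kV x y t.
Proof. by rewrite /kV mulr_natl sinD2pi cosD2pi. Qed.

Lemma kU_2pi x y t : kU x y (t + 2 * pi) = kU x y t.
Proof. by rewrite /kU mulr_natl sinD2pi cosD2pi. Qed.

Lemma kD_2pi x y t : kD x y (t + 2 * pi) = kD x y t.
Proof. by rewrite /kD kU_2pi kV_2pi. Qed.

Lemma kP_2pi x y t : kP x y (t + 2 * pi) = kP x y t.
Proof. by rewrite /kP kD_2pi. Qed.

Lemma kQ_2pi x y t : kQ x y (t + 2 * pi) = kQ x y t.
Proof. by rewrite /kQ kV_2pi kD_2pi. Qed.

Lemma kre_2pi x y t : kre x y (t + 2 * pi) = kre x y t.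
Proof. by rewrite /kre kV_2pi kD_2pi. Qed.

Lemma kim_2pi x y t : kim x y (t + 2 * pi) = kim x y t.
Proof. by rewrite /kim kD_2pi. Qed.

Lemma le_sin_cos (w : R) : 0 <= w <= pi / 2 -> w * cos w <= sin w.
Proof.
move=> /andP[]; rewrite le_eqVlt => /predU1P[<- _|w0 wpi]; first by rewrite mul0r sin0.
have pi0 := pi_gt0 R.
have cs : {within `[0, w], continuous (@sin R)}.
  by apply: continuous_subspaceT => z; exact: continuous_sin.
have [c] := MVT w0 (fun z _ => is_derive_sin z) cs.
rewrite in_itv /= => /andP[c0 cw].
rewrite sin0 !subr0 => ->; rewrite mulrC ler_wpM2r ?(ltW w0)// ltW//.
rewrite ltr_cos// in_itv /= ltW//; lra.
Qed.

(** By the double angle formula and [le_sin_cos] at v / 2, sin v is at least v cos^2 (v / 2) = v (1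
    + cos v) / 2. *)
Lemma le_half_sin (v : R) : 0 <= v <= pi / 2 -> v / 2 <= sin v.
Proof.
move=> /andP[v0 vpi]; have pi0 := pi_gt0 R.
have hw : 0 <= v / 2 <= pi / 2 by apply/andP; split; lra.
have cw : 0 <= cos (v / 2) by apply: cos_ge0_pihalf; apply/andP; split; lra.
have cv : 0 <= cos v by apply: cos_ge0_pihalf; apply/andP; split; lra.
have vE : v = (v / 2) *+ 2 by rewrite -mulr_natr divfK.
have c2 : cos (v / 2) ^+ 2 = (1 + cos v) / 2.
  by rewrite [in RHS]vE cos_mulr2n -mulr_natr; field.
have sE : sin v = 2 * cos (v / 2) * sin (v / 2).
  by rewrite {1}vE sin_mulr2n -mulr_natr; ring.
have := ler_wpM2l cw (le_sin_cos hw).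
have -> : cos (v / 2) * (v / 2 * cos (v / 2)) = v / 2 * cos (v / 2) ^+ 2 by ring.
rewrite c2 sE => h; have := mulr_ge0 v0 cv; lra.
Qed.

Lemma kD_unit tau t : kD (cos tau) (sin tau) t = 2 * (1 - cos (t - tau)).
Proof.
rewrite kD_U cos2Dsin2 /kU cosB; ring.
Qed.

Lemma kim_unit tau t : kim (cos tau) (sin tau) t = - (2 / kD (cos tau) (sin tau) t).
Proof. by rewrite /kim cos2Dsin2 subrr expr0n /= mul0r sub0r. Qed.

(** The square root is the chord 2 sin (|t - tau| / 2). *)
Lemma kD_unit_ge tau t : `|t - tau| <= pi ->
  `|t - tau| / 2 <= Num.sqrt (kD (cos tau) (sin tau) t).
Proof.
move=> tpi; have pi0 := pi_gt0 R; rewrite kD_unit.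
set u := t - tau; rewrite -cos_norm.
have h : `|u| / 2 / 2 <= sin (`|u| / 2).
  by apply: le_half_sin; rewrite divr_ge0//= ler_pM2r.
have -> : 2 * (1 - cos `|u|) = (2 * sin (`|u| / 2)) ^+ 2.
  rewrite exprMn sin2cos2 {1}(_ : `|u| = (`|u| / 2) *+ 2).
    by rewrite cos_mulr2n -mulr_natr; ring.
  by rewrite -mulr_natr divfK.
rewrite sqrtr_sqr (le_trans _ (ler_norm _))//; lra.
Qed.

End Kernel.

(** * Kernel bounds in Stolz angles *)

Section KernelBounds.
Context {R : realType}.
Implicit Types (x y t tau a b w v eps K s : R).

Definition pdist (x1 y1 x2 y2 : R) := Num.sqrt ((x1 - x2) ^+ 2 + (y1 - y2) ^+ 2).

Lemma pdist_ge0 x1 y1 x2 y2 : 0 <= pdist x1 y1 x2 y2.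
Proof. exact: sqrtr_ge0. Qed.

Lemma pdistC x1 y1 x2 y2 : pdist x1 y1 x2 y2 = pdist x2 y2 x1 y1.
Proof. by rewrite /pdist -sqrrN opprB -[(y1 - y2) ^+ 2]sqrrN opprB. Qed.

Lemma pdist_triangle x1 y1 x2 y2 x3 y3 :
  pdist x1 y1 x3 y3 <= pdist x1 y1 x2 y2 + pdist x2 y2 x3 y3.
Proof.
have := @le_normcD R (Complex (x1 - x2) (y1 - y2)) (Complex (x2 - x3) (y2 - y3)).
by rewrite /= !addrA !subrK.
Qed.

Lemma pdist_circle x y t : pdist (cos t) (sin t) x y = Num.sqrt (kD x y t).
Proof. by rewrite /pdist kD_dist. Qed.

(** Here a = |e^{it} - z|, b = |e^{it} - e^{i tau}| and w = 1 - |z|^2, so the bracket is the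
    difference of [kim] at z and at e^{i tau}. Each term on the right has a factor w or a - b, both
    O(|z - e^{i tau}|), and b / a is bounded in a Stolz angle. *)
Lemma kernel_far_identity a b w : a != 0 -> b != 0 ->
  (w ^+ 2 / (a ^+ 2) ^+ 2 - (2 - w) / a ^+ 2 + 2 / b ^+ 2) * b ^+ 3 =
  w * (w / a) * (b / a) ^+ 3 + w * a * (b / a) ^+ 3
    + 2 * (b / a) * (1 + b / a) * (a - b).
Proof. by move=> a0 b0; field; rewrite a0. Qed.

(** Each of the three terms of the identity is at most 4 K^3 eps, whence the 12. *)
Lemma kernel_im_far a b w eps K : 0 < a -> 0 < b -> 1 <= K -> b <= K * a ->
  0 <= w -> w <= 2 * eps -> w <= 2 * a -> `|a - b| <= eps -> a <= 2 ->
  `|w ^+ 2 / (a ^+ 2) ^+ 2 - (2 - w) / a ^+ 2 + 2 / b ^+ 2| * b ^+ 3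
    <= 12 * K ^+ 3 * eps.
Proof.
move=> a0 b0 K1 bKa w0 weps wa abeps a2.
have e0 : 0 <= eps by exact: le_trans (normr_ge0 _) abeps.
have a0' := ltW a0; have b0' := ltW b0.
have b3 : 0 <= b ^+ 3 by rewrite exprn_ge0.
rewrite -[X in _ * X <= _](ger0_norm b3).
rewrite -normrM kernel_far_identity ?gt_eqF//.
have m0 : 0 <= b / a by rewrite divr_ge0.
have mK : b / a <= K by rewrite ler_pdivrMr.
have wa2 : w / a <= 2 by rewrite ler_pdivrMr.
have wa0 : 0 <= w / a by rewrite divr_ge0.
move: (b / a) m0 mK => m m0 mK.
move: (w / a) wa2 wa0 => i wa2 wa0.
have m3 : m ^+ 3 <= K ^+ 3 by rewrite lerXn2r// nnegrE (le_trans _ K1).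
have m30 : 0 <= m ^+ 3 by rewrite exprn_ge0.
have K3 : K ^+ 2 <= K ^+ 3 by rewrite ler_weXn2l.
have h1 : `|w * i * m ^+ 3| <= 4 * K ^+ 3 * eps.
  rewrite ger0_norm ?mulr_ge0//.
  have -> : 4 * K ^+ 3 * eps = (2 * eps) * 2 * K ^+ 3 by ring.
  by apply: ler_pM => //; [exact: mulr_ge0|exact: ler_pM].
have h2 : `|w * a * m ^+ 3| <= 4 * K ^+ 3 * eps.
  rewrite ger0_norm ?mulr_ge0//.
  have -> : 4 * K ^+ 3 * eps = (2 * eps) * 2 * K ^+ 3 by ring.
  by apply: ler_pM => //; [exact: mulr_ge0|exact: ler_pM].
have h3 : `|2 * m * (1 + m) * (a - b)| <= 4 * K ^+ 3 * eps.
  have m1 : 0 <= 2 * m * (1 + m) by rewrite !mulr_ge0// addr_ge0.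
  rewrite normrM (ger0_norm m1); apply: ler_pM => //.
  apply: (@le_trans _ _ (4 * K ^+ 2)); last by rewrite ler_pM2l.
  have : m * m <= K * K by rewrite ler_pM.
  have : m * 1 <= K * K by rewrite ler_pM.
  rewrite expr2; lra.
apply: le_trans (ler_normD _ _) _; apply: le_trans (lerD (ler_normD _ _) (lexx _)) _.
lra.
Qed.

Lemma kernel_re_far a b w v eps K : 0 < a -> 0 < b -> b <= K * a ->
  0 <= w -> w <= 2 * eps -> `|v| <= 2 * a ->
  `|w * v / (a ^+ 2) ^+ 2| * b ^+ 3 <= 12 * K ^+ 3 * eps.
Proof.
move=> a0 b0 bKa w0 weps va.
have K0 : 0 <= K by rewrite -(pmulr_lge0 _ a0) (le_trans (ltW b0)).
have e0 : 0 <= eps by rewrite -(@pmulr_rge0 _ 2)// (le_trans w0).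
have a0' := ltW a0; have b0' := ltW b0.
have b3 : 0 <= b ^+ 3 by rewrite exprn_ge0.
rewrite -[X in _ * X <= _](ger0_norm b3) -normrM.
have -> : w * v / (a ^+ 2) ^+ 2 * b ^+ 3 = w * (v / a) * (b / a) ^+ 3.
  by field; rewrite gt_eqF.
have m0 : 0 <= b / a by rewrite divr_ge0.
have mK : b / a <= K by rewrite ler_pdivrMr.
have m30 : 0 <= (b / a) ^+ 3 by rewrite exprn_ge0.
rewrite normrM (ger0_norm m30) normrM (ger0_norm w0).
rewrite normrM normrV ?unitfE ?gt_eqF// (gtr0_norm a0).
have va2 : `|v| / a <= 2 by rewrite ler_pdivrMr.
have va0 : 0 <= `|v| / a by rewrite divr_ge0.
have m3 : (b / a) ^+ 3 <= K ^+ 3 by rewrite lerXn2r.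
apply: (@le_trans _ _ (2 * eps * 2 * K ^+ 3)).
  by apply: ler_pM => //; [exact: mulr_ge0|exact: ler_pM].
have : 0 <= K ^+ 3 * eps by rewrite mulr_ge0 ?exprn_ge0.
lra.
Qed.

Lemma kernel_im_near a w : 0 < a -> 0 <= w <= 1 -> w <= 2 * a ->
  `|w ^+ 2 / (a ^+ 2) ^+ 2 - (2 - w) / a ^+ 2| * a ^+ 2 <= 6.
Proof.
move=> a0 /andP[w0 w1] wa.
have a0' := ltW a0; have a20 := sqr_ge0 a.
rewrite -[X in _ * X <= _](ger0_norm a20) -normrM.
have -> : (w ^+ 2 / (a ^+ 2) ^+ 2 - (2 - w) / a ^+ 2) * a ^+ 2 =
  (w / a) ^+ 2 - (2 - w) by field; rewrite gt_eqF.
have wa2 : w / a <= 2 by rewrite ler_pdivrMr.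
have wa0 : 0 <= w / a by rewrite divr_ge0// ltW.
have : (w / a) ^+ 2 <= 2 ^+ 2 by rewrite lerXn2r// nnegrE.
have := sqr_ge0 (w / a).
by rewrite ler_norml => h1 h2; apply/andP; split; lra.
Qed.

Lemma kernel_re_near a w v : 0 < a -> 0 <= w -> w <= 2 * a -> `|v| <= 2 * a ->
  `|w * v / (a ^+ 2) ^+ 2| * a ^+ 2 <= 6.
Proof.
move=> a0 w0 wa va.
have a0' := ltW a0; have a20 := sqr_ge0 a.
rewrite -[X in _ * X <= _](ger0_norm a20) -normrM.
have -> : w * v / (a ^+ 2) ^+ 2 * a ^+ 2 = (w / a) * (v / a).
  by field; rewrite gt_eqF.
rewrite !normrM (ger0_norm w0) normrV ?unitfE ?gt_eqF//.
rewrite (gtr0_norm a0).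
have va2 : `|v| / a <= 2 by rewrite ler_pdivrMr.
have wa2 : w / a <= 2 by rewrite ler_pdivrMr.
have va0 : 0 <= `|v| / a by rewrite divr_ge0.
have wa0 : 0 <= w / a by rewrite divr_ge0.
have : w / a * (`|v| / a) <= 2 * 2 by apply: ler_pM.
lra.
Qed.

(* In a Stolz angle |e^{it} - z| dominates both |t - tau| and |z - zeta|. *)
Definition stolz (C x y tau : R) : Prop :=
  x ^+ 2 + y ^+ 2 < 1 /\ pdist x y (cos tau) (sin tau) <= C * (1 - pdist x y 0 0).

Section Stolz.
Variables (C x y tau : R).
Hypothesis xyC : stolz C x y tau.
Let r : R := pdist x y 0 0.
Let eps : R := pdist x y (cos tau) (sin tau).
Let xy1 : x ^+ 2 + y ^+ 2 < 1 := xyC.1.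
Let r2 : x ^+ 2 + y ^+ 2 = r ^+ 2.
Proof. by rewrite /r /pdist !subr0 sqr_sqrtr// addr_ge0// sqr_ge0. Qed.
Let r0 : 0 <= r := pdist_ge0 _ _ _ _.
Let r1 : r < 1.
Proof. by rewrite -(@expr_lt1 _ 2)// -r2. Qed.

Lemma stolz_circle0 t : pdist (cos t) (sin t) 0 0 = 1.
Proof. by rewrite /pdist !subr0 cos2Dsin2 sqrtr1. Qed.

Lemma stolz_dist_le t : 1 - r <= Num.sqrt (kD x y t).
Proof.
rewrite -pdist_circle lerBlDr -(stolz_circle0 t).
exact: pdist_triangle.
Qed.

Lemma stolz_eps_ge : 1 - r <= eps.
Proof.
rewrite lerBlDr -(stolz_circle0 tau) /eps [pdist x y _ _]pdistC.
exact: pdist_triangle.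
Qed.

Lemma stolz_eps_gt0 : 0 < eps.
Proof. by apply: lt_le_trans stolz_eps_ge; rewrite subr_gt0. Qed.

Lemma stolz_C_ge1 : 1 <= C.
Proof.
have h : 0 < 1 - r by rewrite subr_gt0.
rewrite -(ler_pM2r h) mul1r; apply: le_trans stolz_eps_ge _; exact: xyC.2.
Qed.

Lemma stolz_weight : 0 <= 1 - (x ^+ 2 + y ^+ 2) <= 2 * (1 - r).
Proof. by rewrite r2; apply/andP; split; have := r0; have := r1; nra. Qed.

Lemma stolz_kV t : `|2 * kV x y t| <= 2 * Num.sqrt (kD x y t).
Proof.
rewrite -(@ler_pXn2r _ 2)// ?nnegrE ?mulr_ge0// -normrX ger0_norm ?sqr_ge0//.
have D0 := ltW (kD_gt0 t xy1).
rewrite exprMn [in leRHS]exprMn sqr_sqrtr// ler_pM2l ?exprn_gt0//.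
by rewrite /kD lerDr sqr_ge0.
Qed.

Section Far.
Variable t : R.
Hypothesis tpi : `|t - tau| <= pi.
Let s : R := `|t - tau|.
Let a : R := Num.sqrt (kD x y t).
Let b : R := Num.sqrt (kD (cos tau) (sin tau) t).
Let a2 : kD x y t = a ^+ 2. Proof. by rewrite sqr_sqrtr// ltW// kD_gt0. Qed.
Let b2 : kD (cos tau) (sin tau) t = b ^+ 2.
Proof. by rewrite sqr_sqrtr// addr_ge0// sqr_ge0. Qed.
Let a0 : 0 < a. Proof. by rewrite sqrtr_gt0 kD_gt0. Qed.
Let ale2 : a <= 2.
Proof.
rewrite /a -pdist_circle (le_trans (pdist_triangle _ _ 0 0 _ _))//.
by rewrite stolz_circle0 pdistC -/r; have := r1; lra.
Qed.
Let ab : `|a - b| <= eps.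
Proof.
rewrite ler_norml; apply/andP; split.
- have : b <= a + eps by rewrite /a /b -!pdist_circle; exact: pdist_triangle.
  lra.
- have : a <= b + eps.
    by rewrite /a /b -!pdist_circle /eps [X in _ + X]pdistC; exact: pdist_triangle.
  lra.
Qed.
Let epsa : eps <= C * a.
Proof.
apply: le_trans xyC.2 _; rewrite ler_pM2l; first exact: stolz_dist_le.
exact: lt_le_trans ltr01 stolz_C_ge1.
Qed.
Let bKa : b <= (C + 1) * a.
Proof. by have := ab; rewrite ler_norml => /andP[? ?]; have := epsa; lra. Qed.
Let sb : s <= 2 * b.
Proof. by have := kD_unit_ge tpi; rewrite -/b -/s; lra. Qed.
Let w_eps : 1 - (x ^+ 2 + y ^+ 2) <= 2 * eps.
Proof. by have /andP[_] := stolz_weight; have := stolz_eps_ge; lra. Qed.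
Let w_a : 1 - (x ^+ 2 + y ^+ 2) <= 2 * a.
Proof.
by have /andP[_] := stolz_weight; have := stolz_dist_le t; rewrite -/a; lra.
Qed.
Let w0 : 0 <= 1 - (x ^+ 2 + y ^+ 2).
Proof. by have /andP[] := stolz_weight. Qed.
Let w1 : 1 - (x ^+ 2 + y ^+ 2) <= 1.
Proof. by have := sqr_ge0 x; have := sqr_ge0 y; lra. Qed.
Let C1 := stolz_C_ge1.

Let kimE : kim x y t = (1 - (x ^+ 2 + y ^+ 2)) ^+ 2 / (a ^+ 2) ^+ 2 -
  (2 - (1 - (x ^+ 2 + y ^+ 2))) / a ^+ 2.
Proof. by rewrite /kim a2; congr (_ - _ / _); ring. Qed.

(** In this range the kernel is O(1 / a^2) = O(1 / eps^2), since eps <= C a, while the Cauchy kernel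
    on the right is at least 1 / (2 eps). *)
Let near_bound (k : R) : s <= eps -> `|k| * a ^+ 2 <= 6 ->
  s * `|k| <= 192 * (C + 1) ^+ 3 * (eps / (eps ^+ 2 + s ^+ 2)).
Proof.
move=> se ka; have e0 := stolz_eps_gt0.
have es0 : 0 < eps ^+ 2 + s ^+ 2 by rewrite ltr_pwDl ?sqr_ge0// exprn_gt0.
rewrite mulrA ler_pdivlMr//.
have s0 : 0 <= s by exact: normr_ge0.
have h1 : eps ^+ 2 + s ^+ 2 <= 2 * eps ^+ 2.
  have : s ^+ 2 <= eps ^+ 2 by rewrite lerXn2r// nnegrE ltW.
  lra.
have h2 : eps ^+ 2 <= C ^+ 2 * a ^+ 2.
  have C0 : 0 <= C := le_trans ler01 C1.
  have ca : 0 <= C * a := mulr_ge0 C0 (ltW a0).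
  by rewrite -exprMn lerXn2r// nnegrE ltW.
have h3 : eps ^+ 2 * `|k| <= 6 * C ^+ 2.
  apply: (@le_trans _ _ (C ^+ 2 * a ^+ 2 * `|k|)); first by rewrite ler_wpM2r.
  by rewrite -mulrA mulrC [_ * `|k|]mulrC ler_wpM2r// sqr_ge0.
have h4 : C ^+ 2 <= (C + 1) ^+ 3.
  apply: (@le_trans _ _ ((C + 1) ^+ 2)).
    by rewrite lerXn2r ?nnegrE ?lerDl//; have := C1; lra.
  by rewrite ler_weXn2l// lerDr (le_trans _ C1).
apply: (@le_trans _ _ (eps * `|k| * (2 * eps ^+ 2))).
  by rewrite ler_pM ?mulr_ge0 ?addr_ge0 ?sqr_ge0// ler_wpM2r.
have -> : eps * `|k| * (2 * eps ^+ 2) = 2 * (eps ^+ 2 * `|k|) * eps by ring.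
apply: ler_wpM2r; first exact: ltW.
have C10 : 0 <= C + 1 by have := C1; lra.
have := exprn_ge0 3 C10.
lra.
Qed.

(** The constant is 12 * 8 * 2: s^3 <= 8 b^3 because the chord b is at least s / 2, and eps^2 + s^2
    <= 2 s^2. *)
Let far_bound (k : R) : eps <= s -> `|k| * b ^+ 3 <= 12 * (C + 1) ^+ 3 * eps ->
  s * `|k| <= 192 * (C + 1) ^+ 3 * (eps / (eps ^+ 2 + s ^+ 2)).
Proof.
move=> se kb; have e0 := stolz_eps_gt0.
have es0 : 0 < eps ^+ 2 + s ^+ 2 by rewrite ltr_pwDl ?sqr_ge0// exprn_gt0.
rewrite mulrA ler_pdivlMr//.
have s0 : 0 <= s by exact: normr_ge0.
have h1 : eps ^+ 2 + s ^+ 2 <= 2 * s ^+ 2.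
  have : eps ^+ 2 <= s ^+ 2 by rewrite lerXn2r// nnegrE ltW.
  lra.
have h2 : s ^+ 3 <= 8 * b ^+ 3.
  have -> : 8 * b ^+ 3 = (2 * b) ^+ 3 by ring.
  by rewrite lerXn2r// nnegrE (le_trans s0).
apply: (@le_trans _ _ (s * `|k| * (2 * s ^+ 2))); first by rewrite ler_wpM2l// mulr_ge0.
have -> : s * `|k| * (2 * s ^+ 2) = 2 * (s ^+ 3 * `|k|) by ring.
have : s ^+ 3 * `|k| <= 8 * b ^+ 3 * `|k| by rewrite ler_wpM2r.
lra.
Qed.

Lemma kre_bound :
  s * `|kre x y t| <= 192 * (C + 1) ^+ 3 * (eps / (eps ^+ 2 + s ^+ 2)).
Proof.
have kV2 := stolz_kV t; rewrite -/a in kV2.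
rewrite /kre a2; have [se|/ltW es] := leP s eps.
  by apply: near_bound => //; apply: kernel_re_near.
apply: far_bound => //; apply: kernel_re_far => //.
have : eps <= 2 * b by exact: le_trans sb.
by have := stolz_eps_gt0; lra.
Qed.

Lemma kim_bound_near : s <= eps ->
  s * `|kim x y t| <= 192 * (C + 1) ^+ 3 * (eps / (eps ^+ 2 + s ^+ 2)).
Proof.
move=> se; apply: near_bound => //; rewrite kimE; apply: kernel_im_near => //.
by rewrite w0.
Qed.

Lemma kim_bound_far : eps <= s ->
  s * `|kim x y t + 2 / kD (cos tau) (sin tau) t|
    <= 192 * (C + 1) ^+ 3 * (eps / (eps ^+ 2 + s ^+ 2)).
Proof.
move=> es; apply: far_bound => //; rewrite kimE b2; apply: kernel_im_far => //.
- have : eps <= 2 * b by exact: le_trans sb.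
  by have := stolz_eps_gt0; lra.
- by have := C1; lra.
Qed.

End Far.
End Stolz.
End KernelBounds.

(** * Comparison at a point of differentiability *)

Section Comparison.
Context {R : realType}.
Local Notation mu := (@lebesgue_measure R).
Implicit Types (Phi F G : R -> R) (a b c d x y t tau A M C e eps : R).

Lemma is_derive_cauchy c d t : 0 < d ->
  is_derive t 1 (fun t => atan ((t - c) / d)) (d / (d ^+ 2 + (t - c) ^+ 2)).
Proof.
move=> d0; have d0' : d != 0 by rewrite gt_eqF.
have dl := rderivM (rderivB (rderiv_id t) (rderiv_cst c t)) (rderiv_cst d^-1 t).
apply: (is_derive_eq (rderiv_comp dl (is_derive1_atan _))).
have h : 0 < d ^+ 2 + (t - c) ^+ 2 by rewrite ltr_pwDl ?sqr_ge0// exprn_gt0.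
rewrite subr0 mulr0 add0r mulr1.
by field; rewrite d0' gt_eqF.
Qed.

Lemma continuous_cauchy c d : 0 < d ->
  continuous (fun t => d / (d ^+ 2 + (t - c) ^+ 2)).
Proof.
move=> d0 t.
have h : 0 < d ^+ 2 + (t - c) ^+ 2 by rewrite ltr_pwDl ?sqr_ge0// exprn_gt0.
have h' : d * d + (t - c) * (t - c) != 0 by rewrite gt_eqF// -!expr2.
have dl := rderivB (rderiv_id t) (rderiv_cst c t).
have := rderiv_cont (rderivZ d (@rderivV _ (fun t => d * d + (t - c) * (t - c)) _ _ h'
  (rderivD (rderiv_cst (d * d) t) (rderivM dl dl)))).
exact.
Qed.

Lemma II_cauchy a b c d : a <= b -> 0 < d ->
  II a b (fun t => d / (d ^+ 2 + (t - c) ^+ 2)) <= pi.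
Proof.
move=> ab d0; rewrite (II_FTC ab (fun t _ => is_derive_cauchy c t d0)).
  have := atan_ltpi2 ((b - c) / d); have := atan_gtNpi2 ((a - c) / d); lra.
by move=> t _; exact: continuous_cauchy.
Qed.

(** The value p is a separate parameter so that the expansion of Phi, with p = Phi tau, can be
    handed over to F unchanged. *)
Definition approx_by_line F tau p A : Prop :=
  forall e, 0 < e -> exists2 d, 0 < d &
    forall t, `|t - tau| < d -> `|F t - p - A * (t - tau)| <= e * `|t - tau|.

Lemma derivable_approx Phi tau : derivable Phi tau 1 ->
  approx_by_line Phi tau (Phi tau) ('D_1 Phi tau).
Proof.
move=> dP e e0; have /cvgrPdist_le/(_ _ e0) := dP.
rewrite -/('D_1 Phi tau) => -[d /= d0 H]; exists d => // t td.
have [->|tt] := eqVneq t tau; first by rewrite !subrr mulr0 subr0 normr0 mulr0.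
have h0 : t - tau != 0 by rewrite subr_eq0.
have := H (t - tau); rewrite /= sub0r normrN => /(_ td h0).
rewrite /GRing.scale /= mulr1 subrK => h.
have -> : Phi t - Phi tau - 'D_1 Phi tau * (t - tau) =
  (t - tau) * - ('D_1 Phi tau - (t - tau)^-1 * (Phi t - Phi tau)).
  by field.
by rewrite normrM normrN mulrC ler_wpM2r.
Qed.

(** Near t, Phi lies between the continuous functions p + A (y - tau) - e |y - tau| and p + A (y -
    tau) + e |y - tau|. Up to an arbitrary s > 0 these can be frozen at y = t, which gives the
    constant bounds that pass from Phi to F t. *)
Lemma regularized_approx Phi F tau p A : regularized Phi F ->
  approx_by_line Phi tau p A -> approx_by_line F tau p A.
Proof.
move=> [_ _ _ FU FL] H e e0; have [d d0 Hd] := H e e0; exists d => // t td.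
pose l y := p + A * (y - tau).
have cl s : {for t, continuous (fun y => l y + s * `|y - tau|)}.
  apply: cvgD.
    apply: cvgD; first exact: cvg_cst.
    by apply: cvgM; [exact: cvg_cst|apply: cvgB; [exact: cvg_id|exact: cvg_cst]].
  apply: cvgM; first exact: cvg_cst.
  by apply: cvg_norm; apply: cvgB; [exact: cvg_id|exact: cvg_cst].
have nd : \forall y \near t, `|y - tau| < d.
  have : (fun y => `|y - tau|) y @[y --> t] --> `|t - tau|.
    by apply: cvg_norm; apply: cvgB; [exact: cvg_id|exact: cvg_cst].
  by move/cvgr_lt; apply.
rewrite ler_norml; apply/andP; split.
- suff : l t - e * `|t - tau| <= F t by rewrite /l; lra.
  apply/ler_addgt0Pr => s s0; rewrite -lerBlDr; apply: FL.
  have : \forall y \near t, l t + - e * `|t - tau| - s < l y + - e * `|y - tau|.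
    by have /cvgr_gt := cl (- e); apply; rewrite ltrBlDr ltrDl.
  apply: filterS2 nd => y yd; have := Hd _ yd.
  rewrite ler_norml /l => /andP[? ?]; lra.
- suff : F t <= l t + e * `|t - tau| by rewrite /l; lra.
  apply/ler_addgt0Pr => s s0; apply: FU.
  have : \forall y \near t, l y + e * `|y - tau| < l t + e * `|t - tau| + s.
    by have /cvgr_lt := cl e; apply; rewrite ltrDl.
  apply: filterS2 nd => y yd; have := Hd _ yd.
  rewrite ler_norml /l => /andP[? ?]; lra.
Qed.

(** Within d of tau the smallness of G leaves e times a Cauchy kernel. Farther away the bound on k
    gives |k t| <= K eps / |t - tau|^3 <= K eps / d^3. *)
Lemma II_kernel_bound a b tau M (K e d eps : R) G k : a <= b -> 0 <= K -> 0 < e ->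
  0 < d -> 0 < eps -> 0 <= M -> bmfun a b G -> bmfun a b k ->
  (forall t, a <= t <= b -> `|G t| <= M) ->
  (forall t, a <= t <= b -> `|t - tau| < d -> `|G t| <= e * `|t - tau|) ->
  (forall t, a <= t <= b ->
     `|t - tau| * `|k t| <= K * (eps / (eps ^+ 2 + `|t - tau| ^+ 2))) ->
  `|II a b (fun t => G t * k t)| <=
  II a b (fun t => K * e * (eps / (eps ^+ 2 + (t - tau) ^+ 2))
                   + K * M * eps / d ^+ 3).
Proof.
move=> ab K0 e0 d0 eps0 M0 bG bk GM Ge kK.
have bc : bmfun a b (fun t => eps / (eps ^+ 2 + (t - tau) ^+ 2)).
  by apply: bmfun_cont => t _; exact: continuous_cauchy.
apply: le_norm_II; first exact: bmfunM.
  apply: bmfunD; last exact: bmfun_cst.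
  by apply: bmfunM => //; exact: bmfun_cst.
move=> t tab; have := kK t tab; have := GM t tab; have := Ge t tab.
rewrite real_normK ?num_real//.
have D0 : 0 < eps ^+ 2 + (t - tau) ^+ 2 by rewrite ltr_pwDl ?sqr_ge0// exprn_gt0.
have q0 : 0 <= eps / (eps ^+ 2 + (t - tau) ^+ 2) by rewrite divr_ge0// ltW.
have d3 : 0 < d ^+ 3 by rewrite exprn_gt0.
rewrite normrM => hGe hGM hk.
have [td|dt] := ltP `|t - tau| d.
  apply: (@le_trans _ _ (e * `|t - tau| * `|k t|)).
    by rewrite ler_wpM2r// hGe.
  rewrite -mulrA [K * e]mulrC -mulrA.
  apply: (@le_trans _ _ (e * (K * (eps / (eps ^+ 2 + (t - tau) ^+ 2))))).
    by apply: ler_wpM2l => //; exact: ltW.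
  rewrite [e * (K * _)]mulrA lerDl mulrA.
  exact: divr_ge0 (mulr_ge0 (mulr_ge0 K0 M0) (ltW eps0)) (ltW d3).
have s0 : 0 < `|t - tau| by exact: lt_le_trans dt.
apply: (@le_trans _ _ (M * `|k t|)); first by rewrite ler_wpM2r.
apply: (@le_trans _ _ (K * M * eps / d ^+ 3)); last first.
  by rewrite lerDr mulr_ge0// mulr_ge0// ltW.
rewrite ler_pdivlMr//.
have h1 : `|k t| * d ^+ 3 <= `|t - tau| * `|k t| * `|t - tau| ^+ 2.
  rewrite (_ : _ * _ ^+ 2 = `|k t| * `|t - tau| ^+ 3); last by ring.
  by rewrite ler_wpM2l// lerXn2r// nnegrE ltW.
have h2 : eps / (eps ^+ 2 + (t - tau) ^+ 2) * `|t - tau| ^+ 2 <= eps.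
  rewrite real_normK ?num_real// mulrAC ler_pdivrMr//.
  by rewrite ler_wpM2l ?lerDr ?sqr_ge0// ltW.
have h3 : `|t - tau| * `|k t| * `|t - tau| ^+ 2 <= K * eps.
  apply: (@le_trans _ _ (K * (eps / (eps ^+ 2 + (t - tau) ^+ 2)) * `|t - tau| ^+ 2)).
    by rewrite ler_wpM2r// sqr_ge0.
  by rewrite -mulrA ler_wpM2l.
rewrite -mulrA; have := ler_wpM2l M0 (le_trans h1 h3).
lra.
Qed.

(** The Cauchy kernel has mass at most pi and contributes at most e pi / 8; the constant term is at
    most e / 16 on a window of length 2 pi. Together this is e pi / 4 <= e. *)
Lemma II_bound_small tau M (K e d : R) : 0 <= K -> 0 < e -> 0 < d -> 0 <= M ->
  exists2 r, 0 < r & forall eps, 0 < eps < r ->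
  II (tau - pi) (tau + pi)
    (fun t => K * (e / (8 * (K + 1))) * (eps / (eps ^+ 2 + (t - tau) ^+ 2))
              + K * M * eps / d ^+ 3) <= e.
Proof.
move=> K0 e0 d0 M0; have pi0 := pi_gt0 R; have pi2 := pihalf_lt2 R.
have ab : tau - pi <= tau + pi by lra.
have d3 : 0 < d ^+ 3 by rewrite exprn_gt0.
have N0 : 0 < 16 * (K * M + 1).
  by rewrite mulr_gt0// ltr_wpDl// mulr_ge0.
exists (e * d ^+ 3 / (16 * (K * M + 1))).
  by rewrite divr_gt0// mulr_gt0.
move=> eps /andP[eps0]; rewrite ltr_pdivlMr// => he.
have cc : continuous (fun t => eps / (eps ^+ 2 + (t - tau) ^+ 2)).
  exact: continuous_cauchy.
rewrite IID; [|by apply: bmfunM; [exact: bmfun_cst|apply: bmfun_cont => t _; exact: cc]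
              |exact: bmfun_cst].
rewrite II_cst// IIZ; last by apply: bmfun_cont => t _; exact: cc.
have h1 : K * (e / (8 * (K + 1))) <= e / 8.
  rewrite mulrA ler_pdivrMr; last by rewrite mulr_gt0// ltr_wpDl.
  rewrite (_ : e / 8 * _ = e * K + e); first by have := K0; lra.
  by field.
have h10 : 0 <= K * (e / (8 * (K + 1))).
  by rewrite mulr_ge0// divr_ge0 ?mulr_ge0 ?addr_ge0// ltW.
have h2 : K * (e / (8 * (K + 1))) *
    II (tau - pi) (tau + pi) (fun t => eps / (eps ^+ 2 + (t - tau) ^+ 2)) <= e / 8 * pi.
  apply: ler_pM => //; last exact: II_cauchy.
  by apply: II_ge0 => t _; rewrite divr_ge0 ?addr_ge0 ?sqr_ge0// ltW.
have h3 : K * M * eps / d ^+ 3 <= e / 16.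
  rewrite ler_pdivrMr//; have := mulr_ge0 K0 M0; have := ltW eps0; nra.
have h4 : K * M * eps / d ^+ 3 * (tau + pi - (tau - pi)) <= e / 16 * (tau + pi - (tau - pi)).
  by apply: ler_wpM2r => //; lra.
apply: le_trans (lerD h2 h4) _; nra.
Qed.

Lemma II_kre0 x y tau : x ^+ 2 + y ^+ 2 < 1 ->
  II (tau - pi) (tau + pi) (kre x y) = 0.
Proof.
move=> xy1; have pi0 := pi_gt0 R; have ab : tau - pi <= tau + pi by lra.
have dP t : tau - pi <= t <= tau + pi -> is_derive t 1 (fun t => - kP x y t) (kre x y t).
  move=> _; apply: (is_derive_eq (rderivN (is_derive_kP xy1 t))); exact: opprK.
rewrite (II_FTC ab dP); last by move=> t _; exact: continuous_kre.
have -> : tau + pi = tau - pi + 2 * pi by ring.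
by rewrite kP_2pi subrr.
Qed.

Lemma II_kim0 x y tau : x ^+ 2 + y ^+ 2 < 1 ->
  II (tau - pi) (tau + pi) (kim x y) = 0.
Proof.
move=> xy1; have pi0 := pi_gt0 R; have ab : tau - pi <= tau + pi by lra.
have D0 t : kD x y t != 0 by rewrite gt_eqF// kD_gt0.
rewrite (II_FTC ab (fun t _ => is_derive_kQ (D0 t))); last first.
  by move=> t _; exact: continuous_kim.
have -> : tau + pi = tau - pi + 2 * pi by ring.
by rewrite kQ_2pi subrr.
Qed.

(** By parts, the linear factor produces the integral of the Poisson kernel, of mass 2 pi, and a
    boundary term at the point opposite to tau. *)
Lemma II_kre1 x y tau : x ^+ 2 + y ^+ 2 < 1 ->
  II (tau - pi) (tau + pi) (fun t => (t - tau) * kre x y t) =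
  2 * pi - 2 * pi * kP x y (tau + pi).
Proof.
move=> xy1; have pi0 := pi_gt0 R; have ab : tau - pi <= tau + pi by lra.
have dP t : tau - pi <= t <= tau + pi ->
  is_derive t 1 (fun t => t + 2 * atan (kV x y t / kU x y t) - (t - tau) * kP x y t)
    ((t - tau) * kre x y t).
  move=> _; apply: (is_derive_eq (rderivB (is_derive_kP_primitive xy1 t)
    (rderivM (rderivB (rderiv_id t) (rderiv_cst tau t)) (is_derive_kP xy1 t)))).
  ring.
rewrite (II_FTC ab dP); last first.
  move=> t _; apply: cvgM; last exact: continuous_kre.
  by apply: cvgB; [exact: cvg_id|exact: cvg_cst].
have -> : tau + pi = tau - pi + 2 * pi by ring.
by rewrite kP_2pi kV_2pi kU_2pi; ring.
Qed.

(** Here only the boundary term survives, since [kQ] has the periodic primitive ln [kD]. *)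
Lemma II_kim1 x y tau : x ^+ 2 + y ^+ 2 < 1 ->
  II (tau - pi) (tau + pi) (fun t => (t - tau) * kim x y t) =
  2 * pi * kQ x y (tau + pi).
Proof.
move=> xy1; have pi0 := pi_gt0 R; have ab : tau - pi <= tau + pi by lra.
have D0 t := kD_gt0 t xy1.
have D0' t : kD x y t != 0 by rewrite gt_eqF.
have dP t : tau - pi <= t <= tau + pi ->
  is_derive t 1 (fun t => (t - tau) * kQ x y t - ln (kD x y t))
    ((t - tau) * kim x y t).
  move=> _; apply: (is_derive_eq (rderivB
    (rderivM (rderivB (rderiv_id t) (rderiv_cst tau t)) (is_derive_kQ (D0' t)))
    (is_derive_ln_kD (D0 t)))).
  ring.
rewrite (II_FTC ab dP); last first.
  move=> t _; apply: cvgM; last exact: continuous_kim.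
  by apply: cvgB; [exact: cvg_id|exact: cvg_cst].
have -> : tau + pi = tau - pi + 2 * pi by ring.
by rewrite kQ_2pi kD_2pi; ring.
Qed.

(** The opposite point is at distance 2 from e^{i tau}, hence at least 1 from z, so the denominators
    are at least 1; both numerators are O(|z - e^{i tau}|). *)
Lemma stolz_opposite C x y tau : stolz C x y tau ->
  pdist x y (cos tau) (sin tau) <= 1 ->
  `|kP x y (tau + pi)| <= 2 * pdist x y (cos tau) (sin tau) /\
  `|kQ x y (tau + pi)| <= 2 * pdist x y (cos tau) (sin tau).
Proof.
move=> st; set eps := pdist x y _ _ => e1.
have xy1 := st.1; have e0 : 0 <= eps := pdist_ge0 _ _ _ _.
have D1 : 1 <= kD x y (tau + pi).
  have s1 : 1 <= Num.sqrt (kD x y (tau + pi)).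
    rewrite -pdist_circle.
    have := pdist_triangle (cos (tau + pi)) (sin (tau + pi)) x y (cos tau) (sin tau).
    rewrite -/eps [in X in X <= _]pdist_circle kD_unit.
    rewrite (_ : tau + pi - tau = pi); last by ring.
    rewrite cospi opprK.
    have -> : 2 * (1 + 1) = 2 ^+ 2 :> R by ring.
    rewrite sqrtr_sqr ger0_norm//.
    lra.
  rewrite -(sqr_sqrtr (ltW (kD_gt0 (tau + pi) xy1))) -(expr1n _ 2).
  by rewrite lerXn2r// nnegrE.
have D0 : 0 < kD x y (tau + pi) by exact: lt_le_trans D1.
have Vm : kV x y (tau + pi) = - kV x y tau by rewrite /kV sinDpi cosDpi; ring.
have kV2 : `|2 * kV x y (tau + pi)| <= 2 * eps.
  rewrite Vm mulrN normrN; apply: le_trans (stolz_kV st tau) _.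
  by rewrite -pdist_circle pdistC.
have h x1 : x1 / kD x y (tau + pi) <= `|x1|.
  by rewrite ler_pdivrMr// (le_trans (ler_norm _))// ler_peMr.
have hh x1 : `|x1 / kD x y (tau + pi)| <= `|x1|.
  by rewrite normrM normrV ?unitfE ?gt_eqF// (gtr0_norm D0) (le_trans (h _))// normr_id.
split; apply: le_trans (hh _) _ => //.
have /andP[w0 w1] := stolz_weight st.
rewrite ger0_norm//; have := stolz_eps_ge x y tau; rewrite -/eps; lra.
Qed.

End Comparison.

(** * Fatou's theorem and the truncated Hilbert integral at a point of differentiability *)

Section Transforms.
Context {R : realType}.
Local Notation mu := (@lebesgue_measure R).
Implicit Types (Phi F G : R -> R) (a b c d x y t tau A M C e eps p : R).

Definition excess F tau p A t := F t - p - A * (t - tau).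

(** The truncated Hilbert integral after integration by parts, without its boundary terms: on the
    unit circle [kim] is minus the derivative of the cotangent kernel. *)
Definition trunc_int F tau eps :=
  II (tau - pi) (tau - eps) (fun t => F t * kim (cos tau) (sin tau) t) +
  II (tau + eps) (tau + pi) (fun t => F t * kim (cos tau) (sin tau) t).

Lemma kD_unit_gt0 tau t : 0 < `|t - tau| <= pi -> 0 < kD (cos tau) (sin tau) t.
Proof.
move=> /andP[s0 spi]; rewrite -sqrtr_gt0; apply: lt_le_trans (kD_unit_ge spi).
by rewrite divr_gt0.
Qed.

Lemma kD_unit_left tau eps t : 0 < eps -> tau - pi <= t <= tau - eps ->
  0 < kD (cos tau) (sin tau) t.
Proof.
move=> e0 /andP[h1 h2]; apply: kD_unit_gt0.
rewrite ler0_norm; last by lra.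
by apply/andP; split; lra.
Qed.

Lemma kD_unit_right tau eps t : 0 < eps -> tau + eps <= t <= tau + pi ->
  0 < kD (cos tau) (sin tau) t.
Proof.
move=> e0 /andP[h1 h2]; apply: kD_unit_gt0.
rewrite ger0_norm; last by lra.
by apply/andP; split; lra.
Qed.

Lemma kim_unit_left tau eps : 0 < eps ->
  bmfun (tau - pi) (tau - eps) (kim (cos tau) (sin tau)).
Proof.
move=> e0; apply: bmfun_cont => t /(kD_unit_left e0) D0.
by apply: continuous_kim; rewrite gt_eqF.
Qed.

Lemma kim_unit_right tau eps : 0 < eps ->
  bmfun (tau + eps) (tau + pi) (kim (cos tau) (sin tau)).
Proof.
move=> e0; apply: bmfun_cont => t /(kD_unit_right e0) D0.
by apply: continuous_kim; rewrite gt_eqF.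
Qed.

Lemma bmfun_line a b tau : bmfun a b (fun t => t - tau).
Proof.
apply: bmfun_cont => t _; exact: rderiv_cont (rderivB (rderiv_id t) (rderiv_cst tau t)).
Qed.

Lemma excess_bmfun F tau p A a b : bmfun a b F -> bmfun a b (excess F tau p A).
Proof.
move=> bF; apply: bmfunB; last by apply: bmfunM; [exact: bmfun_cst|exact: bmfun_line].
by apply: bmfunB => //; exact: bmfun_cst.
Qed.

Lemma II_excess a b F tau p A k : bmfun a b F -> bmfun a b k ->
  II a b (fun t => F t * k t) = II a b (fun t => excess F tau p A t * k t) +
  p * II a b k + A * II a b (fun t => (t - tau) * k t).
Proof.
move=> bF bk; have bl := bmfun_line a b tau.
have bG := @excess_bmfun F tau p A a b bF.
rewrite -IIZ// -IIZ; last exact: bmfunM.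
rewrite -IID; [|exact: bmfunM|by apply: bmfunM => //; exact: bmfun_cst].
rewrite -IID.
- by apply: II_eq => t _; rewrite /excess; ring.
- by apply: bmfunD; [exact: bmfunM|apply: bmfunM => //; exact: bmfun_cst].
- by apply: bmfunM; [exact: bmfun_cst|exact: bmfunM].
Qed.

Section Approx.
Variables (F : R -> R) (tau p A M : R).
Hypothesis bF : forall a b, bmfun a b F.
Hypothesis FM : forall t, `|F t| <= M.
Hypothesis HA : approx_by_line F tau p A.

Let G := excess F tau p A.
Let M' := M + `|p| + `|A| * pi.

Let M'0 : 0 <= M'.
Proof.
have := pi_gt0 R; have := normr_ge0 (F 0); have := FM 0; rewrite /M' => h1 h2 h3.
apply: addr_ge0; last exact: mulr_ge0 (normr_ge0 _) (ltW h3).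
exact: addr_ge0 (le_trans h2 h1) (normr_ge0 _).
Qed.

Let GM t : tau - pi <= t <= tau + pi -> `|G t| <= M'.
Proof.
move=> /andP[h1 h2]; rewrite /G /excess /M'.
apply: le_trans (ler_normB _ _) _; rewrite lerD//.
  by apply: le_trans (ler_normB _ _) _; rewrite lerD.
by rewrite normrM ler_wpM2l// ler_norml; apply/andP; split; lra.
Qed.

Let window t : tau - pi <= t <= tau + pi -> `|t - tau| <= pi.
Proof. by move=> /andP[h1 h2]; rewrite ler_norml; apply/andP; split; lra. Qed.

Lemma fatou_excess C e : 0 < e -> exists2 r, 0 < r & forall x y,
  stolz C x y tau -> pdist x y (cos tau) (sin tau) < r ->
  `|II (tau - pi) (tau + pi) (fun t => G t * kre x y t)| <= e.
Proof.
move=> e0; have pi0 := pi_gt0 R.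
(* The inequality 1 <= C is available only once a point of the Stolz angle is given, hence the
   absolute value here. *)
pose K := 192 * (`|C| + 1) ^+ 3.
have K0 : 0 <= K by rewrite mulr_ge0// exprn_ge0// addr_ge0.
have e'0 : 0 < e / (8 * (K + 1)).
  by rewrite divr_gt0// mulr_gt0// ltr_wpDl.
have [d d0 Hd] := HA e'0.
have [r r0 Hr] := II_bound_small tau K0 e0 d0 M'0.
exists r => // x y st er.
have eps0 := stolz_eps_gt0 st; have C1 := stolz_C_ge1 st.
have CC : `|C| = C by rewrite ger0_norm// (le_trans ler01).
have xy1 := st.1.
apply: le_trans (Hr _ (introT andP (conj eps0 er))).
apply: II_kernel_bound => //.
- lra.
- exact: excess_bmfun.
- by apply: bmfun_cont => t _; exact: continuous_kre.
- by move=> t _; exact: Hd.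
- by move=> t /window; rewrite /K CC; exact: kre_bound.
Qed.

Lemma fatou_line C e : 0 < e -> exists2 r, 0 < r & forall x y,
  stolz C x y tau -> pdist x y (cos tau) (sin tau) < r ->
  `|II (tau - pi) (tau + pi) (fun t => F t * kre x y t) - 2 * pi * A| <= e.
Proof.
move=> e0; have e2 : 0 < e / 2 by rewrite divr_gt0.
have pi0 := pi_gt0 R.
have [r r0 Hr] := fatou_excess C e2.
have N0 : 0 < 8 * pi * (`|A| + 1) by rewrite mulr_gt0// ?mulr_gt0// ltr_wpDl.
(* The last bound makes 2 pi |A| times the boundary value of [kP], itself at most 2 |z - e^{i tau}|,
   smaller than e / 2. *)
exists (Num.min (Num.min r 1) (e / (8 * pi * (`|A| + 1)))).
  by rewrite !lt_min r0 ltr01 divr_gt0.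
move=> x y st; rewrite !lt_min => /andP[/andP[er e1]].
rewrite ltr_pdivlMr// => eA.
have xy1 := st.1.
have bk : bmfun (tau - pi) (tau + pi) (kre x y).
  by apply: bmfun_cont => t _; exact: continuous_kre.
rewrite (II_excess tau p A (bF _ _) bk) II_kre0// mulr0 addr0 II_kre1//.
have [hP _] := stolz_opposite st (ltW e1).
rewrite (_ : _ - _ = II (tau - pi) (tau + pi) (fun t => G t * kre x y t) +
   - (2 * pi * A * kP x y (tau + pi))); last by rewrite /G; ring.
rewrite [leRHS]splitr; apply: ler_normD_eq (Hr _ _ st er) _ (erefl _).
have pi20 : 0 < 2 * pi :> R by rewrite mulr_gt0.
rewrite normrN normrM (normrM (2 * pi)) (gtr0_norm pi20).
have h : 2 * pi * `|A| * `|kP x y (tau + pi)| <=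
  2 * pi * `|A| * (2 * pdist x y (cos tau) (sin tau)).
  by rewrite ler_wpM2l// !mulr_ge0// ltW.
apply: le_trans h _.
have := pdist_ge0 x y (cos tau) (sin tau); nra.
Qed.

(** The window is cut at distance eps = |z - e^{i tau}| from tau. On the outer parts [kim] is
    compared with its value on the circle; the middle part, absent from [trunc_int], is itself
    small. All three errors have the same integrable majorant [B]. *)
Lemma conj_excess C e : 0 < e -> exists2 r, 0 < r & forall x y,
  stolz C x y tau -> pdist x y (cos tau) (sin tau) < r ->
  `|II (tau - pi) (tau + pi) (fun t => G t * kim x y t) -
    trunc_int G tau (pdist x y (cos tau) (sin tau))| <= e.
Proof.
move=> e0; have pi0 := pi_gt0 R.
pose K := 192 * (`|C| + 1) ^+ 3.
have K0 : 0 <= K by rewrite mulr_ge0// exprn_ge0// addr_ge0.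
have e'0 : 0 < e / (8 * (K + 1)).
  by rewrite divr_gt0// mulr_gt0// ltr_wpDl.
have [d d0 Hd] := HA e'0.
have [r r0 Hr] := II_bound_small tau K0 e0 d0 M'0.
exists (Num.min r pi); first by rewrite lt_min r0.
move=> x y st; rewrite lt_min => /andP[er epi].
have eps0 := stolz_eps_gt0 st; have C1 := stolz_C_ge1 st.
set eps := pdist _ _ _ _ in er epi eps0 *.
have CC : `|C| = C by rewrite ger0_norm// (le_trans ler01).
have xy1 := st.1.
apply: le_trans (Hr _ (introT andP (conj eps0 er))).
set B := (X in _ <= II _ _ X).
have bB a b : bmfun a b B.
  apply: bmfunD; last exact: bmfun_cst.
  by apply: bmfunM; [exact: bmfun_cst|apply: bmfun_cont => t _; exact: continuous_cauchy].
have bG a b : bmfun a b G by exact: excess_bmfun.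
have ck : continuous (kim x y).
  by move=> t; apply: continuous_kim; rewrite gt_eqF// kD_gt0.
have bk a b : bmfun a b (kim x y) by apply: bmfun_cont => t _; exact: ck.
have bGk a b : bmfun a b (fun t => G t * kim x y t) by exact: bmfunM.
have split3 f : (forall a b, bmfun a b f) -> II (tau - pi) (tau + pi) f =
    II (tau - pi) (tau - eps) f + II (tau - eps) (tau + eps) f +
    II (tau + eps) (tau + pi) f.
  move=> bf; rewrite (@II_split _ _ _ (tau + eps))//; last by apply/andP; split; lra.
  by rewrite (@II_split _ (tau - pi) _ (tau - eps))//; apply/andP; split; lra.
rewrite !split3// /trunc_int.
have bl := @kim_unit_left tau eps eps0; have br := @kim_unit_right tau eps eps0.
have hl : `|II (tau - pi) (tau - eps) (fun t => G t * kim x y t) -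
    II (tau - pi) (tau - eps) (fun t => G t * kim (cos tau) (sin tau) t)| <=
    II (tau - pi) (tau - eps) B.
  rewrite -IIB//; last exact: bmfunM.
  rewrite (@II_eq _ _ _ _ (fun t => G t * (kim x y t - kim (cos tau) (sin tau) t)));
    last by move=> t _; ring.
  apply: II_kernel_bound => //.
  - lra.
  - exact: bmfunB.
  - by move=> t /andP[h1 h2]; apply: GM; apply/andP; split; lra.
  - by move=> t _; exact: Hd.
  - move=> t /andP[h1 h2]; rewrite kim_unit opprK /K CC; apply: kim_bound_far => //.
      by apply: window; apply/andP; split; lra.
    by rewrite -/eps ler0_norm; lra.
have hr : `|II (tau + eps) (tau + pi) (fun t => G t * kim x y t) -
    II (tau + eps) (tau + pi) (fun t => G t * kim (cos tau) (sin tau) t)| <=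
    II (tau + eps) (tau + pi) B.
  rewrite -IIB//; last exact: bmfunM.
  rewrite (@II_eq _ _ _ _ (fun t => G t * (kim x y t - kim (cos tau) (sin tau) t)));
    last by move=> t _; ring.
  apply: II_kernel_bound => //.
  - lra.
  - exact: bmfunB.
  - by move=> t /andP[h1 h2]; apply: GM; apply/andP; split; lra.
  - by move=> t _; exact: Hd.
  - move=> t /andP[h1 h2]; rewrite kim_unit opprK /K CC; apply: kim_bound_far => //.
      by apply: window; apply/andP; split; lra.
    by rewrite -/eps ger0_norm; lra.
have hm : `|II (tau - eps) (tau + eps) (fun t => G t * kim x y t)| <=
    II (tau - eps) (tau + eps) B.
  apply: II_kernel_bound => //.
  - lra.
  - by move=> t /andP[h1 h2]; apply: GM; apply/andP; split; lra.
  - by move=> t _; exact: Hd.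
  - move=> t /andP[h1 h2]; rewrite /K CC; apply: kim_bound_near => //.
    by rewrite -/eps ler_norml; apply/andP; split; lra.
apply: ler_normD_eq (ler_normD_eq hl hm (erefl _)) hr _.
ring.
Qed.

Lemma conj_line C e : 0 < e -> exists2 r, 0 < r & forall x y,
  stolz C x y tau -> pdist x y (cos tau) (sin tau) < r ->
  `|II (tau - pi) (tau + pi) (fun t => F t * kim x y t) -
    trunc_int G tau (pdist x y (cos tau) (sin tau))| <= e.
Proof.
move=> e0; have e2 : 0 < e / 2 by rewrite divr_gt0.
have pi0 := pi_gt0 R.
have [r r0 Hr] := conj_excess C e2.
have N0 : 0 < 8 * pi * (`|A| + 1) by rewrite mulr_gt0// ?mulr_gt0// ltr_wpDl.
exists (Num.min (Num.min r 1) (e / (8 * pi * (`|A| + 1)))).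
  by rewrite !lt_min r0 ltr01 divr_gt0.
move=> x y st; rewrite !lt_min => /andP[/andP[er e1]].
rewrite ltr_pdivlMr// => eA.
have xy1 := st.1.
have bk : bmfun (tau - pi) (tau + pi) (kim x y).
  by apply: bmfun_cont => t _; apply: continuous_kim; rewrite gt_eqF// kD_gt0.
rewrite (II_excess tau p A (bF _ _) bk) II_kim0// mulr0 addr0 II_kim1//.
have [_ hP] := stolz_opposite st (ltW e1).
rewrite [leRHS]splitr; apply: (ler_normD_eq (Hr _ _ st er)
   (y := 2 * pi * A * kQ x y (tau + pi))); last by rewrite /G; ring.
have pi20 : 0 < 2 * pi :> R by rewrite mulr_gt0.
rewrite normrM (normrM (2 * pi)) (gtr0_norm pi20).
have h : 2 * pi * `|A| * `|kQ x y (tau + pi)| <=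
  2 * pi * `|A| * (2 * pdist x y (cos tau) (sin tau)).
  by rewrite ler_wpM2l// !mulr_ge0// ltW.
apply: le_trans h _.
have := pdist_ge0 x y (cos tau) (sin tau); nra.
Qed.

End Approx.

Lemma hilbert_kernelE tau t : 0 < `|t - tau| <= pi ->
  hilbert_kernel tau t = - kQ (cos tau) (sin tau) t.
Proof.
move=> ht; have D0 := kD_unit_gt0 ht; move: D0; rewrite /hilbert_kernel /kQ.
set v := (tau - t) / 2.
have tE : t - tau = - (v *+ 2) by rewrite -mulr_natr divfK// opprB.
have -> : kD (cos tau) (sin tau) t = 4 * sin v ^+ 2.
  by rewrite kD_unit tE cosN cos_mulr2n sin2cos2 -mulr_natr; ring.
have -> : kV (cos tau) (sin tau) t = - (2 * (cos v * sin v)).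
  have -> : kV (cos tau) (sin tau) t = sin (t - tau) by rewrite sinB /kV; ring.
  by rewrite tE sinN sin_mulr2n -mulr_natr; ring.
move=> D0; have s0 : sin v != 0.
  by apply: contraTneq D0 => ->; rewrite expr0n mulr0 ltxx.
by field.
Qed.

Lemma kQ_unit tau t :
  kQ (cos tau) (sin tau) t = sin (t - tau) / (1 - cos (t - tau)).
Proof.
rewrite /kQ kD_unit (_ : kV _ _ t = sin (t - tau)); last by rewrite sinB /kV; ring.
by rewrite invfM mulrACA divff ?mul1r.
Qed.

Lemma II_kim_unit tau eps : 0 < eps <= pi ->
  II (tau - pi) (tau - eps) (kim (cos tau) (sin tau)) = - kQ (cos tau) (sin tau) (tau + eps) /\
  II (tau + eps) (tau + pi) (kim (cos tau) (sin tau)) = - kQ (cos tau) (sin tau) (tau + eps).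
Proof.
move=> /andP[e0 epi].
have -> : II (tau - pi) (tau - eps) (kim (cos tau) (sin tau)) =
    kQ (cos tau) (sin tau) (tau - eps) - kQ (cos tau) (sin tau) (tau - pi).
  apply: II_FTC => [|t /(kD_unit_left e0) D0|t /(kD_unit_left e0) D0].
  - lra.
  - by apply: is_derive_kQ; rewrite gt_eqF.
  - by apply: continuous_kim; rewrite gt_eqF.
have -> : II (tau + eps) (tau + pi) (kim (cos tau) (sin tau)) =
    kQ (cos tau) (sin tau) (tau + pi) - kQ (cos tau) (sin tau) (tau + eps).
  apply: II_FTC => [|t /(kD_unit_right e0) D0|t /(kD_unit_right e0) D0].
  - lra.
  - by apply: is_derive_kQ; rewrite gt_eqF.
  - by apply: continuous_kim; rewrite gt_eqF.
rewrite !kQ_unit (_ : tau - pi - tau = - pi); last by ring.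
rewrite (_ : tau + pi - tau = pi); last by ring.
rewrite (_ : tau - eps - tau = - eps); last by ring.
rewrite (_ : tau + eps - tau = eps); last by ring.
by rewrite !sinN !cosN sinpi; split; ring.
Qed.

(** The integrand is odd about tau; its primitive [g] is even, so the two increments cancel. *)
Lemma trunc_int_line tau eps : 0 < eps <= pi ->
  trunc_int (fun t => t - tau) tau eps = 0.
Proof.
move=> /andP[e0 epi]; rewrite /trunc_int.
pose g t := (t - tau) * kQ (cos tau) (sin tau) t - ln (kD (cos tau) (sin tau) t).
have dg t : 0 < kD (cos tau) (sin tau) t ->
    is_derive t 1 g ((t - tau) * kim (cos tau) (sin tau) t).
  move=> D0; have D0' : kD (cos tau) (sin tau) t != 0 by rewrite gt_eqF.
  apply: (is_derive_eq (rderivB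
    (rderivM (rderivB (rderiv_id t) (rderiv_cst tau t)) (is_derive_kQ D0'))
    (is_derive_ln_kD D0))).
  ring.
have cg t : 0 < kD (cos tau) (sin tau) t ->
    {for t, continuous (fun t => (t - tau) * kim (cos tau) (sin tau) t)}.
  move=> D0; apply: cvgM; last by apply: continuous_kim; rewrite gt_eqF.
  by apply: cvgB; [exact: cvg_id|exact: cvg_cst].
have -> : II (tau - pi) (tau - eps) (fun t => (t - tau) * kim (cos tau) (sin tau) t)
    = g (tau - eps) - g (tau - pi).
  apply: II_FTC => [|t /(kD_unit_left e0)|t /(kD_unit_left e0)].
  - lra.
  - exact: dg.
  - exact: cg.
have -> : II (tau + eps) (tau + pi) (fun t => (t - tau) * kim (cos tau) (sin tau) t)
    = g (tau + pi) - g (tau + eps).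
  apply: II_FTC => [|t /(kD_unit_right e0)|t /(kD_unit_right e0)].
  - lra.
  - exact: dg.
  - exact: cg.
have even u : g (tau - u) = g (tau + u).
  rewrite /g !kQ_unit !kD_unit (_ : tau - u - tau = - u); last by ring.
  rewrite (_ : tau + u - tau = u); last by ring.
  by rewrite sinN cosN; ring.
by rewrite !even; ring.
Qed.

Lemma trunc_int_excess F tau p A eps : (forall a b, bmfun a b F) ->
  0 < eps <= pi -> trunc_int F tau eps =
  trunc_int (excess F tau p A) tau eps - 2 * p * kQ (cos tau) (sin tau) (tau + eps).
Proof.
move=> bF epsb; have /andP[e0 epi] := epsb.
have bl := @kim_unit_left tau eps e0; have br := @kim_unit_right tau eps e0.
have := trunc_int_line tau epsb.
rewrite /trunc_int (II_excess tau p A (bF _ _) bl) (II_excess tau p A (bF _ _) br).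
have [-> ->] := II_kim_unit tau epsb.
set u := II _ _ _; set v := II _ _ _ => uv.
have -> : v = - u by lra.
ring.
Qed.

Lemma hilbert_kernel_RS Phi F tau eps : regularized Phi F -> 0 < eps <= pi ->
  is_RSint (hilbert_kernel tau) Phi (tau - pi) (tau - eps)
    (kQ (cos tau) (sin tau) (tau + eps) * Phi (tau - eps) +
     II (tau - pi) (tau - eps) (fun t => F t * kim (cos tau) (sin tau) t)) /\
  is_RSint (hilbert_kernel tau) Phi (tau + eps) (tau + pi)
    (kQ (cos tau) (sin tau) (tau + eps) * Phi (tau + eps) +
     II (tau + eps) (tau + pi) (fun t => F t * kim (cos tau) (sin tau) t)).
Proof.
move=> rF /andP[e0 epi].
pose s t := sin ((tau - t) / 2); pose c t := cos ((tau - t) / 2).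
have dv t : is_derive t 1 (fun t => (tau - t) / 2) (- 2^-1).
  apply: (is_derive_eq (rderivM (rderivB (rderiv_cst tau t) (rderiv_id t))
    (rderiv_cst 2^-1 t))).
  ring.
have sD t : kD (cos tau) (sin tau) t = 4 * s t ^+ 2.
  have tE : t - tau = - ((tau - t) / 2 *+ 2) by rewrite -mulr_natr divfK// opprB.
  by rewrite kD_unit tE cosN cos_mulr2n sin2cos2 -mulr_natr; ring.
have s0 t : 0 < kD (cos tau) (sin tau) t -> s t != 0.
  by rewrite sD; apply: contraTneq => ->; rewrite expr0n mulr0 ltxx.
have dh t : 0 < kD (cos tau) (sin tau) t ->
    is_derive t 1 (hilbert_kernel tau) (- kim (cos tau) (sin tau) t).
  move=> /s0 st0.
  apply: (is_derive_eq (rderiv_div st0 (rderiv_cos (dv t)) (rderiv_sin (dv t)))).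
  rewrite kim_unit sD -/(s t) -/(c t) opprK.
  have h := cos2Dsin2 ((tau - t) / 2); rewrite -/(s t) -/(c t) in h.
  rewrite (_ : _ - _ = (c t ^+ 2 + s t ^+ 2) / 2); last by field.
  by rewrite h; field.
have ch t : 0 < kD (cos tau) (sin tau) t ->
    {for t, continuous (fun t => - kim (cos tau) (sin tau) t)}.
  by move=> D0; apply: cvgN; apply: continuous_kim; rewrite gt_eqF.
(* With the convention cot (pi / 2) = 0 the boundary terms at tau - pi and tau + pi disappear. *)
have h0 : hilbert_kernel tau (tau - pi) = 0.
  by rewrite /hilbert_kernel opprB addrC subrK cos_pihalf mul0r.
have h1 : hilbert_kernel tau (tau + pi) = 0.
  by rewrite /hilbert_kernel opprD addNKr mulNr cosN cos_pihalf mul0r.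
have h2 : hilbert_kernel tau (tau - eps) = kQ (cos tau) (sin tau) (tau + eps).
  rewrite hilbert_kernelE; last by rewrite addrC addKr normrN gtr0_norm// e0.
  rewrite !kQ_unit (_ : tau - eps - tau = - eps); last by ring.
  rewrite (_ : tau + eps - tau = eps); last by ring.
  by rewrite sinN cosN; ring.
have h3 : hilbert_kernel tau (tau + eps) = - kQ (cos tau) (sin tau) (tau + eps).
  rewrite hilbert_kernelE// (_ : tau + eps - tau = eps); last by ring.
  by rewrite gtr0_norm// e0.
split.
- have le1 : tau - pi <= tau - eps by lra.
  have := is_RSint_by_parts le1 rF (fun t ht => dh t (kD_unit_left e0 ht))
    (fun t ht => ch t (kD_unit_left e0 ht)).
  rewrite h0 h2 mul0r subr0 -IIN.
    by under [II _ _ (fun x => - _)]II_eq do rewrite mulrN opprK.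
  apply: bmfunM; first exact: regularized_bmfun rF.
  by apply: bmfunN; exact: kim_unit_left.
- have le1 : tau + eps <= tau + pi by lra.
  have := is_RSint_by_parts le1 rF (fun t ht => dh t (kD_unit_right e0 ht))
    (fun t ht => ch t (kD_unit_right e0 ht)).
  rewrite h1 h3 mul0r sub0r mulNr opprK -IIN.
    by under [II _ _ (fun x => - _)]II_eq do rewrite mulrN opprK.
  apply: bmfunM; first exact: regularized_bmfun rF.
  by apply: bmfunN; exact: kim_unit_right.
Qed.

(** The boundary terms at tau - eps and tau + eps combine with the integral of the constant Phi tau
    into a second difference. At a point of differentiability it is o(eps), which outweighs the
    factor [kQ] = O(1 / eps); the slope A drops out by oddness. *)
Lemma hilbert_truncE Phi F tau eps A : regularized Phi F -> 0 < eps <= pi ->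
  hilbert_trunc Phi tau eps = trunc_int (excess F tau (Phi tau) A) tau eps +
  kQ (cos tau) (sin tau) (tau + eps) *
    (Phi (tau + eps) + Phi (tau - eps) - 2 * Phi tau).
Proof.
move=> rF epsb; have /andP[e0 epi] := epsb.
have [h1 h2] := hilbert_kernel_RS tau rF epsb.
rewrite /hilbert_trunc (RSint_eq _ h1); last by lra.
rewrite (RSint_eq _ h2); last by lra.
have := trunc_int_excess tau (Phi tau) A (fun a b => regularized_bmfun a b rF) epsb.
rewrite /trunc_int; lra.
Qed.

Lemma kQ_unit_bound tau eps : 0 < eps <= pi ->
  `|kQ (cos tau) (sin tau) (tau + eps)| * eps <= 4.
Proof.
move=> /andP[e0 epi].
have hs : `|tau + eps - tau| = eps by rewrite addrC addKr gtr0_norm.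
have D0 : 0 < kD (cos tau) (sin tau) (tau + eps) by apply: kD_unit_gt0; rewrite hs e0.
have := @kD_unit_ge R tau (tau + eps); rewrite hs => /(_ epi).
set a := Num.sqrt _ => ha.
have a0 : 0 < a by rewrite sqrtr_gt0.
have a2 : kD (cos tau) (sin tau) (tau + eps) = a ^+ 2 by rewrite sqr_sqrtr// ltW.
have V2 : `|2 * kV (cos tau) (sin tau) (tau + eps)| <= 2 * a.
  rewrite -(@ler_pXn2r _ 2)// ?nnegrE ?mulr_ge0//; last exact: ltW.
  rewrite -normrX ger0_norm ?sqr_ge0// exprMn [in leRHS]exprMn -a2.
  by rewrite ler_pM2l ?exprn_gt0// /kD lerDr sqr_ge0.
rewrite /kQ a2 normrM normrV ?unitfE ?expf_neq0 ?gt_eqF//.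
rewrite [`|a ^+ 2|]gtr0_norm ?exprn_gt0// mulrAC ler_pdivrMr ?exprn_gt0//.
apply: (@le_trans _ _ (2 * a * (2 * a))); last first.
  by rewrite le_eqVlt; apply/orP; left; apply/eqP; ring.
apply: ler_pM => //; first exact: ltW.
lra.
Qed.

Theorem conj_comparison Phi F tau A C e : regularized Phi F ->
  approx_by_line Phi tau (Phi tau) A -> 0 < e ->
  exists2 r, 0 < r & forall x y, stolz C x y tau ->
  pdist x y (cos tau) (sin tau) < r ->
  `|II (tau - pi) (tau + pi) (fun t => F t * kim x y t) -
    hilbert_trunc Phi tau (pdist x y (cos tau) (sin tau))| <= e.
Proof.
move=> rF HA e0; have [_ [M PM] _ _ _] := rF.
have e2 : 0 < e / 2 by rewrite divr_gt0.
(* The second difference is then at most e eps / 8, and its factor [kQ] is at most 4 / eps in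
   absolute value: the product is at most e / 2. *)
have e16 : 0 < e / 16 by rewrite divr_gt0.
have HF := regularized_approx rF HA.
have [r r0 Hr] := conj_line (fun a b => regularized_bmfun a b rF)
  (regularized_bound rF PM) HF C e2.
have [d d0 Hd] := HA _ e16.
exists (Num.min r (Num.min d pi)); first by rewrite !lt_min r0 d0 pi_gt0.
move=> x y st; rewrite !lt_min => /andP[er /andP[ed epi]].
have eps0 := stolz_eps_gt0 st; have := Hr _ _ st er.
move: (pdist x y (cos tau) (sin tau)) er ed epi eps0 => eps er ed epi eps0.
have epsb : 0 < eps <= pi by rewrite eps0 ltW.
rewrite (hilbert_truncE tau A rF epsb) => h; rewrite [leRHS]splitr.
set q := kQ _ _ _; set D2 := _ + _ - _.
apply: (ler_normD_eq h (y := - (q * D2))); last by ring.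
rewrite normrN normrM.
have D2b : `|D2| <= e / 8 * eps.
  have -> : e / 8 * eps = e / 16 * eps + e / 16 * eps by field.
  have h1 := Hd (tau + eps); have h2 := Hd (tau - eps).
  rewrite (_ : tau + eps - tau = eps) in h1; last by ring.
  rewrite (_ : tau - eps - tau = - eps) in h2; last by ring.
  rewrite normrN (gtr0_norm eps0) in h2; rewrite (gtr0_norm eps0) in h1.
  by apply: ler_normD_eq (h1 ed) (h2 ed) _; rewrite /D2; ring.
apply: (@le_trans _ _ (`|q| * (e / 8 * eps))); first by rewrite ler_wpM2l.
have := kQ_unit_bound tau epsb; rewrite -/q; nra.
Qed.

End Transforms.

(** * Trigonometric polynomials and the Bessel inequality *)

Section TrigPolynomials.
Context {R : realType}.
Implicit Types (f g : R -> R) (p q : nat -> R) (a b c k t : R).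

Definition cosn (n : nat) t : R := cos (n%:R * t).
Definition sinn (n : nat) t : R := sin (n%:R * t).

Lemma is_derive_cosm k t : is_derive t 1 (fun t => cos (k * t)) (- (k * sin (k * t))).
Proof. by have := rderiv_cos (rderivZ k (rderiv_id t)); rewrite mulr1. Qed.

Lemma is_derive_sinm k t : is_derive t 1 (fun t => sin (k * t)) (k * cos (k * t)).
Proof. by have := rderiv_sin (rderivZ k (rderiv_id t)); rewrite mulr1. Qed.

Lemma continuous_cosm k : continuous (fun t => cos (k * t)).
Proof. by move=> t; exact: rderiv_cont (is_derive_cosm k t). Qed.

Lemma continuous_sinm k : continuous (fun t => sin (k * t)).
Proof. by move=> t; exact: rderiv_cont (is_derive_sinm k t). Qed.

Lemma bmfun_cosm a b k : bmfun a b (fun t => cos (k * t)).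
Proof. by apply: bmfun_cont => t _; exact: continuous_cosm. Qed.

Lemma bmfun_sinm a b k : bmfun a b (fun t => sin (k * t)).
Proof. by apply: bmfun_cont => t _; exact: continuous_sinm. Qed.

Lemma bmfun_cosn a b n : bmfun a b (cosn n).
Proof. exact: bmfun_cosm. Qed.

Lemma bmfun_sinn a b n : bmfun a b (sinn n).
Proof. exact: bmfun_sinm. Qed.

Lemma sin_npi n : sin (n%:R * pi) = 0 :> R.
Proof.
elim: n => [|n IH]; first by rewrite mul0r sin0.
by rewrite -natr1 mulrDl mul1r sinDpi IH oppr0.
Qed.

Lemma II_cosm k : sin (k * pi) = 0 -> k != 0 ->
  II (- pi) pi (fun t => cos (k * t)) = 0.
Proof.
move=> sk k0; have pi0 := pi_ge0 R.
have dg t : is_derive t 1 (fun t => k^-1 * sin (k * t)) (cos (k * t)).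
  apply: (is_derive_eq (rderivZ k^-1 (is_derive_sinm k t))).
  by rewrite mulrA mulVf// mul1r.
have -> : II (- pi) pi (fun t => cos (k * t)) =
    k^-1 * sin (k * pi) - k^-1 * sin (k * - pi).
  apply: (II_FTC _ (fun t _ => dg t)); last by move=> t _; exact: continuous_cosm.
  lra.
by rewrite mulrN sinN sk oppr0 mulr0 subr0.
Qed.

Lemma II_sinm k : II (- pi) pi (fun t => sin (k * t)) = 0.
Proof.
have [->|k0] := eqVneq k 0.
  rewrite (@II_eq _ _ _ _ (fun=> 0)) ?II_cst ?mul0r//; last first.
    by move=> t _; rewrite mul0r sin0.
  by have := pi_ge0 R; lra.
have pi0 := pi_ge0 R.
have dg t : is_derive t 1 (fun t => - (k^-1 * cos (k * t))) (sin (k * t)).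
  apply: (is_derive_eq (rderivN (rderivZ k^-1 (is_derive_cosm k t)))).
  by rewrite mulrN opprK mulrA mulVf// mul1r.
have -> : II (- pi) pi (fun t => sin (k * t)) =
    - (k^-1 * cos (k * pi)) - - (k^-1 * cos (k * - pi)).
  apply: (II_FTC _ (fun t _ => dg t)); last by move=> t _; exact: continuous_sinm.
  lra.
by rewrite mulrN cosN subrr.
Qed.

Let sin_sub i j : sin ((i%:R - j%:R) * pi) = 0 :> R.
Proof. by rewrite mulrBl sinB !sin_npi mul0r mulr0 subrr. Qed.

Let sin_add i j : sin ((i%:R + j%:R) * pi) = 0 :> R.
Proof. by rewrite mulrDl sinD !sin_npi mul0r mulr0 addr0. Qed.

Let diff_cos i j : II (- pi) pi (fun t => cos ((i%:R - j%:R) * t)) =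
  2 * pi * (i == j)%:R :> R.
Proof.
have pi0 := pi_ge0 R.
have [->|ij] := eqVneq i j.
  rewrite (@II_eq _ _ _ _ (fun=> 1)) ?II_cst ?mulr1; first by ring.
    lra.
  by move=> t _; rewrite subrr mul0r cos0.
by rewrite mulr0 II_cosm// subr_eq0 eqr_nat.
Qed.

Let sum_cos i j : (0 < i)%N -> II (- pi) pi (fun t => cos ((i%:R + j%:R) * t)) = 0 :> R.
Proof. by move=> i0; rewrite II_cosm// -natrD pnatr_eq0 addn_eq0 gt_eqF. Qed.

Lemma II_cos_cos i j : (0 < i)%N ->
  II (- pi) pi (fun t => cosn i t * cosn j t) = pi * (i == j)%:R :> R.
Proof.
move=> i0; rewrite (@II_eq _ _ _ _ (fun t => 2^-1 * (cos ((i%:R - j%:R) * t) +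
    cos ((i%:R + j%:R) * t)))).
  rewrite IIZ; last by apply: bmfunD; exact: bmfun_cosm.
  rewrite IID ?diff_cos ?sum_cos//; try exact: bmfun_cosm.
  by field.
by move=> t _; rewrite /cosn mulrBl mulrDl cosB cosD; field.
Qed.

Lemma II_sin_sin i j : (0 < i)%N ->
  II (- pi) pi (fun t => sinn i t * sinn j t) = pi * (i == j)%:R :> R.
Proof.
move=> i0; rewrite (@II_eq _ _ _ _ (fun t => 2^-1 * (cos ((i%:R - j%:R) * t) -
    cos ((i%:R + j%:R) * t)))).
  rewrite IIZ; last by apply: bmfunB; exact: bmfun_cosm.
  rewrite IIB ?diff_cos ?sum_cos//; try exact: bmfun_cosm.
  by field.
by move=> t _; rewrite /sinn mulrBl mulrDl cosB cosD; field.
Qed.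

Lemma II_sin_cos i j : II (- pi) pi (fun t => sinn i t * cosn j t) = 0 :> R.
Proof.
rewrite (@II_eq _ _ _ _ (fun t => 2^-1 * (sin ((i%:R - j%:R) * t) +
    sin ((i%:R + j%:R) * t)))).
  rewrite IIZ; last by apply: bmfunD; exact: bmfun_sinm.
  rewrite IID ?II_sinm ?addr0 ?mulr0//; exact: bmfun_sinm.
by move=> t _; rewrite /sinn /cosn mulrBl mulrDl sinB sinD; field.
Qed.

Lemma bmfun_sum a b (s : seq nat) (h : nat -> R -> R) :
  (forall i, bmfun a b (h i)) -> bmfun a b (fun t => \sum_(i <- s) h i t).
Proof.
move=> bh; elim: s => [|i s IH].
  have -> : (fun t => \sum_(i <- [::]) h i t) = fun=> 0.
    by apply/funext => t; rewrite big_nil.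
  exact: bmfun_cst.
have -> : (fun t => \sum_(j <- i :: s) h j t) =
    (fun t => h i t + \sum_(j <- s) h j t).
  by apply/funext => t; rewrite big_cons.
exact: bmfunD.
Qed.

Lemma II_sum a b (s : seq nat) (h : nat -> R -> R) : a <= b ->
  (forall i, bmfun a b (h i)) ->
  II a b (fun t => \sum_(i <- s) h i t) = \sum_(i <- s) II a b (h i).
Proof.
move=> ab bh; elim: s => [|i s IH].
  rewrite big_nil (@II_eq _ _ _ _ (fun=> 0)) ?II_cst ?mul0r// => t _.
  by rewrite big_nil.
rewrite big_cons -IH -IID//; last exact: bmfun_sum.
by apply: II_eq => t _; rewrite big_cons.
Qed.

Definition trig p q (m n : nat) t : R :=
  \sum_(m <= i < n) (p i * cosn i t + q i * sinn i t).

Lemma bmfun_trig_term a b p q i : bmfun a b (fun t => p i * cosn i t + q i * sinn i t).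
Proof.
apply: bmfunD; apply: bmfunM; try exact: bmfun_cst.
- exact: bmfun_cosn.
- exact: bmfun_sinn.
Qed.

Lemma bmfun_trig a b p q m n : bmfun a b (trig p q m n).
Proof. by apply: bmfun_sum => i; exact: bmfun_trig_term. Qed.

Lemma II_mul_trig a b g p q m n : a <= b -> bmfun a b g ->
  II a b (fun t => g t * trig p q m n t) =
  \sum_(m <= i < n) (p i * II a b (fun t => g t * cosn i t) +
                     q i * II a b (fun t => g t * sinn i t)).
Proof.
move=> ab bg.
have bc i : bmfun a b (fun t => g t * cosn i t) by apply: bmfunM => //; exact: bmfun_cosn.
have bs i : bmfun a b (fun t => g t * sinn i t) by apply: bmfunM => //; exact: bmfun_sinn.
rewrite (@II_eq _ _ _ _ (fun t => \sum_(m <= i < n) (p i * (g t * cosn i t) +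
   q i * (g t * sinn i t)))).
  rewrite II_sum//.
    by apply: eq_bigr => i _; rewrite IID ?IIZ//; apply: bmfunM => //; exact: bmfun_cst.
  by move=> i; apply: bmfunD; apply: bmfunM => //; exact: bmfun_cst.
move=> t _; rewrite /trig mulr_sumr; apply: eq_bigr => i _; ring.
Qed.

Lemma sum_delta (h : nat -> R) (m n j : nat) :
  \sum_(m <= i < n) h i * (i == j)%:R = if (m <= j < n)%N then h j else 0.
Proof.
case: ifPn => jmn.
  rewrite (bigD1_seq j) ?mem_index_iota ?iota_uniq//= eqxx mulr1 big1 ?addr0//.
  by move=> i /negPf ->; rewrite mulr0.
rewrite big_nat big1// => i imn; case: eqP => [ij|_]; last by rewrite mulr0.
by rewrite -ij imn in jmn.
Qed.

Let ab : - pi <= pi :> R. Proof. by have := pi_ge0 R; lra. Qed.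

Lemma II_cos_trig p q m n j : (0 < j)%N ->
  II (- pi) pi (fun t => cosn j t * trig p q m n t) =
  if (m <= j < n)%N then pi * p j else 0.
Proof.
move=> j0; rewrite II_mul_trig//; last exact: bmfun_cosn.
rewrite -(sum_delta (fun j => pi * p j)); apply: eq_bigr => i _.
rewrite II_cos_cos// (@II_eq _ _ _ _ (fun t => sinn i t * cosn j t)); last first.
  by move=> t _; rewrite mulrC.
by rewrite II_sin_cos eq_sym; ring.
Qed.

Lemma II_sin_trig p q m n j : (0 < j)%N ->
  II (- pi) pi (fun t => sinn j t * trig p q m n t) =
  if (m <= j < n)%N then pi * q j else 0.
Proof.
move=> j0; rewrite II_mul_trig//; last exact: bmfun_sinn.
rewrite -(sum_delta (fun j => pi * q j)); apply: eq_bigr => i _.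
by rewrite II_sin_sin// II_sin_cos eq_sym; ring.
Qed.

Lemma II_trig_sqr p q m n : (0 < m)%N ->
  II (- pi) pi (fun t => trig p q m n t ^+ 2) =
  pi * \sum_(m <= i < n) (p i ^+ 2 + q i ^+ 2).
Proof.
move=> m0; rewrite (@II_eq _ _ _ _ (fun t => trig p q m n t * trig p q m n t)).
  rewrite II_mul_trig//; last exact: bmfun_trig.
  rewrite mulr_sumr [LHS]big_nat [RHS]big_nat; apply: eq_bigr => i imn.
  have i0 : (0 < i)%N by have /andP[mi _] := imn; exact: leq_trans mi.
  under II_eq do rewrite mulrC.
  under [X in _ + _ * X]II_eq do rewrite mulrC.
  by rewrite II_cos_trig// II_sin_trig// imn; ring.
by move=> t _; rewrite expr2.
Qed.

Definition fcos g (n : nat) := pi^-1 * II (- pi) pi (fun t => g t * cosn n t).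
Definition fsin g (n : nat) := pi^-1 * II (- pi) pi (fun t => g t * sinn n t).

Lemma bessel g n : bmfun (- pi) pi g ->
  pi * \sum_(1 <= i < n) (fcos g i ^+ 2 + fsin g i ^+ 2) <=
  II (- pi) pi (fun t => g t ^+ 2).
Proof.
move=> bg; set S := pi * _; have pi0 : pi != 0 :> R by rewrite gt_eqF// pi_gt0.
have bT := bmfun_trig (- pi) pi (fcos g) (fsin g) 1 n.
have gT : II (- pi) pi (fun t => g t * trig (fcos g) (fsin g) 1 n t) = S.
  rewrite II_mul_trig// /S mulr_sumr; apply: eq_bigr => i _.
  rewrite /fcos /fsin; move: (II _ _ _) (II _ _ _) => u v.
  have h (x : R) : pi^-1 * x * x = pi * (pi^-1 * x) ^+ 2.
    by rewrite expr2 !mulrA divff// mul1r [x * _]mulrC.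
  by rewrite !h mulrDr.
have TT : II (- pi) pi (fun t => trig (fcos g) (fsin g) 1 n t ^+ 2) = S by exact: II_trig_sqr.
have : 0 <= II (- pi) pi (fun t => (g t - trig (fcos g) (fsin g) 1 n t) ^+ 2).
  by apply: II_ge0 => t _; exact: sqr_ge0.
have bgg : bmfun (- pi) pi (fun t => g t ^+ 2) by exact: bmfunM.
have bTT : bmfun (- pi) pi (fun t => trig (fcos g) (fsin g) 1 n t ^+ 2) by exact: bmfunM.
have bgT : bmfun (- pi) pi (fun t => 2 * (g t * trig (fcos g) (fsin g) 1 n t)).
  by apply: bmfunM; [exact: bmfun_cst|exact: bmfunM].
rewrite (@II_eq _ _ _ _ (fun t => g t ^+ 2 - 2 * (g t * trig (fcos g) (fsin g) 1 n t) +
  trig (fcos g) (fsin g) 1 n t ^+ 2)); last by move=> t _; ring.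
rewrite IID//; last exact: bmfunB.
rewrite IIB// IIZ; last exact: bmfunM.
by rewrite gT TT; lra.
Qed.

End TrigPolynomials.

(** * Fourier coefficients of periodic Lipschitz functions *)

Section Windows.
Context {R : realType}.
Implicit Types (f : R -> R) (a b c : R).

Lemma II_window f a c : (forall a b, bmfun a b f) ->
  (forall a b, a <= b -> II (a + 2 * pi) (b + 2 * pi) f = II a b f) ->
  `|c| <= 2 * pi -> II (a + c) (a + c + 2 * pi) f = II a (a + 2 * pi) f.
Proof.
move=> bf pf; have pi0 := pi_gt0 R.
have pos a' c' : 0 <= c' -> c' <= 2 * pi ->
    II (a' + c') (a' + c' + 2 * pi) f = II a' (a' + 2 * pi) f.
  move=> c0 cpi.
  rewrite (@II_split _ _ _ (a' + 2 * pi))//; last by apply/andP; split; lra.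
  rewrite (@II_split _ a' (a' + 2 * pi) (a' + c'))//; last by apply/andP; split; lra.
  by rewrite pf 1?addrC//; lra.
rewrite ler_norml => /andP[c1 c2].
have [c0|/ltW c0] := leP 0 c; first exact: pos.
have := pos (a + c) (- c); rewrite addrK => -> //; lra.
Qed.

End Windows.

Lemma lipschitz_continuous {R : realType} (Psi : R -> R) (m : R) :
  (forall x y, `|Psi x - Psi y| <= m * `|x - y|) -> continuous Psi.
Proof.
move=> lip x; apply/cvgrPdist_le => e e0.
have m0 : 0 < `|m| + 1 by rewrite ltr_wpDl.
have d0 : 0 < e / (`|m| + 1) by rewrite divr_gt0.
exists (e / (`|m| + 1)) => //= y /=; rewrite ltr_pdivlMr// => h.
apply: le_trans (lip _ _) _.
have : m * `|x - y| <= `|m| * `|x - y| by rewrite ler_wpM2r// ler_norm.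
have := normr_ge0 (x - y); lra.
Qed.

Section PeriodicFunctions.
Context {R : realType}.
Variables (Psi : R -> R) (M : R).
Hypothesis cPsi : continuous Psi.
Hypothesis per : forall x, Psi (x + 2 * pi) = Psi x.
Hypothesis PM : forall x, `|Psi x| <= M.
Implicit Types (a b c h t tau : R).

Let rP : regularized Psi Psi := regularized_continuous PM cPsi.

Let rPh h : regularized (fun t => Psi (t + h)) (fun t => Psi (t + h)).
Proof.
apply: (@regularized_continuous _ _ M) => // t.
apply: (@continuous_comp _ _ _ (fun t => t + h) Psi); last exact: cPsi.
exact: rderiv_cont (rderivD (rderiv_id t) (rderiv_cst h t)).
Qed.

Lemma is_derive_cos_phase (k c t : R) : k != 0 ->
  is_derive t 1 (fun t => k^-1 * sin (k * t + c)) (cos (k * t + c)).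
Proof.
move=> k0; apply: (is_derive_eq (rderivZ k^-1 (rderiv_sin
  (rderivD (rderivZ k (rderiv_id t)) (rderiv_cst c t))))).
by rewrite mulr1 addr0 mulrA mulVf// mul1r.
Qed.

Lemma continuous_cos_phase (k c : R) : continuous (fun t => cos (k * t + c)).
Proof.
move=> t; exact: rderiv_cont (rderiv_cos
  (rderivD (rderivZ k (rderiv_id t)) (rderiv_cst c t))).
Qed.

Lemma bmfun_cos_phase a b (k c : R) : bmfun a b (fun t => cos (k * t + c)).
Proof. by apply: bmfun_cont => t _; exact: continuous_cos_phase. Qed.

Lemma cosn_period (n : nat) x : cos (x + n%:R * (2 * pi)) = cos x :> R.
Proof.
elim: n x => [|n IH] x; first by rewrite mul0r addr0.
have pi2 : 2 * pi = pi *+ 2 :> R by rewrite mulr_natl.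
by rewrite -natr1 mulrDl mul1r addrA {2}pi2 cosD2pi IH.
Qed.

Lemma II_Psi_shift a b h (n : nat) c : a <= b -> (0 < n)%N ->
  II (a + h) (b + h) (fun t => Psi t * cos (n%:R * t + c)) =
  II a b (fun t => Psi (t + h) * cos (n%:R * t + (n%:R * h + c))).
Proof.
move=> ab n0; have n0' : n%:R != 0 :> R by rewrite pnatr_eq0 -lt0n.
rewrite (II_shift ab rP (rPh h) (fun x => erefl)
  (fun t => is_derive_cos_phase c t n0') (@continuous_cos_phase n%:R c)).
by apply: II_eq => t _; rewrite mulrDr addrA.
Qed.

Lemma II_Psi_window a h (n : nat) c : (0 < n)%N -> `|h| <= 2 * pi ->
  II (a + h) (a + h + 2 * pi) (fun t => Psi t * cos (n%:R * t + c)) =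
  II a (a + 2 * pi) (fun t => Psi t * cos (n%:R * t + c)).
Proof.
move=> n0 hpi; apply: II_window => //.
- move=> a' b'; apply: bmfunM; first exact: regularized_bmfun rP.
  exact: bmfun_cos_phase.
- move=> a' b' ab; rewrite II_Psi_shift//; apply: II_eq => t _.
  by rewrite per [_ + c]addrC addrA cosn_period.
Qed.

Lemma II_Psi_translate h (n : nat) c : (0 < n)%N -> `|h| <= 2 * pi ->
  II (- pi) pi (fun t => Psi (t + h) * cos (n%:R * t + c)) =
  II (- pi) pi (fun t => Psi t * cos (n%:R * t + (c - n%:R * h))).
Proof.
move=> n0 hpi; have pi0 := pi_gt0 R; have ab : - pi <= pi :> R by lra.
have := II_Psi_shift h (c - n%:R * h) ab n0.
rewrite [n%:R * h + _]addrC subrK => <-.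
have := II_Psi_window (- pi) (c - n%:R * h) n0 hpi.
rewrite (_ : - pi + h + 2 * pi = pi + h); last by ring.
by rewrite (_ : - pi + 2 * pi = pi)//; ring.
Qed.

(* The coefficients of D h carry the factor 2 sin (n h): Bessel for D h with
   h -> 0 bounds the sum of n^2 |c_n|^2. *)
Let D h t := Psi (t + h) - Psi (t + - h).

Let bPh a b h : bmfun a b (fun t => Psi (t + h)) := regularized_bmfun a b (rPh h).
Let bP a b : bmfun a b Psi := regularized_bmfun a b rP.

Lemma II_D_phase h (n : nat) c : (0 < n)%N -> `|h| <= 2 * pi ->
  II (- pi) pi (fun t => D h t * cos (n%:R * t + c)) =
  2 * sin (n%:R * h) * II (- pi) pi (fun t => Psi t * sin (n%:R * t + c)).
Proof.
move=> n0 hpi.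
have bc k c' : bmfun (- pi) pi (fun t => cos (k * t + c')) by exact: bmfun_cos_phase.
rewrite (@II_eq _ _ _ _ (fun t => Psi (t + h) * cos (n%:R * t + c) -
  Psi (t + - h) * cos (n%:R * t + c))); last by move=> t _; rewrite /D; ring.
rewrite IIB; [|exact: bmfunM|exact: bmfunM].
rewrite II_Psi_translate// II_Psi_translate ?normrN//.
rewrite -IIB; [|exact: bmfunM|exact: bmfunM].
rewrite -IIZ.
  apply: II_eq => t _; rewrite mulrN opprK !addrA.
  by move: (n%:R * t + c) (n%:R * h) => u v; rewrite cosB cosD; ring.
apply: bmfunM => //.
have -> : (fun t => sin (n%:R * t + c)) = (fun t => cos (n%:R * t + (c - pi / 2))).
  by apply/funext => t; rewrite addrA cosBpihalf.
exact: bc.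
Qed.

Lemma fcos_D h (n : nat) : (0 < n)%N -> `|h| <= 2 * pi ->
  fcos (D h) n = 2 * sin (n%:R * h) * fsin Psi n.
Proof.
move=> n0 hpi; have := II_D_phase 0 n0 hpi.
rewrite /fcos /fsin; under II_eq do rewrite addr0.
rewrite /cosn => ->; under [in LHS]II_eq do rewrite addr0.
by rewrite mulrCA.
Qed.

Lemma fsin_D h (n : nat) : (0 < n)%N -> `|h| <= 2 * pi ->
  fsin (D h) n = - (2 * sin (n%:R * h) * fcos Psi n).
Proof.
move=> n0 hpi; have := II_D_phase (- (pi / 2)) n0 hpi.
rewrite /fcos /fsin; under II_eq do rewrite cosBpihalf.
rewrite /sinn => ->; under [in LHS]II_eq do rewrite sinBpihalf mulrN.
rewrite IIN; last by apply: bmfunM => //; exact: bmfun_cosn.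
by rewrite /cosn; ring.
Qed.

(** The function [D h] is at most 2 m h in absolute value, so Bessel bounds its coefficients by 2 (2
    m h)^2 = 8 m^2 h^2; division by h^2 leaves the constant. *)
Lemma lipschitz_fourier (m : R) (N : nat) : 0 <= m ->
  (forall x y, `|Psi x - Psi y| <= m * `|x - y|) ->
  \sum_(1 <= n < N) n%:R ^+ 2 * (fcos Psi n ^+ 2 + fsin Psi n ^+ 2) <= 8 * m ^+ 2.
Proof.
move=> m0 lip; have pi0 := pi_gt0 R; have ab : - pi <= pi :> R by lra.
case: N => [|N]; first by rewrite big_geq// mulr_ge0// sqr_ge0.
(* Then n h <= 1 <= pi / 2 for all n in the sum, so that 2 sin (n h) >= n h. *)
pose h : R := N.+1%:R^-1.
have h0 : 0 < h by rewrite invr_gt0.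
have h1 : h <= 1 by rewrite invf_le1// ler1n.
have hpi : `|h| <= 2 * pi.
  by rewrite gtr0_norm//; have := pi_ge2 R; lra.
have bD : bmfun (- pi) pi (D h) by exact: bmfunB.
have D2 : II (- pi) pi (fun t => D h t ^+ 2) <= (2 * m * h) ^+ 2 * (2 * pi).
  rewrite (_ : 2 * pi = pi - - pi); last by ring.
  rewrite -II_cst//; apply: le_II; [exact: bmfunM|exact: bmfun_cst|].
  move=> t _; rewrite -real_normK ?num_real// lerXn2r ?nnegrE//.
    by rewrite !mulr_ge0// ltW.
  apply: le_trans (lip _ _) _.
  rewrite (_ : t + h - (t + - h) = 2 * h); last by ring.
  by rewrite gtr0_norm ?mulr_gt0// le_eqVlt mulrA [m * 2]mulrC eqxx.
have := le_trans (bessel N.+1 bD) D2.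
rewrite [_ * (2 * pi)]mulrA [X in _ <= X]mulrC ler_pM2l// => hb.
have : h ^+ 2 * \sum_(1 <= n < N.+1) n%:R ^+ 2 * (fcos Psi n ^+ 2 + fsin Psi n ^+ 2)
    <= \sum_(1 <= i < N.+1) (fcos (D h) i ^+ 2 + fsin (D h) i ^+ 2).
  rewrite mulr_sumr big_nat [leRHS]big_nat; apply: ler_sum => n /andP[n0 nN].
  have -> : fcos (D h) n ^+ 2 + fsin (D h) n ^+ 2 =
      (2 * sin (n%:R * h)) ^+ 2 * (fcos Psi n ^+ 2 + fsin Psi n ^+ 2).
    by rewrite fcos_D// fsin_D//; ring.
  rewrite mulrA ler_wpM2r ?addr_ge0 ?sqr_ge0// -exprMn.
  have nh0 : 0 <= n%:R * h by rewrite mulr_ge0// ltW.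
  have nh1 : n%:R * h <= pi / 2.
    apply: le_trans (pihalf_ge1 R); rewrite /h ler_pdivrMr// mul1r ler_nat.
    exact: ltnW.
  have := le_half_sin (introT andP (conj nh0 nh1)) => hs.
  rewrite lerXn2r// ?nnegrE; [by rewrite mulr_ge0// ltW|by rewrite mulr_ge0//; lra|].
  rewrite mulrC; lra.
move=> /le_trans /(_ hb).
have -> : (2 * m * h) ^+ 2 * 2 = h ^+ 2 * (8 * m ^+ 2) by ring.
by rewrite ler_pM2l// exprn_gt0.
Qed.

End PeriodicFunctions.

(** * Conjugate functions of periodic Lipschitz functions *)

Section DominatedConvergence.
Context {R : realType}.
Local Notation mu := (@lebesgue_measure R).
Implicit Types (a b x t : R) (f : R -> R) (u : nat -> R -> R).

Lemma II_dct a b u f (g : R -> \bar R) :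
  (forall n, measurable_fun `[a, b] (u n)) -> measurable_fun `[a, b] f ->
  {ae mu, forall x, a <= x <= b -> u n x @[n --> \oo] --> f x} ->
  mu.-integrable `[a, b] g ->
  (forall n x, a <= x <= b -> (`|u n x|%:E <= g x)%E) ->
  II a b (u n) @[n --> \oo] --> II a b f.
Proof.
move=> mu_ mf uf ig ug.
pose D : set R := `[a, b]%classic.
have [] := @dominated_convergence _ _ _ mu D (measurable_itv _)
  (fun n x => (u n x)%:E) (EFin \o f) g.
- by move=> n; apply/measurable_EFinP; exact: mu_.
- exact/measurable_EFinP.
- apply: aeS uf => x ux; rewrite /D /= in_itv /= => /ux h.
  by apply: cvg_EFin; first exact: nearW.
- exact: ig.
- by apply/aeW => x n; rewrite /D /= in_itv /= => /ug.
move=> if_ _ h; rewrite /II /Rintegral; apply: fine_cvg.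
by rewrite fineK//; exact: integrable_fin_num.
Qed.

Lemma II_bounded_cvg a b u f M : (forall n, measurable_fun `[a, b] (u n)) ->
  (forall n x, a <= x <= b -> `|u n x| <= M) ->
  (forall x, a <= x <= b -> u n x @[n --> \oo] --> f x) ->
  bmfun a b f /\ II a b (u n) @[n --> \oo] --> II a b f.
Proof.
move=> mu_ uM uf.
have mf : measurable_fun `[a, b] f.
  apply: (measurable_fun_cvg mu_) => x /=; rewrite in_itv /=; exact: uf.
split.
  split => //; exists M => x xab.
  have h : `|u n x| @[n --> \oo] --> `|f x| by apply: cvg_norm; exact: uf.
  rewrite -(cvg_lim (@Rhausdorff R) h); apply: limr_le.
    by apply/cvg_ex; exists `|f x|.
  by apply: nearW => n; exact: uM.
apply: (II_dct mu_ mf (g := fun=> M%:E)).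
- by apply/aeW => x; exact: uf.
- exact: (bmfun_itg (bmfun_cst a b M)).
- by move=> n x xab; rewrite lee_fin uM.
Qed.

Lemma bounded_series_cvg (c v : nat -> R) C : (forall k, `|v k| <= c k) ->
  (forall n, \sum_(0 <= k < n) c k <= C) -> cvgn (series v).
Proof.
move=> vc cC; apply: normed_cvg; apply: nondecreasing_is_cvgn.
  by apply: (@nondecreasing_series _ (fun k => `|v k|) xpredT 0%N).
exists C => _ [n _ <-]; apply: le_trans (cC n).
by rewrite /series /=; apply: ler_sum.
Qed.

(** The sum g of the |T k| is integrable, hence finite almost everywhere; there the series converges
    absolutely, and g dominates its partial sums. *)
Lemma L1_series a b (T : nat -> R -> R) (c : nat -> R) C : a <= b ->
  (forall k, bmfun a b (T k)) ->
  (forall k, II a b (fun t => `|T k t|) <= c k) ->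
  (forall n, \sum_(0 <= k < n) c k <= C) ->
  exists f : R -> R, mu.-integrable setT (EFin \o f) /\
    forall x, a <= x <= b ->
      II a x (fun t => \sum_(0 <= k < n) T k t) @[n --> \oo] --> II a x f.
Proof.
move=> ab bT Tc cC.
pose D : set R := `[a, b]%classic.
have mD : measurable D by exact: measurable_itv.
pose g t : \bar R := (\sum_(0 <= k <oo) `|T k t|%:E)%E.
have mT k : measurable_fun D (fun t => `|T k t|%:E).
  by apply/measurable_EFinP; have [] := bmfun_norm (bT k).
have mg : measurable_fun D g.
  by apply: ge0_emeasurable_sum => // k x _ _; rewrite lee_fin.
have g0 t : (0 <= g t)%E by apply: nneseries_ge0 => k _ _; rewrite lee_fin.
have ig : mu.-integrable D g.
  apply/integrableP; split => //.
  under eq_integral => t _ do rewrite gee0_abs//.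
  rewrite integral_nneseries//.
  apply: (@le_lt_trans _ _ C%:E); last by rewrite ltry.
  apply: lime_le.
    by apply: is_cvg_nneseries => k _ _; apply: integral_ge0 => t _; rewrite lee_fin.
  apply: nearW => n.
  apply: le_trans (_ : (\sum_(0 <= k < n) (c k)%:E <= _)%E); last first.
    by rewrite sumEFin lee_fin.
  apply: lee_sum => k _.
  have ik := bmfun_itg (bmfun_norm (bT k)).
  rewrite -[X in (X <= _)%E]fineK ?lee_fin; first exact: Tc.
  exact: integrable_fin_num.
pose S n t := \sum_(0 <= k < n) T k t.
have mS n : measurable_fun D (S n).
  by have [] := @bmfun_sum R a b (index_iota 0 n) T bT.
have Sg n t : (`|S n t|%:E <= g t)%E.
  apply: (@le_trans _ _ (\sum_(0 <= k < n) `|T k t|%:E)%E).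
    by rewrite sumEFin lee_fin ler_norm_sum.
  by apply: nneseries_lim_ge => k _ _; rewrite lee_fin.
pose l t := limn_sup (S ^~ t).
have Sl : {ae mu, forall t, D t -> S n t @[n --> \oo] --> l t}.
  apply: (@aeS _ (fun t => D t -> g t \is a fin_num)); last exact: integrable_ae.
  move=> t gt /gt gfin.
  have cS : cvgn (S ^~ t).
    have := @bounded_series_cvg (fun k => `|T k t|) (fun k => T k t) (fine (g t)).
    apply => // n; rewrite -lee_fin fineK// -sumEFin.
    by apply: nneseries_lim_ge => k _ _; rewrite lee_fin.
  by rewrite /l (cvg_limn_supE cS); exact: cS.
(* The upper limit is measurable and agrees with the limit wherever that exists. The restriction to
   D makes f integrable on the whole line, as Lebesgue differentiation will ask. *)
pose f := (fun t => fine (limn_esup (fun n => (S n t)%:E))) \_ D.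
have Sf : {ae mu, forall t, D t -> S n t @[n --> \oo] --> f t}.
  apply: aeS Sl => t St Dt; have h := St Dt.
  have h2 : (S n t)%:E @[n --> \oo] --> (l t)%:E by apply: cvg_EFin; first exact: nearW.
  by rewrite /f patchE mem_set// (cvg_limn_einf_sup h2).2.
have mf0 : measurable_fun D (fun t => fine (limn_esup (fun n => (S n t)%:E))).
  apply: measurableT_comp => //; apply: measurable_fun_limn_esup => n.
  by apply/measurable_EFinP.
have mf : measurable_fun D f.
  by apply: (eq_measurable_fun _ _ mf0) => t tD; rewrite /f patchE tD.
have if_ : mu.-integrable D (EFin \o f).
  have [] := @dominated_convergence _ _ _ mu D mD
    (fun n x => (S n x)%:E) (EFin \o f) g => //.
  - by move=> n; apply/measurable_EFinP; exact: mS.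
  - exact/measurable_EFinP.
  - apply: aeS Sf => x Sx /Sx h.
    by apply: cvg_EFin; first exact: nearW.
  - by apply/aeW => x n _; exact: Sg.
exists f; split.
  have h := proj1 (@integrable_mkcond _ _ _ mu D (EFin \o f) (measurable_itv _)) if_.
  apply: eq_integrable h => // t _; rewrite patchE; case: ifPn => // tD.
  by rewrite /= /f patchE (negbTE tD).
move=> x /andP[ax xb].
have sub : `[a, x]%classic `<=` D by apply: subset_itvl; rewrite bnd_simp.
apply: (@II_dct a x S f g).
- by move=> n; exact: measurable_funS (mS n).
- exact: measurable_funS mf.
- apply: aeS Sf => t St /andP[at_ tx]; apply: St.
  by rewrite /D /= in_itv /= at_ (le_trans tx).
- exact: integrableS ig.
- by move=> n t _; exact: Sg.
Qed.

End DominatedConvergence.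

Section DerivedTrigPolynomials.
Context {R : realType}.
Implicit Types (p q : nat -> R) (t : R).

Lemma is_derive_trig p q m n t :
  is_derive t 1 (trig (fun i => - q i) p m n)
    (trig (fun i => i%:R * p i) (fun i => i%:R * q i) m n t).
Proof.
rewrite /trig; elim: (index_iota m n) => [|i s IH].
  rewrite big_nil (_ : (fun t => _) = fun=> 0); first exact: rderiv_cst.
  by apply/funext => u; rewrite big_nil.
rewrite big_cons (_ : (fun t => _) = fun u => (- q i * cosn i u + p i * sinn i u) +
    \sum_(j <- s) (- q j * cosn j u + p j * sinn j u)); last first.
  by apply/funext => u; rewrite big_cons.
apply: rderivD => //.
apply: (is_derive_eq (rderivD (rderivZ (- q i) (is_derive_cosm i%:R t))
  (rderivZ (p i) (is_derive_sinm i%:R t)))).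
by rewrite /cosn /sinn; ring.
Qed.

Lemma continuous_trig p q m n : continuous (trig p q m n).
Proof.
move=> t; have := rderiv_cont (is_derive_trig q (fun i => - p i) m n t).
have -> // : (fun i => - - p i) = p by apply/funext => i; rewrite opprK.
Qed.

Lemma trig_2pi p q m n t : trig p q m n (t + 2 * pi) = trig p q m n t.
Proof.
apply: eq_bigr => i _; rewrite /cosn /sinn mulrDr cosn_period.
by rewrite -2!cosBpihalf addrAC cosn_period.
Qed.

Lemma trig_bound p q m n t :
  `|trig p q m n t| <= \sum_(m <= i < n) (`|p i| + `|q i|).
Proof.
apply: le_trans (ler_norm_sum _ _ _) _; apply: ler_sum => i _.
apply: le_trans (ler_normD _ _) _; rewrite !normrM lerD//.
- by rewrite ler_piMr// cos_max.
- by rewrite ler_piMr// sin_max.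
Qed.

Lemma II_trig0 p q m n : (0 < m)%N -> II (- pi) pi (trig p q m n) = 0.
Proof.
move=> m0; have ab : - pi <= pi :> R by have := pi_ge0 R; lra.
rewrite (@II_eq _ _ _ _ (fun t => 1 * trig p q m n t)); last first.
  by move=> t _; rewrite mul1r.
rewrite II_mul_trig//; last exact: bmfun_cst.
rewrite big_nat big1// => i /andP[mi _].
rewrite (@II_eq _ _ _ _ (cosn i)); last by move=> t _; rewrite mul1r.
rewrite (@II_eq _ _ _ (fun t => 1 * sinn i t) (sinn i)); last first.
  by move=> t _; rewrite mul1r.
rewrite II_sinm II_cosm ?sin_npi ?mulr0 ?addr0//.
by rewrite pnatr_eq0 -lt0n (leq_trans m0 mi).
Qed.

Lemma trig_cat p q m n k t : (m <= n)%N -> (n <= k)%N ->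
  trig p q m k t = trig p q m n t + trig p q n k t.
Proof. by move=> mn nk; rewrite /trig (big_cat_nat mn nk). Qed.

Lemma II_trig_window p q m n (h : R) (j : nat) (c : R) : (0 < j)%N ->
  `|h| <= 2 * pi ->
  II (- pi + h) (- pi + h + 2 * pi) (fun t => trig p q m n t * cos (j%:R * t + c)) =
  II (- pi) pi (fun t => trig p q m n t * cos (j%:R * t + c)).
Proof.
move=> j0 hpi; rewrite (II_Psi_window (@continuous_trig p q m n)
  (@trig_2pi p q m n) (@trig_bound p q m n) (- pi) c j0 hpi).
by rewrite (_ : - pi + 2 * pi = pi)//; ring.
Qed.

End DerivedTrigPolynomials.

(** * Construction of the conjugate function from its Fourier coefficients *)

Section ConjugateFunction.
Context {R : realType}.
Local Notation mu := (@lebesgue_measure R).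
Variables (p q : nat -> R) (B : R).
Hypothesis pqB : forall N : nat,
  \sum_(1 <= n < N) n%:R ^+ 2 * (p n ^+ 2 + q n ^+ 2) <= B.
Implicit Types (t x : R) (k n : nat).

Let En (n : nat) := n%:R ^+ 2 * (p n ^+ 2 + q n ^+ 2).
Let En0 n : 0 <= En n.
Proof. by rewrite mulr_ge0 ?addr_ge0 ?sqr_ge0. Qed.

Lemma square_tail (e : R) : 0 < e -> exists N : nat,
  forall n k, (N <= n)%N -> (n <= k)%N -> \sum_(n <= i < k) En i <= e.
Proof.
move=> e0; pose A := range (fun N => \sum_(1 <= n < N) En n).
have hA : has_sup A.
  split; first by exists (\sum_(1 <= n < 0) En n), 0%N.
  by exists B => _ [N _ <-]; exact: pqB.
have [_ [N _ <-] hN] := sup_adherent e0 hA.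
exists N.+1 => n k Nn nk.
have h1 : \sum_(1 <= i < k) En i <= sup A.
  by apply: sup_upper_bound => //; exists k.
have n1 : (1 <= n)%N by exact: leq_ltn_trans Nn.
have := h1; rewrite (big_cat_nat n1 nk) /=.
have : \sum_(1 <= i < N) En i <= \sum_(1 <= i < n) En i.
  case: N Nn {hN} => [|N] Nn; first by rewrite big_geq// sumr_ge0.
  rewrite [leRHS](@big_cat_nat _ _ _ N.+1)//=; last by rewrite ltnW.
  by rewrite lerDl sumr_ge0.
lra.
Qed.

(* Along these blocks the differentiated series converges absolutely in L^1, so
   the conjugate function is an indefinite integral. *)
Lemma lacunary_blocks : exists NN : nat -> nat, [/\ NN 0%N = 1%N,
  forall k, (NN k < NN k.+1)%N &
  forall k, \sum_(NN k.+1 <= i < NN k.+2) En i <= (2^-1 ^+ 2) ^+ k].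
Proof.
have h k : exists N : nat, forall n l, (N <= n)%N -> (n <= l)%N ->
    \sum_(n <= i < l) En i <= (2^-1 ^+ 2) ^+ k.
  by apply: square_tail; rewrite !exprn_gt0// invr_gt0.
have [Nf NfP] := choice h.
(* The block starting at [NN k.+1] lies beyond [Nf k]; the first block, from 1 to [NN 1], carries no
   bound. *)
pose fix NN k := if k is k'.+1 then maxn (NN k').+1 (Nf k') else 1%N.
exists NN; split => // k.
- by rewrite /= leq_max leqnn.
- apply: NfP; first by rewrite /= leq_max leqnn orbT.
  by rewrite [NN k.+2]/= leq_max leqnSn.
Qed.

Section Blocks.
Variable NN : nat -> nat.
Hypothesis NN0 : NN 0%N = 1%N.
Hypothesis NNlt : forall k, (NN k < NN k.+1)%N.
Hypothesis NNE : forall k, \sum_(NN k.+1 <= i < NN k.+2) En i <= (2^-1 ^+ 2) ^+ k.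

Let NN_gt k : (k < NN k)%N.
Proof. by elim: k => [|k IH]; [rewrite NN0|exact: leq_ltn_trans IH (NNlt k)]. Qed.

Let NN1 k : (0 < NN k)%N. Proof. exact: leq_ltn_trans (NN_gt k). Qed.

Let T k : R -> R :=
  trig (fun i => i%:R * p i) (fun i => i%:R * q i) (NN k) (NN k.+1).
(** A block of the series conjugate to that with coefficients p and q; its derivative is [T k]. *)
Let Bk k : R -> R := trig (fun i => - q i) p (NN k) (NN k.+1).
Let c k : R := II (- pi) pi (fun t => `|T k t|).
Let ab : - pi <= pi :> R. Proof. by have := pi_ge0 R; lra. Qed.

Let bT k a b : bmfun a b (T k). Proof. exact: bmfun_trig. Qed.

(** In place of Cauchy-Schwarz, 2 |T| <= T^2 / r + r with r = 2^-k. As the integral of T^2 is at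
    most pi r^2, the result is at most 3 pi r / 2. *)
Let c_le k : c k.+1 <= 2 * pi * 2^-1 ^+ k.
Proof.
pose r : R := 2^-1 ^+ k.
have r0 : 0 < r by rewrite exprn_gt0// invr_gt0.
apply: (@le_trans _ _ (II (- pi) pi (fun t => 2^-1 * (r^-1 * T k.+1 t ^+ 2 + r)))).
  apply: le_II.
  - exact: bmfun_norm.
  - apply: bmfunM; first exact: bmfun_cst.
    apply: bmfunD; last exact: bmfun_cst.
    by apply: bmfunM; [exact: bmfun_cst|exact: bmfunM].
  - move=> t _; rewrite -[T _ _ ^+ 2]real_normK ?num_real//.
    move: `|T k.+1 t| => s.
    have : 0 <= r^-1 * (s - r) ^+ 2 by rewrite mulr_ge0 ?sqr_ge0// invr_ge0 ltW.
    have -> : r^-1 * (s - r) ^+ 2 = r^-1 * s ^+ 2 + r - 2 * s.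
      by field; rewrite gt_eqF.
    lra.
have bTT : bmfun (- pi) pi (fun t => T k.+1 t ^+ 2) by exact: bmfunM.
have brT : bmfun (- pi) pi (fun t => r^-1 * T k.+1 t ^+ 2).
  by apply: bmfunM => //; exact: bmfun_cst.
rewrite IIZ; last by apply: bmfunD => //; exact: bmfun_cst.
rewrite IID//; last exact: bmfun_cst.
rewrite IIZ// II_cst// II_trig_sqr//.
have hE : \sum_(NN k.+1 <= i < NN k.+2) ((i%:R * p i) ^+ 2 + (i%:R * q i) ^+ 2) <= r ^+ 2.
  apply: le_trans (_ : _ <= \sum_(NN k.+1 <= i < NN k.+2) En i) _.
    by apply: ler_sum => i _; rewrite /En mulrDr !exprMn.
  by apply: le_trans (NNE k) _; rewrite /r -!exprM mulnC.
have h1 : r^-1 * (pi * \sum_(NN k.+1 <= i < NN k.+2)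
    ((i%:R * p i) ^+ 2 + (i%:R * q i) ^+ 2)) <= pi * r.
  have -> : pi * r = r^-1 * (pi * r ^+ 2) by field; rewrite gt_eqF.
  by rewrite ler_pM2l ?invr_gt0// ler_pM2l// pi_gt0.
rewrite -/r; have := pi_gt0 R; move: h1; nra.
Qed.

(** The first block, plus the sum of the geometric series 2 pi 2^-k. *)
Let C : R := c 0%N + 4 * pi.

Let c0 k : 0 <= c k. Proof. by apply: II_ge0 => t _. Qed.

Let sum_c n : \sum_(0 <= k < n) c k <= C.
Proof.
have pi0 := pi_gt0 R.
case: n => [|n].
  by rewrite big_geq// /C addr_ge0// mulr_ge0// ltW.
rewrite big_nat_recl//= /C lerD2l.
apply: le_trans (_ : _ <= \sum_(0 <= k < n) 2 * pi * 2^-1 ^+ k) _.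
  exact: ler_sum.
suff : \sum_(0 <= k < n) 2 * pi * 2^-1 ^+ k = 4 * pi * (1 - 2^-1 ^+ n) :> R.
  by move=> ->; rewrite ler_piMr ?mulr_ge0 ?(ltW pi0)// lerBlDr lerDl exprn_ge0// invr_ge0.
elim: n => [|n IH]; first by rewrite big_geq// expr0 subrr mulr0.
by rewrite big_nat_recr//= IH exprS; field.
Qed.

Let dB k t : is_derive t 1 (Bk k) (T k t). Proof. exact: is_derive_trig. Qed.

(** A block has mean zero, so its value at x is the mean over y of Bk x - Bk y, and each such
    difference is at most the integral of |T|. *)
Let Bk_le k x : - pi <= x <= pi -> `|Bk k x| <= c k.
Proof.
move=> /andP[x1 x2]; have pi0 := pi_gt0 R.
have bB : bmfun (- pi) pi (Bk k) by exact: bmfun_trig.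
have ftc y z : y <= z -> II y z (T k) = Bk k z - Bk k y.
  by move=> yz; apply: II_FTC => // t _; exact: continuous_trig.
have hyz y z : - pi <= y -> y <= z -> z <= pi -> `|Bk k z - Bk k y| <= c k.
  move=> y1 yz z1; rewrite -ftc//.
  apply: le_trans (le_norm_II (bT k y z) (bmfun_norm (bT k y z)) (fun t _ => lexx _)) _.
  have bn a b := bmfun_norm (bT k a b).
  rewrite /c (@II_split _ (- pi) pi y)//; last by rewrite y1 (le_trans yz).
  rewrite (@II_split _ y pi z)//; last by rewrite yz.
  rewrite addrCA lerDl addr_ge0//; exact: II_ge0.
have hx y : - pi <= y <= pi -> `|Bk k x - Bk k y| <= c k.
  move=> /andP[y1 y2]; have [xy|/ltW yx] := leP x y; last exact: hyz.
  by rewrite distrC; exact: hyz.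
have : `|II (- pi) pi (fun y => Bk k x - Bk k y)| <= II (- pi) pi (fun=> c k).
  by apply: le_norm_II => //; [apply: bmfunB => //; exact: bmfun_cst|exact: bmfun_cst].
rewrite IIB ?II_cst//; last exact: bmfun_cst.
rewrite /Bk II_trig0// subr0 -/(Bk k) opprK normrM.
by rewrite [`|pi + pi|]ger0_norm ?ler_pM2r//; lra.
Qed.

Let Bk_le2 k x : `|x| <= 2 * pi -> `|Bk k x| <= c k.
Proof.
rewrite ler_norml => /andP[x1 x2].
have [xpi|pix] := leP x pi; last first.
  rewrite -[x](subrK (2 * pi)) /Bk trig_2pi; apply: Bk_le; apply/andP; split; lra.
have [pix|xpi'] := leP (- pi) x; first by apply: Bk_le; rewrite pix.
rewrite /Bk -trig_2pi; apply: Bk_le; apply/andP; split; lra.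
Qed.

Let I2 : set R := `[- (2 * pi), 2 * pi]%classic.
Let in_I2 x : (x \in I2) = (`|x| <= 2 * pi).
Proof. by rewrite ler_norml; apply/idP/idP; rewrite inE /I2 /= in_itv. Qed.

(** The cut-off gives convergence and the bound C on the whole line, while [I2] still contains every
    window [tau - pi, tau + pi] with |tau| <= pi. *)
Let u n x := \1_I2 x * \sum_(0 <= k < n) Bk k x.

Let sumB n x : \sum_(0 <= k < n) Bk k x = trig (fun i => - q i) p 1 (NN n) x.
Proof.
elim: n => [|n IH]; first by rewrite big_geq// NN0 /trig big_geq.
by rewrite big_nat_recr//= IH -trig_cat// ltnW.
Qed.

Let u_le n x : `|u n x| <= C.
Proof.
have C0 : 0 <= C by apply: le_trans (sum_c 0); rewrite big_geq.
rewrite /u indicE in_I2; have [xpi|_] := leP `|x| (2 * pi).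
  rewrite mul1r; apply: le_trans (ler_norm_sum _ _ _) _; apply: le_trans (sum_c n).
  by apply: ler_sum => k _; exact: Bk_le2.
by rewrite mul0r normr0.
Qed.

Let K x := limn (u ^~ x).

Let u_cvg x : u n x @[n --> \oo] --> K x.
Proof.
suff : cvgn (u ^~ x) by [].
rewrite /u indicE in_I2; have [xpi|_] := leP `|x| (2 * pi); last first.
  by under eq_fun do rewrite mul0r; exact: is_cvg_cst.
under eq_fun do rewrite mul1r.
exact: (bounded_series_cvg (fun k => Bk_le2 k xpi) sum_c).
Qed.

Let mu_ n a b : bmfun a b (u n).
Proof.
split; last by exists C => x _; exact: u_le.
apply: measurable_funM; first by apply: measurable_indic; exact: measurable_itv.
by have [] := @bmfun_sum R a b (index_iota 0 n) Bk (fun k => bmfun_trig _ _ _ _ _ _).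
Qed.

Let bK a b : bmfun a b K.
Proof.
have mu' n : measurable_fun `[a, b] (u n) by have [] := mu_ n a b.
by have [] := @II_bounded_cvg R a b u K C mu' (fun n x _ => u_le n x) (fun x _ => @u_cvg x).
Qed.

Let K_le x : `|K x| <= C.
Proof.
have h : `|u n x| @[n --> \oo] --> `|K x| by apply: cvg_norm; exact: u_cvg.
rewrite -(cvg_lim (@Rhausdorff R) h); apply: limr_le; first by apply/cvg_ex; exists `|K x|.
by apply: nearW => n; exact: u_le.
Qed.

(** The same integral with u n in place of K no longer changes once j < NN n, by orthogonality;
    bounded convergence carries its value over to K. The phase d treats cosines and sines at
    once. *)
Let K_phase tau j (d : R) : `|tau| <= pi -> (0 < j)%N ->
  II (tau - pi) (tau + pi) (fun t => K t * cos (j%:R * t + d)) =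
  pi * (- (q j * cos d) - p j * sin d).
Proof.
move=> taupi j0; have pi0 := pi_gt0 R; set l := (RHS).
have bc a b : bmfun a b (fun t => cos (j%:R * t + d)) by exact: bmfun_cos_phase.
have mv n : measurable_fun `[tau - pi, tau + pi] (fun t => u n t * cos (j%:R * t + d)).
  by have [] := bmfunM (mu_ n (tau - pi) (tau + pi)) (bc (tau - pi) (tau + pi)).
have v_le n x : tau - pi <= x <= tau + pi -> `|u n x * cos (j%:R * x + d)| <= C.
  move=> _; rewrite normrM; apply: le_trans (u_le n x).
  by rewrite ler_piMr// cos_max.
have v_cvg x : tau - pi <= x <= tau + pi ->
    u n x * cos (j%:R * x + d) @[n --> \oo] --> K x * cos (j%:R * x + d).
  by move=> _; apply: cvgMr_tmp; exact: u_cvg.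
have [_ h] := II_bounded_cvg mv v_le v_cvg.
have hl : II (tau - pi) (tau + pi) (fun t => u n t * cos (j%:R * t + d))
    @[n --> \oo] --> l.
  apply: cvg_near_cst; near=> n.
  have jn : (j < NN n)%N.
    by apply: leq_ltn_trans (NN_gt n); near: n; exact: nbhs_infty_ge.
  rewrite (@II_eq _ _ _ _ (fun t => trig (fun i => - q i) p 1 (NN n) t *
      cos (j%:R * t + d))); last first.
    move=> t /andP[t1 t2]; rewrite /u indicE in_I2.
    have -> : `|t| <= 2 * pi.
      by move: taupi; rewrite !ler_norml => /andP[h1 h2]; apply/andP; split; lra.
    by rewrite mul1r sumB.
  have -> : tau - pi = - pi + tau by ring.
  have -> : tau + pi = - pi + tau + 2 * pi by ring.
  rewrite II_trig_window//; last by rewrite (le_trans taupi)//; lra.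
  have bt a b := bmfun_trig a b (fun i => - q i) p 1 (NN n).
  rewrite (@II_eq _ _ _ _ (fun t => cos d * (cosn j t * trig (fun i => - q i) p 1 (NN n) t)
     - sin d * (sinn j t * trig (fun i => - q i) p 1 (NN n) t))); last first.
    by move=> t _; rewrite cosD /cosn /sinn; ring.
  have b1 : bmfun (- pi) pi (fun t => cosn j t * trig (fun i => - q i) p 1 (NN n) t).
    by apply: bmfunM => //; exact: bmfun_cosn.
  have b2 : bmfun (- pi) pi (fun t => sinn j t * trig (fun i => - q i) p 1 (NN n) t).
    by apply: bmfunM => //; exact: bmfun_sinn.
  rewrite IIB; [|by apply: bmfunM => //; exact: bmfun_cst|by apply: bmfunM => //; exact: bmfun_cst].
  by rewrite !IIZ// II_cos_trig// II_sin_trig// j0 jn /= /l; ring.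
by rewrite -(cvg_lim (@Rhausdorff R) h) (cvg_lim (@Rhausdorff R) hl).
Unshelve. all: by end_near. Qed.

(** Integrating the differentiated series termwise exhibits K as an indefinite integral on
    [-pi, pi]; it is derivable at every Lebesgue point of the integrand. *)
Let K_derivable : {ae mu, forall x, - pi < x < pi -> derivable K x 1}.
Proof.
have pi0 := pi_gt0 R.
have [f [intf fT]] := L1_series ab (fun k => bT k (- pi) pi) (fun k => lexx (c k)) sum_c.
have KE x : - pi <= x <= pi -> K x = K (- pi) + II (- pi) x f.
  move=> xpi; have /andP[x1 x2] := xpi.
  have one y : - pi <= y <= pi -> \1_I2 y = 1 :> R.
    move=> /andP[y1 y2]; rewrite indicE in_I2.
    have -> // : `|y| <= 2 * pi by rewrite ler_norml; apply/andP; split; lra.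
  have h n : II (- pi) x (fun t => \sum_(0 <= k < n) T k t) = u n x - u n (- pi).
    rewrite /u !one ?lexx// !mul1r -sumrB II_sum//.
    by apply: eq_bigr => k _; apply: II_FTC => // t _; exact: continuous_trig.
  have h1 := fT x xpi.
  have h2 : II (- pi) x (fun t => \sum_(0 <= k < n) T k t) @[n --> \oo] -->
      K x - K (- pi).
    by under eq_fun do rewrite h; apply: cvgB; exact: u_cvg.
  rewrite -(cvg_lim (@Rhausdorff R) h1) (cvg_lim (@Rhausdorff R) h2).
  by rewrite addrC subrK.
have locf : locally_integrable setT f by apply: open_integrable_locally => //; exact: openT.
apply: aeS (lebesgue_differentiation locf) => x fx /andP[x1 x2].
have itf : mu.-integrable [set` Interval (BLeft (- pi)) (BRight pi)] (EFin \o f).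
  exact: integrableS intf.
have [|dF _] := @FTC1_lebesgue_pt R f (BLeft (- pi)) x pi x2 itf _ fx.
  by rewrite [X in is_true X](_ : _ = (- pi <= x)) ?ltW//.
apply: (@near_eq_derivable _ _ _ (fun y => K (- pi) + II (- pi) y f)).
- near=> y; rewrite (KE y)//; apply/andP; split; near: y.
    by apply: (cvgr_ge (F := nbhs x)) x1; exact: cvg_id.
  by apply: (cvgr_le (F := nbhs x)) x2; exact: cvg_id.
- by apply: derivableD => //; exact: derivable_cst.
Unshelve. all: by end_near. Qed.

Lemma conjugate_function_blocks : exists F : R -> R, [/\ forall a b, bmfun a b F,
  exists M, forall x, `|F x| <= M,
  forall tau j (d : R), `|tau| <= pi -> (0 < j)%N ->
    II (tau - pi) (tau + pi) (fun t => F t * cos (j%:R * t + d)) =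
    pi * (- (q j * cos d) - p j * sin d) &
  {ae mu, forall x, - pi < x < pi -> derivable F x 1}].
Proof.
exists K; split => //.
- by exists C => x; exact: K_le.
Qed.

End Blocks.

Lemma conjugate_function : exists F : R -> R, [/\ forall a b, bmfun a b F,
  exists M, forall x, `|F x| <= M,
  forall tau j (d : R), `|tau| <= pi -> (0 < j)%N ->
    II (tau - pi) (tau + pi) (fun t => F t * cos (j%:R * t + d)) =
    pi * (- (q j * cos d) - p j * sin d) &
  {ae mu, forall x, - pi < x < pi -> derivable F x 1}].
Proof. by have [NN [h0 h1 h2]] := lacunary_blocks; exact: conjugate_function_blocks h0 h1 h2. Qed.

End ConjugateFunction.

(** * Radial limits *)

Section KernelSeries.
Context {R : realType}.
Implicit Types (r t tau : R) (n N : nat).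

(** Divided by 1 - r, this bounds N + 1 times the least term of 1 + r + ... + r^N by the sum. *)
Lemma nat_geometric_bound (r : R) N : 0 <= r <= 1 ->
  N.+1%:R * r ^+ N * (1 - r) <= 1 - r ^+ N.+1.
Proof.
move=> /andP[r0 r1]; elim: N => [|N IH]; first by rewrite !expr0 expr1; lra.
have := ler_wpM2l r0 IH; have rN0 : 0 <= r ^+ N.+1 by exact: exprn_ge0.
have rN1 : r ^+ N.+1 <= 1 by exact: exprn_ile1.
have : 0 <= (1 - r) * (1 - r ^+ N.+1) by apply: mulr_ge0; lra.
rewrite -(natr1 N.+1) [r ^+ N.+2]exprS {1 2}[r ^+ N.+1]exprS => h1 h2.
rewrite (_ : (_ + 1) * _ * _ = r * (N.+1%:R * r ^+ N * (1 - r)) +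
  r ^+ N.+1 * (1 - r)); last by rewrite [r ^+ N.+1]exprS; ring.
by move: h1 h2; rewrite -[r * r ^+ N]exprS; lra.
Qed.

(** With s the square root of r, one factor s^N absorbs the linear growth and the other one tends to
    0. *)
Lemma cvg_nat_geometric (r : R) : 0 <= r < 1 ->
  (2 * N%:R + 1) * r ^+ N @[N --> \oo] --> 0.
Proof.
move=> /andP[r0 r1]; set s := Num.sqrt r.
have s0 : 0 <= s by exact: sqrtr_ge0.
have s1 : s < 1 by rewrite -(sqrtr1 R) ltr_sqrt.
have sE : r = s ^+ 2 by rewrite sqr_sqrtr.
have h : 2 / (1 - s) * s ^+ N @[N --> \oo] --> 0.
  by rewrite -[0](mulr0 (2 / (1 - s))); apply: cvgMr; apply: cvg_expr; rewrite ger0_norm.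
apply: (squeeze_cvgr _ (cvg_cst 0) h); apply: nearW => N.
have N0 : 0 <= N%:R :> R by exact: ler0n.
apply/andP; split; first by apply: mulr_ge0; [lra|exact: exprn_ge0].
have hb := @nat_geometric_bound s N; have sN : 0 <= s ^+ N by exact: exprn_ge0.
have sN1 : 0 <= s ^+ N.+1 by exact: exprn_ge0.
rewrite sE -exprM mulnC exprM expr2 mulrA ler_wpM2r//.
rewrite ler_pdivlMr; last by lra.
have : N.+1%:R * s ^+ N * (1 - s) <= 1.
  by apply: le_trans (hb _) _; [apply/andP; split => //; lra|lra].
have hp : 0 <= s ^+ N * (1 - s) by apply: mulr_ge0 => //; lra.
rewrite -natr1; have := hp; nra.
Qed.

Lemma polar_sqr r tau : (r * cos tau) ^+ 2 + (r * sin tau) ^+ 2 = r ^+ 2.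
Proof. by rewrite !exprMn -mulrDr cos2Dsin2 mulr1. Qed.

Lemma polar_kU r tau t : kU (r * cos tau) (r * sin tau) t = 1 - r * cos (t - tau).
Proof. by rewrite /kU cosB; ring. Qed.

Lemma polar_kV r tau t : kV (r * cos tau) (r * sin tau) t = r * sin (t - tau).
Proof. by rewrite /kV sinB; ring. Qed.

Section Remainder.
Variables (r s : R).
Let C n := r ^+ n * cos (n%:R * s).
Let S n := r ^+ n * sin (n%:R * s).
Let U := 1 - r * cos s.
Let V := r * sin s.
Let D := U ^+ 2 + V ^+ 2.
Let X (N : nat) := N%:R * C N - (N%:R - 1) * C N.+1.
Let Y (N : nat) := - (N%:R * S N - (N%:R - 1) * S N.+1).

Let C_S n : C n.+1 = r * cos s * C n - r * sin s * S n.
Proof. by rewrite /C /S -natr1 mulrDl mul1r cosD exprS; ring. Qed.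

Let S_S n : S n.+1 = r * cos s * S n + r * sin s * C n.
Proof. by rewrite /C /S -natr1 mulrDl mul1r sinD exprS; ring. Qed.

(* With q = r e^{-is} = 1 - (U + iV), this is the identity
   (1 - q)^2 \sum_(n < N) n q^n = q - N q^N + (N - 1) q^(N + 1). *)
Lemma geometric_remainder N :
  D ^+ 2 * (\sum_(0 <= n < N) n%:R * C n) =
    (1 - U) * (U ^+ 2 - V ^+ 2) - 2 * U * V * V -
    (X N * (U ^+ 2 - V ^+ 2) + 2 * U * V * Y N) /\
  D ^+ 2 * (\sum_(0 <= n < N) n%:R * S n) =
    V * (U ^+ 2 - V ^+ 2) + 2 * U * V * (1 - U) +
    (Y N * (U ^+ 2 - V ^+ 2) - 2 * U * V * X N).
Proof.
elim: N => [|N [IH1 IH2]].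
  rewrite !big_geq// /X /Y !C_S !S_S /C /S !expr0 !mul0r cos0 sin0 /U /V; split; ring.
rewrite !big_nat_recr//= 2!(mulrDr (D ^+ 2)) IH1 IH2 /X /Y !(C_S, S_S) -(@natr1 R N).
move: (C N) (S N) (N%:R : R) => c' s' n; rewrite /D /U /V.
split; ring.
Qed.

Hypothesis r01 : 0 <= r < 1.

Let D_ge : (1 - r) ^+ 2 <= D.
Proof.
have := cos_le1 s; have /andP[r0 r1] := r01.
have -> : D = 1 - 2 * r * cos s + r ^+ 2 * (cos s ^+ 2 + sin s ^+ 2).
  by rewrite /D /U /V; ring.
rewrite cos2Dsin2 => c1; have := mulr_ge0 r0 (_ : 0 <= 1 - cos s).
by rewrite subr_ge0 => /(_ c1); lra.
Qed.

Let D0 : 0 < D.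
Proof.
by have /andP[r0 r1] := r01; apply: lt_le_trans D_ge; rewrite exprn_gt0// subr_gt0.
Qed.

Let remainder_bound A B N : `|A| <= (2 * N%:R + 1) * r ^+ N ->
  `|B| <= (2 * N%:R + 1) * r ^+ N ->
  `|(A * (U ^+ 2 - V ^+ 2) + 2 * U * V * B) / D ^+ 2| <=
  2 * ((2 * N%:R + 1) * r ^+ N) / (1 - r) ^+ 2.
Proof.
set K := (_ * r ^+ N) => hA hB; have /andP[r0 r1] := r01.
have K0 : 0 <= K by apply: le_trans hA.
rewrite normrM normfV (ger0_norm (_ : 0 <= D ^+ 2)) ?sqr_ge0//.
rewrite ler_pdivrMr ?exprn_gt0//.
apply: (@le_trans _ _ (2 * K * D)).
  apply: le_trans (ler_normD _ _) _.
  rewrite (normrM A) (normrM _ B) (normrM _ V) (normrM _ U).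
  have h1 : `|U ^+ 2 - V ^+ 2| <= D.
    rewrite /D ler_norml; have := sqr_ge0 U; have := sqr_ge0 V => *.
    by apply/andP; split; lra.
  have h2 : `|2| * `|U| * `|V| <= D.
    rewrite /D -(real_normK (num_real U)) -(real_normK (num_real V)) (ger0_norm (ler0n R 2)).
    have := sqr_ge0 (`|U| - `|V|); rewrite sqrrB; lra.
  have -> : 2 * K * D = K * D + D * K by ring.
  by apply: lerD; apply: ler_pM => //; rewrite ?mulr_ge0.
rewrite -(mulrA (2 * K)); apply: ler_wpM2l; first exact: mulr_ge0.
have h : 0 < (1 - r) ^+ 2 by rewrite exprn_gt0// subr_gt0.
rewrite ler_pdivlMl// expr2 ler_wpM2r// ltW//.
Qed.

Let abs_X N (c : nat -> R) : (forall n, `|c n| <= r ^+ n) ->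
  `|N%:R * c N - (N%:R - 1) * c N.+1| <= (2 * N%:R + 1) * r ^+ N.
Proof.
move=> cr; have /andP[r0 r1] := r01; have N0 := ler0n R N.
have rN : 0 <= r ^+ N by exact: exprn_ge0.
have h1 : `|N%:R * c N| <= N%:R * r ^+ N.
  by rewrite normrM (ger0_norm N0) ler_wpM2l.
have h2 : `|(N%:R - 1) * c N.+1| <= (N%:R + 1) * r ^+ N.
  rewrite normrM; apply: ler_pM => //.
    by apply: le_trans (ler_normB _ _) _; rewrite normr1 (ger0_norm N0).
  by apply: le_trans (cr _) _; rewrite exprS ler_piMl// ltW.
by apply: le_trans (ler_normB _ _) _; apply: le_trans (lerD h1 h2) _; lra.
Qed.

Lemma geometric_tail N :
  `|((1 - U) * (U ^+ 2 - V ^+ 2) - 2 * U * V * V) / D ^+ 2 -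
    \sum_(0 <= n < N) n%:R * C n| <= 2 * ((2 * N%:R + 1) * r ^+ N) / (1 - r) ^+ 2 /\
  `|(V * (U ^+ 2 - V ^+ 2) + 2 * U * V * (1 - U)) / D ^+ 2 -
    \sum_(0 <= n < N) n%:R * S n| <= 2 * ((2 * N%:R + 1) * r ^+ N) / (1 - r) ^+ 2.
Proof.
have [h1 h2] := geometric_remainder N; have /andP[r0 r1] := r01.
have Dn0 : D != 0 by rewrite gt_eqF.
have hC : `|X N| <= (2 * N%:R + 1) * r ^+ N.
  apply: abs_X => n; rewrite /C normrM ger0_norm ?exprn_ge0// ler_piMr ?exprn_ge0//.
  exact: cos_max.
have hS : `|Y N| <= (2 * N%:R + 1) * r ^+ N.
  rewrite normrN; apply: abs_X => n.
  rewrite /S normrM ger0_norm ?exprn_ge0// ler_piMr ?exprn_ge0//.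
  exact: sin_max.
split.
  suff -> : ((1 - U) * (U ^+ 2 - V ^+ 2) - 2 * U * V * V) / D ^+ 2 -
    \sum_(0 <= n < N) n%:R * C n = (X N * (U ^+ 2 - V ^+ 2) + 2 * U * V * Y N) / D ^+ 2.
    exact: remainder_bound.
  apply: (@mulfI _ (D ^+ 2)); first by rewrite expf_neq0.
  by rewrite mulrBr h1; field.
suff -> : (V * (U ^+ 2 - V ^+ 2) + 2 * U * V * (1 - U)) / D ^+ 2 -
    \sum_(0 <= n < N) n%:R * S n = - ((Y N * (U ^+ 2 - V ^+ 2) + 2 * U * V * (- X N)) / D ^+ 2).
  by rewrite normrN; apply: remainder_bound => //; rewrite normrN.
apply: (@mulfI _ (D ^+ 2)); first by rewrite expf_neq0.
by rewrite mulrBr h2; field.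
Qed.

End Remainder.

(** For q = r e^{-i (t - tau)}, [kim] is the real part and [kre] minus the imaginary part of 2 q /
    (1 - q)^2, the sum of 2 n q^n. The error bound is uniform in t, so the sums can be integrated
    against bounded functions. *)
Lemma kernel_series r tau t N : 0 <= r < 1 ->
  `|kim (r * cos tau) (r * sin tau) t -
    \sum_(0 <= n < N) 2 * n%:R * r ^+ n * cos (n%:R * (t - tau))|
  <= 4 * ((2 * N%:R + 1) * r ^+ N) / (1 - r) ^+ 2 /\
  `|kre (r * cos tau) (r * sin tau) t -
    \sum_(0 <= n < N) 2 * n%:R * r ^+ n * sin (n%:R * (t - tau))|
  <= 4 * ((2 * N%:R + 1) * r ^+ N) / (1 - r) ^+ 2.
Proof.
move=> r01; have /andP[r0 r1] := r01.
have r21 : (r * cos tau) ^+ 2 + (r * sin tau) ^+ 2 < 1.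
  by rewrite polar_sqr expr_lt1.
have D0 := kD_gt0 t r21; have Dn0 : kD (r * cos tau) (r * sin tau) t != 0 by rewrite gt_eqF.
have := geometric_tail (t - tau) r01 N; rewrite -polar_kU -polar_kV -/(kD _ _ t).
have hU := kD_U (r * cos tau) (r * sin tau) t; move: hU Dn0.
rewrite /kim /kre polar_sqr; set D := kD _ _ t; set U := kU _ _ t; set V := kV _ _ t.
have VE : V ^+ 2 = D - U ^+ 2 by rewrite /D /kD -/U -/V; ring.
move=> hU Dn0 [h1 h2].
have -> : 4 * ((2 * N%:R + 1) * r ^+ N) / (1 - r) ^+ 2 =
  2 * (2 * ((2 * N%:R + 1) * r ^+ N) / (1 - r) ^+ 2) by ring.
have rE : r ^+ 2 = D + 1 - 2 * U by lra.
split.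
  rewrite (_ : _ - _ = 2 * (((1 - U) * (U ^+ 2 - V ^+ 2) - 2 * U * V * V) / D ^+ 2 -
    \sum_(0 <= n < N) n%:R * (r ^+ n * cos (n%:R * (t - tau))))).
    by rewrite normrM ger0_norm// ler_wpM2l.
  rewrite [RHS]mulrBr mulr_sumr; congr (_ - _); last by apply: eq_bigr => n _; ring.
  rewrite rE (_ : 2 * U * V * V = 2 * U * V ^+ 2); last by ring.
  by rewrite VE; field.
rewrite (_ : _ - _ = 2 * ((V * (U ^+ 2 - V ^+ 2) + 2 * U * V * (1 - U)) / D ^+ 2 -
    \sum_(0 <= n < N) n%:R * (r ^+ n * sin (n%:R * (t - tau))))).
  by rewrite normrM ger0_norm// ler_wpM2l.
rewrite [RHS]mulrBr mulr_sumr; congr (_ - _); last by apply: eq_bigr => n _; ring.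
by rewrite rE VE; field.
Qed.

End KernelSeries.

(** * The conjugate Poisson integral of a function as the Poisson integral of its conjugate *)

Section ConjugateIdentity.
Context {R : realType}.
Variables (Psi F : R -> R) (M tau : R).
Hypotheses (bP : forall a b, bmfun a b Psi) (bF : forall a b, bmfun a b F).
Hypotheses (PM : forall t, `|Psi t| <= M) (FM : forall t, `|F t| <= M).
Hypothesis conj : forall n, (0 < n)%N ->
  II (tau - pi) (tau + pi) (fun t => F t * sin (n%:R * (t - tau))) =
  II (tau - pi) (tau + pi) (fun t => Psi t * cos (n%:R * (t - tau))).

Let ab : tau - pi <= tau + pi. Proof. by have := pi_ge0 R; lra. Qed.

Let term_cos n (c : R) : bmfun (tau - pi) (tau + pi) (fun t => c * cos (n%:R * (t - tau))).
Proof.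
apply: bmfunM; first exact: bmfun_cst.
under eq_fun do rewrite mulrBr; exact: bmfun_cos_phase.
Qed.

Let term_sin n (c : R) : bmfun (tau - pi) (tau + pi) (fun t => c * sin (n%:R * (t - tau))).
Proof.
apply: bmfunM; first exact: bmfun_cst.
under eq_fun do rewrite -cosBpihalf mulrBr -addrA; exact: bmfun_cos_phase.
Qed.

Let mul_sum (f : R -> R) (h : nat -> R -> R) N : bmfun (tau - pi) (tau + pi) f ->
  (forall n, bmfun (tau - pi) (tau + pi) (h n)) ->
  II (tau - pi) (tau + pi) (fun t => f t * \sum_(0 <= n < N) h n t) =
  \sum_(0 <= n < N) II (tau - pi) (tau + pi) (fun t => f t * h n t).
Proof.
move=> bf bh; rewrite -II_sum//; last by move=> n; exact: bmfunM.
by apply: II_eq => t _; rewrite mulr_sumr.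
Qed.

Let near_sum (f k h : R -> R) B : bmfun (tau - pi) (tau + pi) f ->
  bmfun (tau - pi) (tau + pi) k -> bmfun (tau - pi) (tau + pi) h ->
  (forall t, `|f t| <= M) -> (forall t, `|k t - h t| <= B) ->
  `|II (tau - pi) (tau + pi) (fun t => f t * k t) -
    II (tau - pi) (tau + pi) (fun t => f t * h t)| <= M * B * (2 * pi).
Proof.
move=> bf bk bh fM kh; rewrite -IIB; [|exact: bmfunM|exact: bmfunM].
have -> : M * B * (2 * pi) = II (tau - pi) (tau + pi) (fun=> M * B).
  by rewrite II_cst//; congr (_ * _); ring.
apply: le_norm_II; [by apply: bmfunB; exact: bmfunM|exact: bmfun_cst|].
by move=> t _; rewrite -mulrBr normrM ler_pM.
Qed.

(** The partial sums of the two kernels have equal integrals by [conj], term by term; so the two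
    sides differ by at most 4 pi M E N for every N, and this tends to 0. *)
Lemma conjugate_kernels r : 0 <= r < 1 ->
  II (tau - pi) (tau + pi) (fun t => Psi t * kim (r * cos tau) (r * sin tau) t) =
  II (tau - pi) (tau + pi) (fun t => F t * kre (r * cos tau) (r * sin tau) t).
Proof.
move=> r01; have /andP[r0 r1] := r01.
have r21 : (r * cos tau) ^+ 2 + (r * sin tau) ^+ 2 < 1 by rewrite polar_sqr expr_lt1.
set I := II _ _ _; set J := II _ _ _.
pose E N : R := 4 * ((2 * N%:R + 1) * r ^+ N) / (1 - r) ^+ 2.
have hN N : `|I - J| <= M * E N * (2 * pi) + M * E N * (2 * pi).
  pose hc n t := 2 * n%:R * r ^+ n * cos (n%:R * (t - tau)).
  pose hs n t := 2 * n%:R * r ^+ n * sin (n%:R * (t - tau)).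
  have bc n : bmfun (tau - pi) (tau + pi) (hc n) by exact: term_cos.
  have bs n : bmfun (tau - pi) (tau + pi) (hs n) by exact: term_sin.
  have bkim : bmfun (tau - pi) (tau + pi) (kim (r * cos tau) (r * sin tau)).
    by apply: bmfun_cont => t _; apply: continuous_kim; rewrite gt_eqF// kD_gt0.
  have bkre : bmfun (tau - pi) (tau + pi) (kre (r * cos tau) (r * sin tau)).
    by apply: bmfun_cont => t _; exact: continuous_kre.
  have h1 := near_sum (bP (tau - pi) (tau + pi)) bkim
    (bmfun_sum (index_iota 0 N) bc) PM (fun t => (kernel_series tau t N r01).1).
  have h2 := near_sum (bF (tau - pi) (tau + pi)) bkre
    (bmfun_sum (index_iota 0 N) bs) FM (fun t => (kernel_series tau t N r01).2).
  have sE : II (tau - pi) (tau + pi) (fun t => F t * \sum_(0 <= n < N) hs n t) =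
            II (tau - pi) (tau + pi) (fun t => Psi t * \sum_(0 <= n < N) hc n t).
    rewrite !mul_sum//; apply: eq_bigr => -[|n] _.
      (* The term n = 0, about which [conj] says nothing, vanishes through its factor n. *)
      have h0 (f : R -> R) (g : nat -> R -> R) :
          II (tau - pi) (tau + pi) (fun t => f t * (2 * 0%:R * r ^+ 0 * g 0%N t)) = 0.
        rewrite (@II_eq _ _ _ _ (fun=> 0)); last by move=> t _; ring.
        by rewrite II_cst// mul0r.
      by rewrite (h0 F (fun n t => sin (n%:R * (t - tau))))
                 (h0 Psi (fun n t => cos (n%:R * (t - tau)))).
    have hZ (f g : R -> R) (c : R) : bmfun (tau - pi) (tau + pi) (fun t => f t * g t) ->
        II (tau - pi) (tau + pi) (fun t => f t * (c * g t)) =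
        c * II (tau - pi) (tau + pi) (fun t => f t * g t).
      by move=> bfg; rewrite -IIZ//; apply: II_eq => t _; ring.
    have b1 : bmfun (tau - pi) (tau + pi) (fun t => 1 * sin (n.+1%:R * (t - tau))) by exact: term_sin.
    have b2 : bmfun (tau - pi) (tau + pi) (fun t => 1 * cos (n.+1%:R * (t - tau))) by exact: term_cos.
    move: b1 b2; under eq_fun do rewrite mul1r; move=> b1.
    under eq_fun do rewrite mul1r; move=> b2.
    by rewrite /hs /hc !hZ ?conj//; exact: bmfunM.
  move: h2; rewrite sE distrC => h2; apply: ler_normD_eq h1 h2 _.
  by rewrite -/I -/J; ring.
have E0 : M * E N * (2 * pi) + M * E N * (2 * pi) @[N --> \oo] --> 0.
  have h := cvg_nat_geometric r01.
  rewrite -[0](mulr0 (M * 4 / (1 - r) ^+ 2 * (4 * pi))).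
  rewrite (_ : (fun N => _) = (fun N => M * 4 / (1 - r) ^+ 2 * (4 * pi) *
     ((2 * N%:R + 1) * r ^+ N))); first exact: cvgMr.
  by apply/funext => N; rewrite /E; ring.
apply/eqP; rewrite -subr_eq0 -normr_le0; rewrite -(cvg_lim (@Rhausdorff R) E0).
by apply: limr_ge; [apply/cvg_ex; exists 0|exact: nearW].
Qed.

End ConjugateIdentity.

(** * Radial limits for Lipschitz functions *)

Section Radial.
Context {R : realType}.
Implicit Types (Psi : R -> R) (r tau : R).
Let mu := @lebesgue_measure R.

Lemma polar_pdist r tau : r <= 1 ->
  pdist (r * cos tau) (r * sin tau) (cos tau) (sin tau) = 1 - r.
Proof.
move=> r1; rewrite /pdist (_ : (_ - _) ^+ 2 + _ = (1 - r) ^+ 2 * (cos tau ^+ 2 + sin tau ^+ 2)).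
  by rewrite cos2Dsin2 mulr1 sqrtr_sqr ger0_norm// subr_ge0.
by ring.
Qed.

Lemma polar_stolz r tau : 0 <= r < 1 -> stolz 1 (r * cos tau) (r * sin tau) tau.
Proof.
move=> /andP[r0 r1]; split; first by rewrite polar_sqr expr_lt1.
by rewrite polar_pdist ?(ltW r1)// mul1r /pdist !subr0 polar_sqr sqrtr_sqr ger0_norm.
Qed.

(** For a regularization of a periodic function this is 2 pi times the imaginary part of its
    Schwartz integral at r e^{i tau}. *)
Definition radial_im Psi tau r :=
  II (tau - pi) (tau + pi) (fun t => Psi t * kim (r * cos tau) (r * sin tau) t).

Lemma radial_near (f : R -> R -> R) (l tau : R) :
  (forall e : R, 0 < e -> exists2 d : R, 0 < d & forall x y,
     stolz 1 x y tau -> pdist x y (cos tau) (sin tau) < d -> `|f x y - l| <= e) ->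
  f (r * cos tau) (r * sin tau) @[r --> 1^'-] --> l.
Proof.
move=> h; apply/cvgrPdist_le => e e0; have [d d0 hd] := h e e0.
have d1 : 0 < Num.min d 1 by rewrite lt_min d0 ltr01.
exists (Num.min d 1) => //= r; rewrite /ball_ => rd r1; rewrite distrC.
have {}rd : 1 - r < Num.min d 1 by rewrite /= ger0_norm// in rd; rewrite subr_ge0 ltW.
move: rd; rewrite lt_min => /andP[rd r0]; apply: hd; last by rewrite polar_pdist// ltW.
by apply: polar_stolz; apply/andP; split=> //; lra.
Qed.

Lemma lipschitz_radial Psi (M m : R) : 0 <= m ->
  (forall x y, `|Psi x - Psi y| <= m * `|x - y|) ->
  (forall x, Psi (x + 2 * pi) = Psi x) -> (forall x, `|Psi x| <= M) ->
  {ae mu, forall tau, - pi < tau < pi -> cvg (radial_im Psi tau r @[r --> 1^'-])}.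
Proof.
move=> m0 lip per PM; have pi0 := pi_gt0 R.
have cPsi := lipschitz_continuous lip.
have bP a b : bmfun a b Psi by apply: bmfun_cont => x _; exact: cPsi.
have [F [bF [N FN] ph dF]] :=
  conjugate_function (fun N => lipschitz_fourier cPsi per PM N m0 lip).
apply: aeS dF => tau dF tpi; have {}dF := dF tpi.
have taupi : `|tau| <= pi by move/andP: tpi => [t1 t2]; rewrite ler_norml !ltW.
have tau2 : `|tau| <= 2 * pi by rewrite (le_trans taupi)//; lra.
have PsiE n (d : R) : (0 < n)%N ->
    II (tau - pi) (tau + pi) (fun t => Psi t * cos (n%:R * t + d)) =
    pi * (cos d * fcos Psi n - sin d * fsin Psi n).
  move=> n0; have := II_Psi_window cPsi per PM (- pi) d n0 tau2.
  have -> : - pi + tau + 2 * pi = tau + pi by ring.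
  have -> : - pi + tau = tau - pi by ring.
  have -> : - pi + 2 * pi = pi :> R by ring.
  move=> ->; rewrite (@II_eq _ _ _ _ (fun t => cos d * (Psi t * cosn n t) -
     sin d * (Psi t * sinn n t))); last by move=> t _; rewrite cosD /cosn /sinn; ring.
  have b1 : bmfun (- pi) pi (fun t => Psi t * cosn n t) by apply: bmfunM => //; exact: bmfun_cosn.
  have b2 : bmfun (- pi) pi (fun t => Psi t * sinn n t) by apply: bmfunM => //; exact: bmfun_sinn.
  rewrite IIB; [|by apply: bmfunM => //; exact: bmfun_cst|by apply: bmfunM => //; exact: bmfun_cst].
  rewrite !IIZ// /fcos /fsin; have pin0 : pi != 0 :> R by rewrite gt_eqF.
  by rewrite mulrBr (mulrCA _ (cos d)) (mulrCA _ (sin d)) !mulVKf.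
have conj n : (0 < n)%N ->
    II (tau - pi) (tau + pi) (fun t => F t * sin (n%:R * (t - tau))) =
    II (tau - pi) (tau + pi) (fun t => Psi t * cos (n%:R * (t - tau))).
  move=> n0; under eq_fun do rewrite -cosBpihalf mulrBr -addrA.
  rewrite ph//; under [in RHS]eq_fun do rewrite mulrBr.
  by rewrite PsiE// cosBpihalf sinBpihalf; ring.
pose K := Num.max M N.
have PK t : `|Psi t| <= K by rewrite /K le_max PM.
have FK t : `|F t| <= K by rewrite /K le_max FN orbT.
have line := derivable_approx dF.
apply/cvg_ex; exists (2 * pi * 'D_1 F tau).
have h : II (tau - pi) (tau + pi) (fun t => F t * kre (r * cos tau) (r * sin tau) t)
    @[r --> 1^'-] --> 2 * pi * 'D_1 F tau.
  apply: (@radial_near (fun x y => II (tau - pi) (tau + pi) (fun t => F t * kre x y t))).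
  by move=> e e0; exact: (fatou_line bF FK line).
apply: cvg_trans h; apply: near_eq_cvg; near=> r.
by rewrite /radial_im (conjugate_kernels bP bF PK FK conj)//; apply/andP; split; near: r;
  [apply: nbhs_left_ge|exact: nbhs_left_lt].
Unshelve. all: by end_near. Qed.

End Radial.

(** * The Marcinkiewicz decomposition *)

Section LipschitzMinorant.
Context {R : realType}.
Variables (Phi : R -> R) (M m : R).
Hypothesis PM : forall t, `|Phi t| <= M.
Hypothesis m0 : 0 < m.

(** The inf-convolution of Phi with m |.|, as in McShane's extension of Lipschitz functions. *)
Definition lip_minorant x := inf [set Phi s + m * `|x - s| | s in [set: R]].

Local Notation Psi := lip_minorant.

Let PML s : - M <= Phi s. Proof. by have := PM s; rewrite ler_norml => /andP[]. Qed.

Let lb x : has_lbound [set Phi s + m * `|x - s| | s in [set: R]].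
Proof.
exists (- M) => _ [s _ <-]; apply: (le_trans (PML s)).
by rewrite lerDl mulr_ge0// ltW.
Qed.

Let ne x : [set Phi s + m * `|x - s| | s in [set: R]] !=set0.
Proof. by exists (Phi 0 + m * `|x - 0|); exists 0. Qed.

Let minorant_ge x u : (forall s, u <= Phi s + m * `|x - s|) -> u <= Psi x.
Proof. by move=> h; apply: lb_le_inf => // _ [s _ <-]. Qed.

Let minorant_le x s : Psi x <= Phi s + m * `|x - s|.
Proof. by apply: ge_inf => //; exists s. Qed.

Lemma lip_minorant_le x : Psi x <= Phi x.
Proof. by have := minorant_le x x; rewrite subrr normr0 mulr0 addr0. Qed.

Lemma lip_minorant_bound x : `|Psi x| <= M.
Proof.
rewrite ler_norml; apply/andP; split.
  by apply: minorant_ge => s; apply: (le_trans (PML s)); rewrite lerDl mulr_ge0// ltW.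
by apply: (le_trans (lip_minorant_le x)); have := PM x; rewrite ler_norml => /andP[].
Qed.

Lemma lip_minorant_lipschitz x y : `|Psi x - Psi y| <= m * `|x - y|.
Proof.
have h u v : Psi u - m * `|u - v| <= Psi v.
  apply: minorant_ge => s; rewrite lerBlDr; apply: (le_trans (minorant_le u s)).
  by rewrite -addrA lerD2l -mulrDr ler_pM2l// [leRHS]addrC ler_distD.
rewrite ler_norml; apply/andP; split; last by have := h x y; lra.
by have := h y x; rewrite distrC; lra.
Qed.

Lemma lip_minorant_periodic T : (forall x, Phi (x + T) = Phi x) ->
  forall x, Psi (x + T) = Psi x.
Proof.
move=> per x; rewrite /Psi; congr inf; apply/seteqP; split=> _ [s _ <-].
  exists (s - T) => //; rewrite -(per (s - T)) subrK; congr (_ + _ * `|_|); ring.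
by exists (s + T) => //; rewrite per; congr (_ + _ * `|_|); ring.
Qed.

Section Contact.
Variables (F : R -> R) (tau : R).
Hypothesis rF : regularized Phi F.

Lemma lip_minorant_le_regularized x : Psi x <= F x.
Proof.
have [_ _ _ _ FL] := rF; apply/ler_addgt0Pr => e e0; rewrite -lerBlDr; apply: FL.
have em : 0 < e / m by rewrite divr_gt0.
exists (e / m) => //= y xy; apply: le_trans (lip_minorant_le y).
rewrite lerBlDr -lerBlDl; apply: le_trans (ler_norm _) _.
apply: le_trans (lip_minorant_lipschitz _ _) _.
by rewrite mulrC -ler_pdivlMr// ltW.
Qed.

Hypothesis tauE : forall t, `|Phi t - Phi tau| <= m * `|t - tau|.

Lemma lip_minorant_contact : Psi tau = Phi tau.
Proof.
apply/eqP; rewrite eq_le lip_minorant_le /=; apply: minorant_ge => s.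
by have := tauE s; rewrite ler_norml distrC => /andP[h _]; lra.
Qed.

(** Psi is m-Lipschitz and equals Phi at tau, and F inherits the bound of Phi at tau: both stay
    within m |t - tau| of Phi tau. *)
Lemma contact_gap t : 0 <= F t - Psi t <= 2 * m * `|t - tau|.
Proof.
rewrite subr_ge0 lip_minorant_le_regularized /=.
have hP : Phi tau - m * `|t - tau| <= Psi t.
  have := lip_minorant_lipschitz t tau; rewrite lip_minorant_contact ler_norml.
  by move=> /andP[h _]; lra.
suff : F t <= Phi tau + m * `|t - tau| by lra.
have [_ _ _ FU _] := rF; apply/ler_addgt0Pr => e e0; apply: FU.
have em : 0 < e / m by rewrite divr_gt0.
exists (e / m) => //= y ty.
have h1 := tauE y; rewrite ler_norml in h1; case/andP: h1 => _ h1.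
have h2 : m * `|t - y| <= e by rewrite mulrC -ler_pdivlMr// ltW.
have : m * `|y - tau| <= m * `|t - tau| + m * `|t - y|.
  by rewrite -mulrDr ler_pM2l// (distrC t y) [leRHS]addrC ler_distD.
lra.
Qed.

End Contact.
End LipschitzMinorant.

(** * Finiteness of the Marcinkiewicz integral *)

Section GapIntegral.
Context {R : realType}.
Local Notation mu := (@lebesgue_measure R).
Variable beta : R -> R.
Hypothesis mb : measurable_fun setT beta.
Hypothesis b0 : forall t, 0 <= beta t.

(* The value at beta t = 0 and t = tau is the junk value 0. *)
Definition gap_kernel tau t := beta t / (beta t ^+ 2 + (tau - t) ^+ 2).

Lemma gap_kernel_ge0 tau t : 0 <= gap_kernel tau t.
Proof. by rewrite divr_ge0// addr_ge0// sqr_ge0. Qed.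

Let I1 : set R := `[- pi, pi]%classic.
Let I2 : set R := `[- (2 * pi), 2 * pi]%classic.
Let h_ge0 := gap_kernel_ge0.
Let RR : measurableType _ := (measurableTypeR R * measurableTypeR R)%type.
Let f (z : RR) : \bar R := (\1_I1 z.1 * \1_I2 z.2 * gap_kernel z.1 z.2)%:E.

Let mh : measurable_fun setT (fun z : RR => gap_kernel z.1 z.2).
Proof.
have m2 : measurable_fun setT (fun z : RR => beta z.2).
  by apply: measurableT_comp => //; exact: measurable_snd.
apply: measurable_funM => //.
(* The power with exponent -1 is measurable and agrees with the inverse on the nonnegative reals, 0
   included. *)
have -> : (fun z : RR => (beta z.2 ^+ 2 + (z.1 - z.2) ^+ 2)^-1) =
    (fun z => powR (beta z.2 ^+ 2 + (z.1 - z.2) ^+ 2) (-1)).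
  by apply/funext => z; rewrite powR_inv1// addr_ge0// sqr_ge0.
apply: (measurableT_comp (measurable_powR (-1))).
apply: measurable_funD; apply: measurable_funX => //.
by apply: measurable_funB; [exact: measurable_fst|exact: measurable_snd].
Qed.

Let mf : measurable_fun setT f.
Proof.
apply/measurable_EFinP; apply: measurable_funM => //; apply: measurable_funM.
  apply: measurableT_comp; [by apply: measurable_indic; exact: measurable_itv|exact: measurable_fst].
apply: measurableT_comp; [by apply: measurable_indic; exact: measurable_itv|exact: measurable_snd].
Qed.

Let f0 z : (0 <= f z)%E.
Proof. by rewrite lee_fin; apply: mulr_ge0; [exact: mulr_ge0|exact: gap_kernel_ge0]. Qed.

(** As a function of tau, [gap_kernel] is the Cauchy kernel of centre t and width beta t, whose mass
    does not exceed pi whatever the width. *)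
Let inner t : (\int[mu]_tau f (tau, t) <= (pi * \1_I2 t)%:E)%E.
Proof.
have pi0 := pi_gt0 R; have ab : - pi <= pi :> R by lra.
have [bt0|bt] := eqVneq (beta t) 0.
  rewrite integral0_eq ?lee_fin ?mulr_ge0 ?(ltW pi0)// => x _.
  by rewrite /f /gap_kernel /= bt0 mul0r mulr0.
have {}bt : 0 < beta t by rewrite lt_neqAle eq_sym bt b0.
have bk : bmfun (- pi) pi (fun tau => \1_I2 t * gap_kernel tau t).
  apply: bmfunM; first exact: bmfun_cst.
  by apply: bmfun_cont => x _; rewrite /gap_kernel; exact: continuous_cauchy.
have -> : (\int[mu]_tau f (tau, t) =
    \int[mu]_(tau in `[(- pi)%R, pi]) (\1_I2 t * gap_kernel tau t)%:E)%E.
  rewrite [RHS]integral_mkcond; apply: eq_integral => x _.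
  rewrite /f /= patchE indicE; case: ifPn => xI; rewrite /I1 ?xI ?mul1r//.
  by rewrite !mul0r.
rewrite -[leLHS]fineK; last exact: integrable_fin_num (bmfun_itg bk).
rewrite lee_fin -/(Rintegral _ _ _) -/(II _ _ _) IIZ; last first.
  by apply: bmfun_cont => x _; rewrite /gap_kernel; exact: continuous_cauchy.
by rewrite mulrC ler_wpM2r// II_cauchy.
Qed.

Lemma gap_integrable :
  {ae mu, forall tau, - pi <= tau <= pi ->
  mu.-integrable `[- (2 * pi), 2 * pi] (EFin \o gap_kernel tau)}.
Proof.
have pi0 := pi_gt0 R.
pose g := fubini_F mu f.
have mg := @measurable_fun_fubini_tonelli_F _ _ (measurableTypeR R) (measurableTypeR R) R mu f mf f0.
have g0 x : (0 <= g x)%E by apply: integral_ge0 => y _; exact: f0.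
have ig : mu.-integrable setT g.
  apply/integrableP; split => //.
  rewrite (eq_integral g); last by move=> x _; rewrite gee0_abs.
  rewrite /g /fubini_F (fubini_tonelli f mf f0).
  apply: (@le_lt_trans _ _ (\int[mu]_t (pi * \1_I2 t)%:E)%E).
    apply: ge0_le_integral => //.
    - by move=> t _; apply: integral_ge0 => y _; exact: f0.
    - exact: measurable_fun_fubini_tonelli_G.
    - apply/measurable_EFinP; apply: measurable_funM => //.
      by apply: measurable_indic; exact: measurable_itv.
  under eq_integral do rewrite EFinM.
  rewrite ge0_integralZl//; last 2 first.
  - by apply/measurable_EFinP; apply: measurable_indic; exact: measurable_itv.
  - by rewrite lee_fin ltW.
  rewrite integral_indic//; last exact: measurable_itv.
  have hI : (mu (I2 `&` setT) < +oo)%E.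
    by rewrite setIT /I2 lebesgue_measure_itv /=; case: ifP => // _; rewrite -EFinD ltry.
  by apply: lte_mul_pinfty => //; rewrite lee_fin ltW.
apply: aeS (integrable_ae measurableT ig) => tau fin tpi.
have {}fin := fin I.
apply/integrableP; split.
  apply/measurable_EFinP; apply: measurable_funTS.
  exact: (measurableT_comp mh (measurable_pair1 tau)).
apply: (@le_lt_trans _ _ (g tau)); last by rewrite ltey_eq fin.
rewrite integral_mkcond /g /fubini_F le_eqVlt; apply/orP; left; apply/eqP.
apply: eq_integral => t _; rewrite patchE /f /= !indicE.
have -> : tau \in I1 by rewrite inE /I1 /= in_itv.
rewrite mul1r; case: ifPn => tI; rewrite /I2 ?tI ?mul1r ?(negbTE tI) ?mul0r//.
by rewrite ger0_norm.
Qed.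

End GapIntegral.

(** * Radial limits almost everywhere on the set of differentiability *)

Section Marcinkiewicz.
Context {R : realType}.
Local Notation mu := (@lebesgue_measure R).
Implicit Types (Phi F : R -> R) (tau t r : R).

Lemma polar_kD r tau t :
  kD (r * cos tau) (r * sin tau) t = 1 - 2 * r * cos (t - tau) + r ^+ 2.
Proof. by rewrite kD_U polar_sqr polar_kU; ring. Qed.

(** The constant is 6 * 4^2: the kernel is at most 6 / a^2, and |t - tau| / 2 is at most the chord,
    which is at most a + (1 - r) <= 2 a. *)
Lemma kim_radial_bound r tau t : 0 <= r < 1 -> `|t - tau| <= pi -> t != tau ->
  `|kim (r * cos tau) (r * sin tau) t| <= 96 / (t - tau) ^+ 2.
Proof.
move=> r01 tpi tt; have /andP[r0 r1] := r01.
have st := polar_stolz tau r01; have [xy1 _] := st.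
set x := r * cos tau; set y := r * sin tau.
have D0 := kD_gt0 t xy1; set a := Num.sqrt (kD x y t).
have a0 : 0 < a by rewrite sqrtr_gt0.
have a2 : kD x y t = a ^+ 2 by rewrite sqr_sqrtr// ltW.
have ra : 1 - r <= a.
  by have := stolz_dist_le x y t; rewrite /pdist !subr0 polar_sqr sqrtr_sqr ger0_norm.
have ta : `|t - tau| <= 4 * a.
  have h1 := kD_unit_ge tpi.
  have := pdist_triangle (cos t) (sin t) x y (cos tau) (sin tau).
  by rewrite polar_pdist ?(ltW r1)// !pdist_circle -/a; lra.
have w01 : 0 <= 1 - r ^+ 2 <= 1.
  by rewrite subr_ge0 exprn_ile1 ?(ltW r1)//= lerBlDr lerDl exprn_ge0.
have wa : 1 - r ^+ 2 <= 2 * a by have := sqr_ge0 (1 - r); rewrite sqrrB; lra.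
have := kernel_im_near a0 w01 wa.
rewrite (_ : _ - _ = kim x y t); last by rewrite /kim a2 polar_sqr; congr (_ - _ / _); ring.
have t2 : 0 < (t - tau) ^+ 2.
  by rewrite lt_neqAle sqr_ge0 andbT eq_sym expf_neq0// subr_eq0.
move=> h; rewrite ler_pdivlMr//.
have : (t - tau) ^+ 2 <= (4 * a) ^+ 2.
  by rewrite -real_normK ?num_real// lerXn2r// nnegrE mulr_ge0// ltW.
have k0 := normr_ge0 (kim x y t); rewrite exprMn => h2.
have := ler_wpM2l k0 h2; lra.
Qed.

Lemma kim_radial_cvg (u : nat -> R) tau t : kD (cos tau) (sin tau) t != 0 ->
  u n @[n --> \oo] --> (1 : R) ->
  kim (u n * cos tau) (u n * sin tau) t @[n --> \oo] --> kim (cos tau) (sin tau) t.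
Proof.
move=> D0 u1.
have u2 : u n ^+ 2 @[n --> \oo] --> (1 ^+ 2 : R) by under eq_fun do rewrite expr2; apply: cvgM.
have cD : kD (u n * cos tau) (u n * sin tau) t @[n --> \oo] --> kD (cos tau) (sin tau) t.
  under eq_fun do rewrite polar_kD.
  have -> : kD (cos tau) (sin tau) t = 1 - 2 * 1 * cos (t - tau) + 1 ^+ 2.
    by rewrite kD_unit; ring.
  apply: cvgD => //; apply: cvgB; first exact: cvg_cst.
  by apply: cvgMr_tmp; apply: cvgM => //; exact: cvg_cst.
have cI : (kD (u n * cos tau) (u n * sin tau) t)^-1 @[n --> \oo] -->
    (kD (cos tau) (sin tau) t)^-1 by apply: cvgV.
rewrite (_ : (fun n => _) = (fun n => (1 - u n ^+ 2) ^+ 2 *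
    ((kD (u n * cos tau) (u n * sin tau) t)^-1) ^+ 2 -
    (1 + u n ^+ 2) * (kD (u n * cos tau) (u n * sin tau) t)^-1)); last first.
  by apply/funext => n; rewrite /kim polar_sqr exprVn.
have -> : kim (cos tau) (sin tau) t = (1 - 1 ^+ 2) ^+ 2 *
    ((kD (cos tau) (sin tau) t)^-1) ^+ 2 - (1 + 1 ^+ 2) * (kD (cos tau) (sin tau) t)^-1.
  by rewrite kim_unit; ring.
have c1 : (1 : R) @[_ --> \oo] --> (1 : R) by exact: cvg_cst.
apply: cvgB; apply: cvgM => //.
- have h : 1 - u n ^+ 2 @[n --> \oo] --> (1 - 1 ^+ 2 : R) by apply: cvgB.
  by under eq_fun do rewrite expr2; apply: cvgM.
- by under eq_fun do rewrite expr2; apply: cvgM.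
- by apply: cvgD.
Qed.

Lemma marcinkiewicz Phi F (m : R) : regularized Phi F ->
  (forall x, Phi (x + 2 * pi) = Phi x) -> 0 < m ->
  {ae mu, forall tau, - pi < tau < pi ->
    (forall t, `|Phi t - Phi tau| <= m * `|t - tau|) ->
    cvg (radial_im F tau r @[r --> 1^'-])}.
Proof.
move=> rF per m0; have pi0 := pi_gt0 R.
have [mF [M PM] _ _ _] := rF.
pose Psi := lip_minorant Phi m.
have lip := lip_minorant_lipschitz PM m0; have bPsi := lip_minorant_bound PM m0.
have cPsi : continuous Psi := lipschitz_continuous lip.
pose beta t := (F t - Psi t) / (2 * m).
have mb : measurable_fun setT beta.
  apply: measurable_funM => //; apply: measurable_funB => //.
  exact: continuous_measurable_fun.
have b0 t : 0 <= beta t.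
  by rewrite divr_ge0 ?subr_ge0 ?(lip_minorant_le_regularized PM m0 rF)// mulr_ge0// ltW.
have bE t : F t - Psi t = 2 * m * beta t.
  by rewrite /beta mulrC divfK// mulf_neq0// gt_eqF.
have H1 := lipschitz_radial (ltW m0) lip (lip_minorant_periodic m per) bPsi.
have H2 := gap_integrable mb b0.
apply: (aeS _ (@filterI _ _ (ae_filter_ringOfSetsType mu) _ _ H1 H2)) => tau [h1 h2] tpi tE.
have {}h1 := h1 tpi; have {}h2 : mu.-integrable `[- (2 * pi), 2 * pi] (EFin \o gap_kernel beta tau).
  by apply: h2; case/andP: tpi => ? ?; rewrite !ltW.
have bgap t : beta t <= `|t - tau|.
  rewrite ler_pdivrMr ?mulr_gt0// mulrC.
  by have /andP[] := contact_gap PM m0 rF tE t.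
pose a := tau - pi; pose b := tau + pi.
have igap : mu.-integrable `[a, b] (EFin \o gap_kernel beta tau).
  apply: integrableS h2 => //.
  move=> t /=; rewrite !in_itv /= /a /b => /andP[t1 t2]; case/andP: tpi => ? ?.
  by apply/andP; split; lra.
(* This is where tau in E_m counts: beta t <= |t - tau| makes the two denominators comparable. *)
have bnd t : t != tau -> beta t / (t - tau) ^+ 2 <= 2 * gap_kernel beta tau t.
  move=> tt; have t2 : 0 < (t - tau) ^+ 2.
    by rewrite lt_neqAle sqr_ge0 andbT eq_sym expf_neq0// subr_eq0.
  have bt2 : beta t ^+ 2 <= (t - tau) ^+ 2.
    by rewrite -[leRHS]real_normK ?num_real// lerXn2r// nnegrE.
  have s2 : (tau - t) ^+ 2 = (t - tau) ^+ 2 by ring.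
  rewrite /gap_kernel s2 mulrCA ler_wpM2l//.
  have p : 0 < beta t ^+ 2 + (t - tau) ^+ 2 by rewrite ltr_wpDl ?sqr_ge0.
  by rewrite -[leLHS]mul1r ler_pdivrMr// mulrAC ler_pdivlMr// mul1r; lra.
have bG c d : bmfun c d (fun t => F t - Psi t).
  apply: bmfunB; first exact: (regularized_bmfun c d rF).
  by apply: bmfun_cont => t _; exact: cPsi.
(* At t = tau the limit kernel divides by zero; the integrand vanishes there because of this
   factor. *)
have at_tau : F tau - Psi tau = 0.
  by rewrite bE; have := bgap tau; have := b0 tau; rewrite subrr normr0 => *; nra.
pose l := II a b (fun t => (F t - Psi t) * kim (cos tau) (sin tau) t).
have h3 : radial_im (fun t => F t - Psi t) tau r @[r --> 1^'-] --> l.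
  apply/cvg_at_leftP => u [u_lt u1].
  (* The domination must hold for every index, so the finitely many terms with u n < 0 are shifted
     away. *)
  have [N _ Nu] : \forall n \near \oo, 0 <= u n.
    by apply: (cvgr_ge (F := \oo)) ltr01; exact: u1.
  rewrite -(cvg_shiftn N) /=.
  have v1 : u (n + N)%N @[n --> \oo] --> (1 : R) by rewrite (cvg_shiftn N u).
  have v01 n : 0 <= u (n + N)%N < 1 by rewrite u_lt Nu//= leq_addl.
  have bk n c d : bmfun c d (kim (u (n + N)%N * cos tau) (u (n + N)%N * sin tau)).
    apply: bmfun_cont => t _; apply: continuous_kim; rewrite gt_eqF// kD_gt0//.
    by have /andP[? ?] := v01 n; rewrite polar_sqr expr_lt1.
  have mG n : measurable_fun `[a, b] (fun t => (F t - Psi t) *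
      kim (u (n + N)%N * cos tau) (u (n + N)%N * sin tau) t).
    by have [] := bmfunM (bG a b) (bk n a b).
  have pw t : a <= t <= b -> (F t - Psi t) *
      kim (u (n + N)%N * cos tau) (u (n + N)%N * sin tau) t @[n --> \oo] -->
      (F t - Psi t) * kim (cos tau) (sin tau) t.
    move=> /andP[t1 t2]; have [->|tt] := eqVneq t tau.
      by rewrite at_tau mul0r; under eq_fun do rewrite mul0r; exact: cvg_cst.
    apply: cvgM; first exact: cvg_cst.
    apply: kim_radial_cvg => //; rewrite gt_eqF// kD_unit_gt0//.
    rewrite normr_gt0 subr_eq0 tt /= ler_norml; move: t1 t2; rewrite /a /b => t1 t2.
    by apply/andP; split; lra.
  (* The factor 384 is 2 * 96 * 2: from F - Psi = 2 m beta, from [kim_radial_bound], and from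
     [bnd]. *)
  apply: (@II_dct _ a b _ _ (fun t => (384 * m)%:E * (gap_kernel beta tau t)%:E)%E) => //.
  - by apply: (measurable_fun_cvg mG) => t /=; rewrite in_itv /=; exact: pw.
  - by apply/aeW => t; exact: pw.
  - exact: integrableZl.
  - move=> n t /andP[t1 t2]; rewrite -EFinM lee_fin.
    have [->|tt] := eqVneq t tau.
      rewrite at_tau mul0r normr0; apply: mulr_ge0; last exact: gap_kernel_ge0.
      by apply: mulr_ge0 => //; exact: ltW.
    have mt0 : 0 <= 2 * m * beta t by rewrite -bE subr_ge0 (lip_minorant_le_regularized PM m0 rF).
    rewrite bE normrM (ger0_norm mt0).
    have tpi' : `|t - tau| <= pi.
      by rewrite ler_norml; move: t1 t2; rewrite /a /b => t1 t2; apply/andP; split; lra.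
    have hk := kim_radial_bound (v01 n) tpi' tt.
    apply: (@le_trans _ _ (2 * m * beta t * (96 / (t - tau) ^+ 2))).
      exact: ler_wpM2l.
    have := ler_wpM2l (ltW m0) (bnd t tt).
    set X := beta t / _; rewrite (_ : 2 * m * beta t * _ = 192 * (m * X)); last by rewrite /X; ring.
    lra.
have /cvg_ex[l1 hl1] := h1.
apply/cvg_ex; exists (l1 + l); apply: cvg_trans (cvgD hl1 h3).
apply: near_eq_cvg; near=> r.
have r01 : 0 <= r < 1 by apply/andP; split; near: r; [exact: nbhs_left_ge|exact: nbhs_left_lt].
have bk c d : bmfun c d (kim (r * cos tau) (r * sin tau)).
  apply: bmfun_cont => t _; apply: continuous_kim; rewrite gt_eqF// kD_gt0//.
  by have /andP[? ?] := r01; rewrite polar_sqr expr_lt1.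
have bP c d : bmfun c d Psi by apply: bmfun_cont => t _; exact: cPsi.
rewrite fctE /radial_im /= -IID; [|exact: bmfunM|exact: bmfunM].
by apply: II_eq => t _; ring.
Unshelve. all: by end_near. Qed.

Lemma radial_im_cvg Phi F : regularized Phi F ->
  (forall x, Phi (x + 2 * pi) = Phi x) ->
  {ae mu, forall tau, - pi < tau < pi -> derivable Phi tau 1 ->
    cvg (radial_im F tau r @[r --> 1^'-])}.
Proof.
move=> rF per; have [_ [M PM] _ _ _] := rF.
have H := ae_foralln (fun n => marcinkiewicz rF per (ltr0Sn R n)).
apply: aeS H => tau H tpi dP.
have [d d0 hd] := derivable_approx dP ltr01.
set A := 'D_1 Phi tau in hd.
(* Within d of tau the difference quotients are at most |A| + 1, beyond d at most 2 M / d; so tau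
   lies in E_m for every integer m >= K. *)
pose K := `|A| + 1 + 2 * M / d.
have M0 : 0 <= M by apply: le_trans (PM 0).
have [n Kn] : exists n : nat, K <= n.+1%:R.
  exists (Num.bound K); apply/ltW; apply: lt_trans (archi_boundP _) _.
    by rewrite !addr_ge0// divr_ge0 ?mulr_ge0// ltW.
  by rewrite ltr_nat.
apply: (H n tpi) => t; apply: (@le_trans _ _ (K * `|t - tau|)); last by rewrite ler_wpM2r.
have Md : 0 <= 2 * M / d by rewrite divr_ge0 ?mulr_ge0// ltW.
have [td|td] := ltP `|t - tau| d.
  have h : `|A * (t - tau)| <= `|A| * `|t - tau| by rewrite normrM.
  apply: (@le_trans _ _ (1 * `|t - tau| + `|A| * `|t - tau|)).
    by apply: (ler_normD_eq (hd t td) h); ring.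
  by have := mulr_ge0 Md (normr_ge0 (t - tau)); rewrite /K; lra.
apply: (@le_trans _ _ (2 * M)).
  by apply: le_trans (ler_normB _ _) _; have := PM t; have := PM tau; lra.
have h : 2 * M <= 2 * M / d * `|t - tau|.
  by rewrite mulrAC ler_pdivlMr// ler_wpM2l// mulr_ge0.
have : 0 <= (`|A| + 1) * `|t - tau| by rewrite mulr_ge0// addr_ge0.
by rewrite /K; lra.
Qed.

End Marcinkiewicz.

(** * Angular limits *)

Section ComplexTransforms.
Context {R : realType}.
Local Open Scope complex_scope.
Local Notation mu := (@lebesgue_measure R).
Implicit Types (Phi F : R -> R) (tau t r x y a b : R).

Lemma ltc_normE (a b e : R) :
  (`|(a +i* b) : R[i]| < e%:C) = (Num.sqrt (a ^+ 2 + b ^+ 2) < e).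
Proof. by rewrite normc_def ltcR. Qed.

Lemma gt0_complex (e : R[i]) : 0 < e -> exists2 e' : R, 0 < e' & e = e'%:C.
Proof.
case: e => a b; rewrite ltcE /= => /andP[/eqP b0 a0].
by exists a => //; rewrite b0.
Qed.

Lemma sqrt_sqrD_lt (a b u v e : R) : `|a| < u -> `|b| <= v -> u + v <= e ->
  Num.sqrt (a ^+ 2 + b ^+ 2) < e.
Proof.
move=> au bv uve; have e0 : 0 <= e.
  by have := normr_ge0 a; have := normr_ge0 b; lra.
rewrite -(ger0_norm e0) -sqrtr_sqr ltr_sqrt; last first.
  by rewrite exprn_gt0//; have := normr_ge0 a; have := normr_ge0 b; lra.
have h : (u + v) ^+ 2 <= e ^+ 2.
  by rewrite lerXn2r// nnegrE; have := normr_ge0 a; have := normr_ge0 b; lra.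
apply: lt_le_trans h; rewrite -(real_normK (num_real a)) -(real_normK (num_real b)).
have := normr_ge0 a; have := normr_ge0 b => b0 a0.
have h1 : `|a| ^+ 2 < u ^+ 2 by rewrite ltrXn2r// nnegrE; lra.
have h2 : `|b| ^+ 2 <= v ^+ 2 by rewrite lerXn2r// nnegrE; lra.
have h3 : 0 <= u * v by rewrite mulr_ge0//; lra.
by rewrite sqrrD; lra.
Qed.

Lemma RS_sum_complex (g1 g2 Phi : R -> R) p (t s : nat -> R) :
  RS_sum (fun x => g1 x +i* g2 x) (fun x => (Phi x)%:C) p t s =
  RS_sum g1 Phi p t s +i* RS_sum g2 Phi p t s.
Proof.
rewrite /RS_sum; elim: p => [|p IH]; first by rewrite !big_ord0.
by rewrite !big_ord_recr /= IH; simpc.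
Qed.

Lemma is_RSint_complex (g1 g2 Phi : R -> R) a b (I1 I2 : R) :
  is_RSint g1 Phi a b I1 -> is_RSint g2 Phi a b I2 ->
  is_RSint (fun t => g1 t +i* g2 t) (fun t => (Phi t)%:C) a b (I1 +i* I2).
Proof.
move=> h1 h2 e /gt0_complex[e' e0 ->].
have e2 : 0 < e' / 2 by rewrite divr_gt0.
have [d1 d10 hd1] := h1 _ e2; have [d2 d20 hd2] := h2 _ e2.
exists (Num.min d1 d2); first by rewrite lt_min d10.
move=> p t s tp td; rewrite RS_sum_complex.
have k1 : `|RS_sum g1 Phi p t s - I1| < e' / 2.
  by apply: hd1 => // k /td; rewrite lt_min => /andP[].
have k2 : `|RS_sum g2 Phi p t s - I2| < e' / 2.
  by apply: hd2 => // k /td; rewrite lt_min => /andP[].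
have -> : RS_sum g1 Phi p t s +i* RS_sum g2 Phi p t s - (I1 +i* I2) =
  (RS_sum g1 Phi p t s - I1) +i* (RS_sum g2 Phi p t s - I2) by simpc.
by rewrite ltc_normE; apply: (sqrt_sqrD_lt k1 (ltW k2)); lra.
Qed.

Lemma schwartz_kernelE x y t : x ^+ 2 + y ^+ 2 < 1 ->
  schwartz_kernel (x +i* y) t = kP x y t +i* - kQ x y t.
Proof.
move=> xy1; have D0 := kD_gt0 t xy1.
have Dn0 : kD x y t != 0 by rewrite gt_eqF.
have z0 : expi t - (x +i* y) != 0.
  rewrite /expi; simpc; rewrite eq_complex /=; apply/negP => /andP[/eqP h1 /eqP h2].
  by move: Dn0; rewrite kD_dist h1 h2 !expr0n addr0 eqxx.
apply: (canLR (mulfK z0)); rewrite /expi; simpc.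
have c2 := cos2Dsin2 t; rewrite /kP /kQ /kV; move: Dn0.
have DE := kD_dist x y t; move: DE; set D := kD x y t => DE Dn0.
set c := cos t in c2 DE *; set s := sin t in c2 DE *.
congr (_ +i* _); apply: (mulIf Dn0).
  transitivity ((1 - (x ^+ 2 + y ^+ 2)) * (c - x) + 2 * (x * s - y * c) * (s - y)).
    rewrite DE; transitivity ((c + x) * ((c ^+ 2 + s ^+ 2) + x ^+ 2 + y ^+ 2 - 2 * (x * c + y * s))).
      by ring.
    rewrite c2; transitivity ((1 - (x ^+ 2 + y ^+ 2)) * (c - x) + 2 * (x * s - y * c) * (s - y)
      + 2 * x * (1 - (c ^+ 2 + s ^+ 2))); last by rewrite c2; ring.
    by ring.
  by field.
transitivity ((1 - (x ^+ 2 + y ^+ 2)) * (s - y) - 2 * (x * s - y * c) * (c - x)).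
  rewrite DE; transitivity ((s + y) * ((c ^+ 2 + s ^+ 2) + x ^+ 2 + y ^+ 2 - 2 * (x * c + y * s))).
    by ring.
  rewrite c2; transitivity ((1 - (x ^+ 2 + y ^+ 2)) * (s - y) - 2 * (x * s - y * c) * (c - x)
    + 2 * y * (1 - (c ^+ 2 + s ^+ 2))); last by rewrite c2; ring.
  by ring.
by field.
Qed.

(** The boundary terms at -pi and pi cancel by periodicity of Phi and of the kernels. *)
Lemma schwartz_RS Phi F x y : regularized Phi F ->
  (forall t, Phi (t + 2 * pi) = Phi t) -> x ^+ 2 + y ^+ 2 < 1 ->
  is_RSint (schwartz_kernel (x +i* y)) (fun t => (Phi t)%:C) (- pi) pi
    (II (- pi) pi (fun t => F t * kre x y t) +i* II (- pi) pi (fun t => F t * kim x y t)).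
Proof.
move=> rF per xy1; have ab : - pi <= pi :> R by have := pi_ge0 R; lra.
have D0 t : kD x y t != 0 by rewrite gt_eqF// kD_gt0.
have -> : schwartz_kernel (x +i* y) = (fun t => kP x y t +i* - kQ x y t).
  by apply/funext => t; exact: schwartz_kernelE.
have pE : - pi + 2 * pi = pi :> R by ring.
have Ppi : Phi pi = Phi (- pi) by rewrite -[in LHS]pE per.
have kPpi : kP x y pi = kP x y (- pi) by rewrite -[in LHS]pE kP_2pi.
have kQpi : kQ x y pi = kQ x y (- pi) by rewrite -[in LHS]pE kQ_2pi.
have bk1 : bmfun (- pi) pi (fun t => F t * kre x y t).
  apply: bmfunM; first exact: (regularized_bmfun _ _ rF).
  by apply: bmfun_cont => t _; exact: continuous_kre.
have bk2 : bmfun (- pi) pi (fun t => F t * kim x y t).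
  apply: bmfunM; first exact: (regularized_bmfun _ _ rF).
  by apply: bmfun_cont => t _; exact: continuous_kim.
apply: is_RSint_complex.
  have := is_RSint_by_parts ab rF (fun t _ => is_derive_kP xy1 t)
    (fun t _ => continuousN (@continuous_kre _ _ _ xy1 t)).
  rewrite kPpi Ppi subrr sub0r (@II_eq _ _ _ _ (fun t => - (F t * kre x y t))); last first.
    by move=> t _; rewrite mulrN.
  by rewrite IIN// opprK.
have := is_RSint_by_parts ab rF (fun t _ => rderivN (is_derive_kQ (D0 t)))
  (fun t _ => continuousN (@continuous_kim _ _ _ t (D0 t))).
rewrite kQpi Ppi subrr sub0r (@II_eq _ _ _ _ (fun t => - (F t * kim x y t))); last first.
  by move=> t _; rewrite mulrN.
by rewrite IIN// opprK.
Qed.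

Lemma II_kernel_window Phi F tau x y : regularized Phi F ->
  (forall t, Phi (t + 2 * pi) = Phi t) -> x ^+ 2 + y ^+ 2 < 1 -> `|tau| <= pi ->
  II (- pi) pi (fun t => F t * kre x y t) =
    II (tau - pi) (tau + pi) (fun t => F t * kre x y t) /\
  II (- pi) pi (fun t => F t * kim x y t) =
    II (tau - pi) (tau + pi) (fun t => F t * kim x y t).
Proof.
move=> rF per xy1 taupi; have pi0 := pi_gt0 R.
have D0 t : kD x y t != 0 by rewrite gt_eqF// kD_gt0.
have tau2 : `|tau| <= 2 * pi by lra.
have window k g : (forall t, is_derive t 1 g (k t)) -> continuous k ->
    (forall t, k (t + 2 * pi) = k t) ->
    II (- pi) pi (fun t => F t * k t) = II (tau - pi) (tau + pi) (fun t => F t * k t).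
  move=> dg ck pk.
  have bk a b : bmfun a b (fun t => F t * k t).
    apply: bmfunM; first exact: (regularized_bmfun _ _ rF).
    by apply: bmfun_cont => t _; exact: ck.
  have sh a b : a <= b -> II (a + 2 * pi) (b + 2 * pi) (fun t => F t * k t) =
      II a b (fun t => F t * k t).
    move=> ab; rewrite (II_shift ab rF rF (fun t => esym (per t)) dg ck).
    by apply: II_eq => t _; rewrite pk.
  have := II_window (- pi) bk sh tau2.
  have -> : - pi + tau + 2 * pi = tau + pi by ring.
  have -> : - pi + tau = tau - pi by ring.
  by have -> : - pi + 2 * pi = pi :> R by ring.
split.
- apply: (@window (kre x y) (fun t => - kP x y t)).
  + by move=> t; have := rderivN (is_derive_kP xy1 t); rewrite opprK.
  + exact: continuous_kre.
  + exact: kre_2pi.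
- apply: (@window (kim x y) (kQ x y)).
  + by move=> t; exact: is_derive_kQ.
  + by move=> t; exact: continuous_kim.
  + exact: kim_2pi.
Qed.

Lemma schwartzE Phi F tau x y : regularized Phi F ->
  (forall t, Phi (t + 2 * pi) = Phi t) -> x ^+ 2 + y ^+ 2 < 1 -> `|tau| <= pi ->
  schwartz Phi (x +i* y) =
  ((2 * pi)^-1 * II (tau - pi) (tau + pi) (fun t => F t * kre x y t)) +i*
  ((2 * pi)^-1 * II (tau - pi) (tau + pi) (fun t => F t * kim x y t)).
Proof.
move=> rF per xy1 taupi; have ab : - pi <= pi :> R by have := pi_ge0 R; lra.
rewrite /schwartz (RSint_eq ab (schwartz_RS rF per xy1)).
by have [-> ->] := II_kernel_window rF per xy1 taupi; simpc.
Qed.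

Lemma cos_eq1_lt2pi (u : R) : `|u| < 2 * pi -> cos u = 1 -> u = 0.
Proof.
move=> u2; rewrite -cos_norm => c1; apply/eqP; rewrite -normr_eq0; apply/eqP.
have [//|u0] := eqVneq `|u| 0.
have v0 : 0 < `|u| / 2 < pi.
  by apply/andP; split; [rewrite divr_gt0// lt_neqAle eq_sym u0 normr_ge0|lra].
have := sin_gt0_pi v0; have : cos `|u| = 1 - 2 * sin (`|u| / 2) ^+ 2.
  by rewrite sin2cos2 {1}(_ : `|u| = (`|u| / 2) *+ 2) ?cos_mulr2n -mulr_natr ?divfK//; ring.
by rewrite c1 => h s0; have := exprn_gt0 2 s0; lra.
Qed.

Lemma arg_expi tau : - pi < tau <= pi -> arg (expi tau) = tau.
Proof.
move=> tpi; rewrite /arg; case: xgetP => [u -> [upi]|/(_ tau) h]; last by exfalso; apply: h.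
move=> [h1 h2]; apply/eqP; rewrite -subr_eq0; apply/eqP; apply: cos_eq1_lt2pi.
  move/andP: tpi upi => [? ?] /andP[? ?].
  by rewrite ltr_norml; apply/andP; split; lra.
by rewrite cosB -h1 -h2 -!expr2 cos2Dsin2.
Qed.

Lemma disk_sqr x y : disk (x +i* y) <-> x ^+ 2 + y ^+ 2 < 1.
Proof.
rewrite /disk /= (_ : 1 = (1 : R)%:C)// ltc_normE -[X in _ < X](sqrtr1 R).
by rewrite ltr_sqrt.
Qed.

(* If the whole segment of length rho in direction theta lies in the disk, then
   2 cos (theta - tau) + rho <= 0. *)
Lemma sector_stolz (alpha beta rho : R) tau x y : 0 < rho ->
  sector (expi tau) alpha beta rho `<=` disk ->
  sector (expi tau) alpha beta rho (x +i* y) ->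
  pdist x y (cos tau) (sin tau) < rho / 2 -> stolz (4 / rho) x y tau.
Proof.
move=> rho0 sd [s [th [/andP[s0 srho] thab [xE yE]]]].
have {}xE : x = cos tau + s * cos th by rewrite xE; ring.
have {}yE : y = sin tau + s * sin th by rewrite yE; ring.
have nE (u : R) : (cos tau + u * cos th) ^+ 2 + (sin tau + u * sin th) ^+ 2 =
    1 + 2 * u * cos (th - tau) + u ^+ 2.
  rewrite cosB; transitivity ((cos tau ^+ 2 + sin tau ^+ 2) +
    2 * u * (cos th * cos tau + sin th * sin tau) + u ^+ 2 * (cos th ^+ 2 + sin th ^+ 2)).
    by ring.
  by rewrite !cos2Dsin2 mulr1.
have seg (u : R) : 0 < u < rho -> 2 * cos (th - tau) + u < 0.
  move=> /andP[u0 ur].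
  have /sd : sector (expi tau) alpha beta rho
      ((cos tau + u * cos th) +i* (sin tau + u * sin th)).
    by exists u, th; split; rewrite ?u0 ?ur//; rewrite /expi; simpc.
  by rewrite disk_sqr nE; nra.
(* The limit of [seg] as u tends to rho. *)
have cr : 2 * cos (th - tau) + rho <= 0.
  apply/ler_addgt0Pr => e e0; rewrite add0r.
  have m0 : 0 < Num.min (e / 2) (rho / 2) by rewrite lt_min !divr_gt0.
  have h := seg (rho - Num.min (e / 2) (rho / 2)).
  have m1 : Num.min (e / 2) (rho / 2) <= e / 2 by rewrite ge_min lexx.
  have m2 : Num.min (e / 2) (rho / 2) <= rho / 2 by rewrite ge_min lexx orbT.
  by have := h; rewrite subr_gt0 => {}h; have : 2 * cos (th - tau) + (rho - Num.min (e / 2) (rho / 2)) < 0;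
    [apply: h; apply/andP; split; lra|lra].
have dE : pdist x y (cos tau) (sin tau) = s.
  rewrite /pdist xE yE (_ : _ + _ = s ^+ 2 * (cos th ^+ 2 + sin th ^+ 2)).
    by rewrite cos2Dsin2 mulr1 sqrtr_sqr gtr0_norm.
  by ring.
rewrite /stolz dE => s2; have xyE : x ^+ 2 + y ^+ 2 = 1 + 2 * s * cos (th - tau) + s ^+ 2.
  by rewrite xE yE nE.
(* By [cr], 1 - |z|^2 = - s (2 cos (th - tau) + s) >= s (rho - s). Together with 1 - q^2 <= 2 (1 -
   q) this yields the aperture 4 / rho. *)
have gap : s * (rho / 2) <= 1 - (x ^+ 2 + y ^+ 2).
  have : s * (rho / 2) <= s * (rho - s) by rewrite ler_pM2l//; lra.
  have : s * (2 * cos (th - tau) + rho) <= 0 by rewrite pmulr_rle0.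
  by rewrite xyE; lra.
have sr0 : 0 < s * (rho / 2) by rewrite mulr_gt0// divr_gt0.
split; first by lra.
set q := pdist x y 0 0.
have q2 : x ^+ 2 + y ^+ 2 = q ^+ 2.
  by rewrite /q /pdist !subr0 sqr_sqrtr// addr_ge0// sqr_ge0.
have q0 : 0 <= q by exact: pdist_ge0.
have q1 : q < 1 by rewrite -(@expr_lt1 _ 2)// -q2; lra.
rewrite mulrAC ler_pdivlMr//.
have : 1 - q ^+ 2 <= 2 * (1 - q) by have := sqr_ge0 (1 - q); rewrite sqrrB; lra.
by rewrite q2 in gap; lra.
Qed.

(** The radial point of modulus 1 - eps is at distance exactly eps from e^{i tau}, so the comparison
    there involves the truncation at eps. *)
Lemma hilbert_trunc_cvg Phi F tau A (l : R) : regularized Phi F ->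
  approx_by_line Phi tau (Phi tau) A ->
  radial_im F tau r @[r --> 1^'-] --> l ->
  hilbert_trunc Phi tau eps @[eps --> 0^'+] --> l.
Proof.
move=> rF HA /cvgrPdist_le hl; apply/cvgrPdist_le => e e0.
have e2 : 0 < e / 2 by rewrite divr_gt0.
have [d d0 hd] := conj_comparison 1 rF HA e2.
have [d' /= d'0 hd'] := hl _ e2.
have m0 : 0 < Num.min d (Num.min d' 1) by rewrite !lt_min d0 d'0 ltr01.
exists (Num.min d (Num.min d' 1)) => //= eps; rewrite /ball_ /= sub0r normrN => + eps0.
rewrite gtr0_norm// !lt_min => /and3P[ed ed' e1].
have r1 : 1 - eps <= 1 by lra.
have pE := polar_pdist tau r1.
have h1 := hd _ _ (@polar_stolz _ (1 - eps) tau _).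
have r01 : 0 <= 1 - eps < 1 by apply/andP; split; lra.
move: h1 => /(_ r01); rewrite pE (_ : 1 - (1 - eps) = eps); last by ring.
move=> /(_ ed) h1.
have h2 : `|l - radial_im F tau (1 - eps)| <= e / 2.
  have de : 1 - (1 - eps) = eps by ring.
  by apply: hd'; [rewrite /ball_ /= de gtr0_norm|lra].
by have := ler_normD_eq h2 h1 (subrKA _ _ _); rewrite -splitr.
Qed.

Lemma schwartz_stolz_limit Phi F tau A (l C e : R) : regularized Phi F ->
  (forall t, Phi (t + 2 * pi) = Phi t) -> `|tau| <= pi ->
  approx_by_line Phi tau (Phi tau) A ->
  hilbert_trunc Phi tau eps @[eps --> 0^'+] --> l -> 0 < e ->
  exists2 d : R, 0 < d & forall x y, stolz C x y tau ->
    pdist x y (cos tau) (sin tau) < d ->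
    `|A +i* ((2 * pi)^-1 * l) - schwartz Phi (x +i* y)| < e%:C.
Proof.
move=> rF per taupi HA hl e0; have pi0 := pi_gt0 R.
have p2 : 0 < (2 * pi)^-1 :> R by rewrite invr_gt0 mulr_gt0.
have [_ [M PM] _ _ _] := rF.
(* After division by 2 pi this is e / 8; it occurs once in the real part and twice in the imaginary
   part, each of which may be as large as e / 2. *)
pose e1 := e * pi / 4; have e10 : 0 < e1 by rewrite /e1 !mulr_gt0.
have bF a b : bmfun a b F := regularized_bmfun a b rF.
have [d1 d10 h1] := fatou_line bF (regularized_bound rF PM) (regularized_approx rF HA) C e10.
have [d2 d20 h2] := conj_comparison C rF HA e10.
have /cvgrPdist_le /(_ _ e10) [d3 /= d30 h3] := hl.
exists (Num.min d1 (Num.min d2 d3)); first by rewrite !lt_min d10 d20.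
move=> x y st; rewrite !lt_min => /and3P[k1 k2 k3].
have xy1 := st.1.
have {}h1 := h1 x y st k1; have {}h2 := h2 x y st k2.
have eps0 := stolz_eps_gt0 st.
have {}h3 : `|l - hilbert_trunc Phi tau (pdist x y (cos tau) (sin tau))| <= e1.
  by apply: h3 => //=; rewrite sub0r normrN gtr0_norm.
rewrite (schwartzE rF per xy1 taupi).
set I1 := II _ _ (fun t => F t * kre x y t) in h1 *.
set I2 := II _ _ (fun t => F t * kim x y t) in h2 *.
rewrite (_ : _ - _ = (A - (2 * pi)^-1 * I1) +i*
  ((2 * pi)^-1 * l - (2 * pi)^-1 * I2)); last by simpc.
rewrite ltc_normE.
have b1 : `|A - (2 * pi)^-1 * I1| < e / 2.
  have -> : A - (2 * pi)^-1 * I1 = (2 * pi)^-1 * (2 * pi * A - I1).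
    by rewrite mulrBr mulrA mulVf ?mul1r// gt_eqF// mulr_gt0.
  rewrite normrM (gtr0_norm p2) distrC ltr_pdivrMl ?mulr_gt0//.
  by apply: le_lt_trans h1 _; rewrite /e1; have := mulr_gt0 e0 pi0; lra.
have b2 : `|(2 * pi)^-1 * l - (2 * pi)^-1 * I2| <= e / 2.
  rewrite -mulrBr normrM (gtr0_norm p2) ler_pdivrMl ?mulr_gt0//.
  rewrite distrC in h2; have := ler_normD_eq h3 h2 (subrKA _ _ _).
  move/le_trans; apply; rewrite /e1; have := mulr_gt0 e0 pi0; lra.
by apply: (sqrt_sqrD_lt b1 b2); lra.
Qed.

Lemma stolz_angular_limit Phi tau (L : R[i]) :
  (forall C e : R, 0 < e -> exists2 d : R, 0 < d & forall x y, stolz C x y tau ->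
     pdist x y (cos tau) (sin tau) < d -> `|L - schwartz Phi (x +i* y)| < e%:C) ->
  angular_limit (schwartz Phi) (expi tau) L.
Proof.
move=> H g [cg gd g1] [alpha [beta [rho [_ rho0 sd nt]]]].
have [_ _ gl] := (continuous_within_itvP (g : R -> R[i]^o) (@ltr01 R)).1 cg.
rewrite g1 in gl.
apply/cvgrPdist_lt => e /gt0_complex[e' e'0 ->].
have [d d0 hd] := H (4 / rho) e' e'0.
have m0 : 0 < (Num.min d (rho / 2))%:C :> R[i].
  by rewrite ltcR lt_min d0 divr_gt0.
have nd := (@cvgrPdist_lt _ _ _ _ _ _ _).1 gl _ m0.
have ns := gl _ nt.
near=> t.
have t0 : 0 <= t < 1 by apply/andP; split; near: t; [exact: nbhs_left_ge|exact: nbhs_left_lt].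
have hs : sector (expi tau) alpha beta rho (g t).
  have : forall u : R, 0 <= u < 1 -> g u = g t -> sector (expi tau) alpha beta rho (g t).
    by near: t; exact: ns.
  by move=> h; exact: (h t t0).
have hdist : `|expi tau - g t| < (Num.min d (rho / 2))%:C by near: t; exact: nd.
case: (g t) hs hdist => x y hs; rewrite /expi.
rewrite (_ : _ - _ = (cos tau - x) +i* (sin tau - y)); last by simpc.
rewrite ltc_normE -/(pdist _ _ _ _) pdistC lt_min => /andP[k1 k2].
by apply: hd => //; exact: (sector_stolz rho0 sd hs k2).
Unshelve. all: by end_near. Qed.

End ComplexTransforms.

(** Applied at pi, this reduces the half-open parameter interval of the circle to the open one, on
    which the radial limits are known. *)
Lemma ae_neq (R : realType) (a : R) : {ae @lebesgue_measure R, forall t, t != a}.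
Proof.
exists [set a]; split; first exact: measurable_set1.
- exact: lebesgue_measure_set1.
- by move=> t /= /negP; rewrite negbK => /eqP.
Qed.

Unset Implicit Arguments.
Set Strict Implicit.
Local Open Scope complex_scope.

Theorem corollary8 (R : realType) (Phi : R -> R)
    (Phi_periodic : periodic Phi (2 * pi))
    (Phi_bounded : bounded_fun Phi)
    (Phi_derivable : {ae @lebesgue_measure R, forall t, derivable Phi t 1}) :
  (forall z : R[i], disk z -> schwartz_exists Phi z) /\
  circle_ae (fun zeta : R[i] =>
    hilbert_exists Phi (arg zeta) /\
    angular_limit (schwartz Phi) zeta
      (derive1 Phi (arg zeta) +i* hilbert Phi (arg zeta))).
Proof.
have per x : Phi (x + 2 * pi) = Phi x by exact: Phi_periodic.
have [M PM] : exists M : R, forall x, `|Phi x| <= M.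
  by have [M [_ hM]] := Phi_bounded; exists (M + 1) => x; apply: hM; rewrite // ltrDl.
have cP : {ae @lebesgue_measure R, forall x, {for x, continuous Phi}}.
  by apply: aeS Phi_derivable => x /derivable1_diffP/differentiable_continuous.
have rF := regularized_envelope PM cP; set F := usc_envelope Phi in rF.
split.
  by case=> x y /disk_sqr xy1; eexists; exact: schwartz_RS rF per xy1.
have Hae := @filterI _ _ (ae_filter_ringOfSetsType lebesgue_measure) _ _ Phi_derivable
  (@filterI _ _ (ae_filter_ringOfSetsType lebesgue_measure) _ _
    (radial_im_cvg rF per) (ae_neq (pi : R))).
apply: aeS Hae => tau [dP [rc taupi]] tpi; have /andP[t1 t2] := tpi.
have tpi' : - pi < tau < pi by rewrite t1 lt_neqAle taupi.
have taule : `|tau| <= pi by rewrite ler_norml t2 ltW.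
rewrite (arg_expi tpi).
have HA := derivable_approx dP.
have /cvg_ex[l hl] := rc tpi' dP.
have hT := hilbert_trunc_cvg rF HA hl.
have limE : lim (hilbert_trunc Phi tau eps @[eps --> 0^'+]) = l by exact: cvg_lim hT.
split.
  split; last by apply/cvg_ex; exists l.
  by move=> eps e01; have [h1 h2] := hilbert_kernel_RS tau rF e01; split; eexists; eassumption.
apply: stolz_angular_limit => C e e0.
rewrite /hilbert limE derive1E.
exact: (schwartz_stolz_limit _ rF per taule HA hT e0).
Qed.
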